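(* The Activation 2-DP Augmentation problem admits a polynomial time algorithm. Consequently, both the Activation 2 Disjoint st-Paths problem (Activation 2-DP) and the Activation 2 Edge Disjoint st-Paths problem (Activation 2-EDP) admit approximation ratio 1.5.
   Context: Activation setting: we are given an undirected multigraph G=(V,E) where every edge e=uv has two non-negative activation costs c_e^u, c_e^v. For an edge set F, the activation cost is ℓ_F(V)=∑_{v∈V} ℓ_F(v), where ℓ_F(v)=max{c_e^v : e∈F incident to v} (max over empty set is 0). In Activation k-DP we are given G with activation costs, nodes s,t∈V and an integer k, and seek an edge set F⊆E containing k internally node disjoint st-paths of minimum activation cost. Activation k-EDP is the same with edge disjoint st-paths. In the augmentation version (Activation k-DP Augmentation) we are additionally given a subgraph G_0=(V,E_0) of G of activation cost zero that already contains k-1 internally disjoint st-paths, and seek an augmenting edge set F⊆E∖E_0 of minimum activation cost such that G_0∪F contains k internally disjoint st-paths; here k=2, so G_0 is an st-path P. *)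

(* Defs.v *)
From mathcomp Require Import all_boot all_order all_algebra.

Set Implicit Arguments.
Unset Strict Implicit.
Unset Printing Implicit Defensive.

Import Order.TTheory GRing.Theory Num.Theory.

Local Open Scope nat_scope.

(** Polynomial time refers to N. D. Jones' WHILE language over binary trees, in its
    one-variable form (the language I of "Computability and Complexity from a
    Programming Perspective"), with unit cost per executed operation.  A
    program is presented point-free, as a partial function on trees: the
    argument is the content of the single variable.  Since trees are immutable
    and can be shared, every operation takes constant time on a pointer
    machine, so this model is polynomially equivalent to Turing machines. *)

Inductive tree : Type := Leaf | Node of tree & tree.

Fixpoint tree_size (x : tree) : nat :=
  if x is Node a b then (tree_size a + tree_size b).+1 else 1.

Definition tree_hd (x : tree) : tree := if x is Node a _ then a else Leaf.
Definition tree_tl (x : tree) : tree := if x is Node _ b then b else Leaf.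

Inductive prog : Type :=
| PId
| PLeaf
| PHd
| PTl
| PNode of prog & prog
| PSeq of prog & prog
| PIf of prog & prog & prog
| PWhile of prog & prog.

(** [run p x y n]: on input [x], [p] halts with output [y] after [n] steps.
    In [PSeq p q], [p] is run first; [Leaf] is the truth value "false". *)
Inductive run : prog -> tree -> tree -> nat -> Prop :=
| RunId x : run PId x x 1
| RunLeaf x : run PLeaf x Leaf 1
| RunHd x : run PHd x (tree_hd x) 1
| RunTl x : run PTl x (tree_tl x) 1
| RunNode p q x y z m n :
    run p x y m -> run q x z n -> run (PNode p q) x (Node y z) (m + n).+1
| RunSeq p q x y z m n :
    run p x y m -> run q y z n -> run (PSeq p q) x z (m + n).+1
| RunIfTrue p q r x a b y m n :
    run p x (Node a b) m -> run q x y n -> run (PIf p q r) x y (m + n).+1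
| RunIfFalse p q r x y m n :
    run p x Leaf m -> run r x y n -> run (PIf p q r) x y (m + n).+1
| RunWhileStop p q x m :
    run p x Leaf m -> run (PWhile p q) x x m.+1
| RunWhileStep p q x a b y z m n k :
    run p x (Node a b) m -> run q x y n -> run (PWhile p q) y z k ->
    run (PWhile p q) x z (m + n + k).+1.

(** The bound on the size of the output excludes outputs that are small only
    thanks to sharing. *)
Definition runs_in_polytime (I : Type) (enc : I -> tree)
    (accept : I -> tree -> Prop) (p : prog) : Prop :=
  exists c d : nat, forall i : I, exists (y : tree) (n : nat),
    [/\ run p (enc i) y n,
        n <= c * tree_size (enc i) ^ d,
        tree_size y <= c * tree_size (enc i) ^ d
      & accept i y].

Fixpoint enc_seq (s : seq tree) : tree :=
  if s is x :: s' then Node x (enc_seq s') else Leaf.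

Definition enc_bool (b : bool) : tree := if b then Node Leaf Leaf else Leaf.

Definition enc_option (T : Type) (enc : T -> tree) (o : option T) : tree :=
  if o is Some x then Node (enc x) Leaf else Leaf.

(** Vertex numbers and the number of vertices are written in unary, which is
    polynomially equivalent to listing the vertices. *)
Definition enc_unary (n : nat) : tree := enc_seq (nseq n Leaf).

(** Binary, least significant bit first. *)
Fixpoint pos_bits (p : BinNums.positive) : seq bool :=
  match p with
  | BinNums.xH => [:: true]
  | BinNums.xO p' => false :: pos_bits p'
  | BinNums.xI p' => true :: pos_bits p'
  end.

Definition nat_bits (n : nat) : seq bool :=
  if bin_of_nat n is BinNums.Npos p then pos_bits p else [::].

Definition enc_binary (n : nat) : tree := enc_seq (map enc_bool (nat_bits n)).

(** Injective on nonnegative rationals only: the sign is dropped. *)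
Definition enc_rat (q : rat) : tree :=
  Node (enc_binary `|numq q|%N) (enc_binary `|denq q|%N).

(** A set of indices is encoded by its characteristic sequence. *)
Definition enc_set (m : nat) (F : {set 'I_m}) : tree :=
  enc_seq [seq enc_bool (e \in F) | e <- enum 'I_m].

Record min_problem : Type := MinProblem {
  instance : Type;
  solution : instance -> Type;
  enc_instance : instance -> tree;
  enc_solution : forall i : instance, solution i -> tree;
  feasible : forall i : instance, solution i -> Prop;
  objective : forall i : instance, solution i -> rat
}.

(** Infeasible instances have to be recognized. *)
Definition solves_within (P : min_problem)
    (good : forall i : instance P, solution i -> Prop)
    (i : instance P) (y : tree) : Prop :=
  exists o : option (solution i),
    y = enc_option (@enc_solution P i) o /\
    match o with
    | Some F => feasible F /\ good i F
    | None => forall F : solution i, ~ feasible F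
    end.

Definition is_minimum (P : min_problem) (i : instance P) (F : solution i) :
    Prop :=
  forall F' : solution i, feasible F' -> (objective F <= objective F')%R.

Definition is_within_ratio (rho : rat) (P : min_problem) (i : instance P)
    (F : solution i) : Prop :=
  forall F' : solution i, feasible F' -> (objective F <= rho * objective F')%R.

Definition admits_polytime_algorithm (P : min_problem) : Prop :=
  exists p : prog,
    runs_in_polytime (@enc_instance P) (solves_within (@is_minimum P)) p.

Definition admits_approximation_ratio (P : min_problem) (rho : rat) : Prop :=
  exists p : prog,
    runs_in_polytime (@enc_instance P)
      (solves_within (@is_within_ratio rho P)) p.

(** The edge [e] joins [end1 e] and [end2 e]; its activation costs at these
    two nodes are [cost1 e] and [cost2 e].  Parallel edges are allowed, loops
    are not. *)
Record agraph : Type := AGraph {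
  nv : nat;
  ne : nat;
  end1 : 'I_ne -> 'I_nv;
  end2 : 'I_ne -> 'I_nv;
  cost1 : 'I_ne -> rat;
  cost2 : 'I_ne -> rat;
  ends_neq : forall e, end1 e != end2 e;
  cost1_ge0 : forall e, (0 <= cost1 e)%R;
  cost2_ge0 : forall e, (0 <= cost2 e)%R
}.

Definition vertex (G : agraph) : finType := 'I_(nv G).
Definition edge (G : agraph) : finType := 'I_(ne G).

Definition enc_edge (G : agraph) (e : 'I_(ne G)) : tree :=
  Node (Node (enc_unary (end1 e)) (enc_rat (cost1 e)))
       (Node (enc_unary (end2 e)) (enc_rat (cost2 e))).

Definition enc_graph (G : agraph) : tree :=
  Node (enc_unary (nv G)) (enc_seq [seq enc_edge e | e <- enum 'I_(ne G)]).

Section Graph.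
Variable G : agraph.
Implicit Types (e : edge G) (F : {set edge G}) (u v s t : vertex G).

Definition incident e v : bool := (v == end1 e) || (v == end2 e).

(** Only meaningful when [e] is incident to [v]. *)
Definition edge_cost e v : rat := if v == end1 e then cost1 e else cost2 e.

Definition node_activation F v : rat :=
  \big[Num.max/0%R]_(e in F | incident e v) edge_cost e v.

Definition activation_cost F : rat := (\sum_(v : vertex G) node_activation F v)%R.

Definition joins e u v : bool :=
  ((u == end1 e) && (v == end2 e)) || ((u == end2 e) && (v == end1 e)).

(** A walk from [u] is the sequence of its (edge, node reached) pairs. *)
Definition walk : Type := seq (edge G * vertex G).
Implicit Types p q : walk.

Fixpoint is_walk F u (p : walk) v : bool :=
  if p is (e, w) :: p' then [&& e \in F, joins e u w & is_walk F w p' v]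
  else u == v.

Definition is_path F s t p : bool := is_walk F s p t && uniq (s :: unzip2 p).

Definition internal_nodes s t p : seq (vertex G) :=
  [seq v <- unzip2 p | (v != s) && (v != t)].

Definition edge_disjoint p q : bool := ~~ has [in unzip1 p] (unzip1 q).

(** Edge disjointness is implied for distinct simple st-paths, but it has to be
    required so that an edge st is not counted as several disjoint paths. *)
Definition internally_disjoint s t p q : bool :=
  edge_disjoint p q && ~~ has [in internal_nodes s t p] (internal_nodes s t q).

Definition has_disjoint_paths k s t F : Prop :=
  exists ps : seq walk,
    [/\ size ps = k, all (is_path F s t) ps
      & pairwise (internally_disjoint s t) ps].

Definition has_edge_disjoint_paths k s t F : Prop :=
  exists ps : seq walk,
    [/\ size ps = k, all (is_path F s t) ps & pairwise edge_disjoint ps].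

End Graph.

Record dp_instance : Type := DpInstance {
  dp_graph : agraph;
  dp_s : vertex dp_graph;
  dp_t : vertex dp_graph;
  dp_s_neq_t : dp_s != dp_t
}.

Definition enc_dp (i : dp_instance) : tree :=
  Node (enc_graph (dp_graph i)) (Node (enc_unary (dp_s i)) (enc_unary (dp_t i))).

Definition activation_DP (k : nat) : min_problem := {|
  instance := dp_instance;
  solution := fun i => {set edge (dp_graph i)};
  enc_instance := enc_dp;
  enc_solution := fun i F => enc_set F;
  feasible := fun i F => has_disjoint_paths k (dp_s i) (dp_t i) F;
  objective := fun i F => activation_cost F
|}.

Definition activation_EDP (k : nat) : min_problem := {|
  instance := dp_instance;
  solution := fun i => {set edge (dp_graph i)};
  enc_instance := enc_dp;
  enc_solution := fun i F => enc_set F;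
  feasible := fun i F => has_edge_disjoint_paths k (dp_s i) (dp_t i) F;
  objective := fun i F => activation_cost F
|}.

Record dp_aug_instance (k : nat) : Type := DpAugInstance {
  aug_base : dp_instance;
  aug_E0 : {set edge (dp_graph aug_base)};
  aug_E0_cost : activation_cost aug_E0 = 0%R;
  aug_E0_paths :
    has_disjoint_paths k.-1 (dp_s aug_base) (dp_t aug_base) aug_E0
}.

Definition enc_dp_aug (k : nat) (i : dp_aug_instance k) : tree :=
  Node (enc_dp (aug_base i)) (enc_set (aug_E0 i)).

Definition activation_DP_augmentation (k : nat) : min_problem := {|
  instance := dp_aug_instance k;
  solution := fun i => {set edge (dp_graph (aug_base i))};
  enc_instance := @enc_dp_aug k;
  enc_solution := fun i F => enc_set F;
  feasible := fun i F =>
    [disjoint F & aug_E0 i] /\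
    has_disjoint_paths k (dp_s (aug_base i)) (dp_t (aug_base i))
      (aug_E0 i :|: F);
  objective := fun i F => activation_cost F
|}.

(* Main.v *)
Require Import Defs.
From mathcomp Require Import all_boot all_order all_algebra.
From mathcomp Require Import zify.

Set Implicit Arguments.
Unset Strict Implicit.
Unset Printing Implicit Defensive.

Import Order.TTheory GRing.Theory Num.Theory.

(** Augmentation.  Let P = v_0 ... v_m be the free st-path.  A set of edges
    completes P to two disjoint paths iff it contains ears Q_1, ..., Q_r of P,
    Q_i going from v_(a_i) to v_(b_i), with a_1 = 0, b_r = m, b_i increasing and
    b_(i-1) <= a_(i+1) < b_i, where b_0 = 1.  The only vertices of P that two ears
    can share are v_(b_i) = v_(a_(i+2)).  So a shortest path algorithm on pairs (pending end
    v_(b_(i-1)) with its cost, current directed edge), which charges each vertex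
    when the ear leaves it, or once its last use is known, finds a solution: its
    length bounds the activation cost of the edges used from above, and an optimal
    solution without repeated vertices off P charges every vertex once.

    Approximation.  Guess the levels of s and t, make them free, take a cheapest
    path P and augment it optimally.  The two paths of an optimal solution only
    share s and t, so P costs at most half of the remaining cost, and the
    augmentation at most all of it.

    Edge-disjoint paths.  A solution with fewest edges is a chain of pairs of
    internally disjoint paths between consecutive common vertices.  Find the best
    chain by a shortest path algorithm on pairs (vertex, level).  Having two
    edge-disjoint paths is transitive, so overlaps of the pieces do no harm. *)

(** * Polynomial-time functions between encoded types *)

(** A node pays the maximum over its edges, so activation costs are not additive over edges; with
    the current directed edge in the state, the maximum at an inner node of an ear depends on two
    consecutive edges only.

    Guessing the levels of the two ends is what makes the factor one half possible: the two paths of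
    a solution divide the cost between them only away from their common ends, where both rely on the
    same payment.

    One search finds both the first path and its augmentation. If the two-node list [[:: u; v]]
    takes the place of a path, no ear can end before [v], so a cheapest ear sequence is a cheapest
    walk from [u] to [v]. Likewise, one outer search serves both approximations; for 2-DP it may
    only use a block from [s] to [t].

    Optimality is expressed by level functions on nodes. A search result has levels whose sum is at
    most its length, and any competing solution with levels [L] forces the search to succeed within
    a bound in terms of [L]. Activation costs enter only at the end, scaled to integers. *)

Class Enc (A : Type) := enc : A -> tree.
#[global] Instance Enc_tree : Enc tree := id.
#[global] Instance Enc_nat : Enc nat := enc_unary.
#[global] Instance Enc_bool : Enc bool := enc_bool.
#[global] Instance Enc_seq A {eA : Enc A} : Enc (seq A) := fun s => enc_seq (map enc s).
#[global] Instance Enc_prod A B {eA : Enc A} {eB : Enc B} : Enc (A * B) :=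
  fun p => Node (enc p.1) (enc p.2).
#[global] Instance Enc_opt A {eA : Enc A} : Enc (option A) := enc_option enc.

Definition sz A {eA : Enc A} (a : A) := tree_size (enc a).

Arguments sz : simpl never.

Lemma tree_size_gt0 x : 0 < tree_size x.
Proof. by case: x. Qed.

Lemma sz_gt0 A {eA : Enc A} (a : A) : 0 < sz a.
Proof. exact: tree_size_gt0. Qed.

Lemma sz_pair A B {eA : Enc A} {eB : Enc B} (p : A * B) : sz p = (sz p.1 + sz p.2).+1.
Proof. by []. Qed.

Lemma sz_nil A {eA : Enc A} : sz (@nil A) = 1.
Proof. by []. Qed.

Lemma sz_cons A {eA : Enc A} (x : A) s : sz (x :: s) = (sz x + sz s).+1.
Proof. by []. Qed.

Lemma sz_cat A {eA : Enc A} (s1 s2 : seq A) : sz (s1 ++ s2) + 1 = sz s1 + sz s2.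
Proof. by elim: s1 => [|x s1 IH] /=; rewrite ?sz_cons ?sz_nil; lia. Qed.

Lemma sz_rcons A {eA : Enc A} (x : A) s : sz (rcons s x) = (sz x + sz s).+1.
Proof. by have := @sz_cat A eA s [:: x]; rewrite cats1 sz_cons sz_nil; lia. Qed.

Lemma sz_rev A {eA : Enc A} (s : seq A) : sz (rev s) = sz s.
Proof. by elim: s => [|x s IH] //; rewrite rev_cons sz_rcons sz_cons IH. Qed.

Lemma size_sz A {eA : Enc A} (s : seq A) : size s < sz s.
Proof. by elim: s => [|x s IH] //=; rewrite sz_cons; have := @sz_gt0 A eA x; lia. Qed.

Lemma sz_mem (A : eqType) {eA : Enc A} (x : A) s : x \in s -> sz x <= sz s.
Proof.
elim: s => // y s IH; rewrite inE sz_cons => /orP[/eqP->|/IH h].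
  by rewrite ltnW // ltnS leq_addr.
by rewrite ltnW // ltnS (leq_trans h) ?leq_addl.
Qed.

Lemma sz_bounded A {eA : Enc A} (s : seq A) B :
  all (fun x => sz x <= B) s -> sz s <= size s * B.+1 + 1.
Proof.
elim: s => [|x s IH] /=; first by rewrite sz_nil.
by move=> /andP[hx /IH]; rewrite sz_cons; lia.
Qed.

Lemma sz_nat n : sz n = n.*2.+1.
Proof. by elim: n => //= n; rewrite /sz /= => ->; lia. Qed.

Lemma sz_bool (b : bool) : sz b <= 3.
Proof. by case: b. Qed.

Lemma sz_bits (s : seq bool) : sz s <= 4 * size s + 1.
Proof. by elim: s => [|b s IH] //=; rewrite sz_cons; have := sz_bool b; lia. Qed.

Lemma sz_some A {eA : Enc A} (x : A) : sz (Some x) = (sz x).+2.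
Proof. by rewrite /sz /=; lia. Qed.

(** * Polynomial bounds *)

Definition pbnd A {eA : Enc A} (f : A -> nat) :=
  exists c d, forall a, f a <= c * sz a ^ d.

Section Pbnd.
Context {A : Type} {eA : Enc A}.
Implicit Types f g : A -> nat.

Lemma pbnd_le f g : (forall a, f a <= g a) -> pbnd g -> pbnd f.
Proof.
by move=> h [c [d H]]; exists c, d => a; apply: leq_trans (h a) (H a).
Qed.

Lemma pbnd_cst k : pbnd (fun=> k).
Proof. by exists k, 0 => a; rewrite expn0 muln1. Qed.

Lemma pbnd_sz : pbnd (fun a : A => sz a).
Proof. by exists 1, 1 => a; rewrite expn1 mul1n. Qed.

Lemma pbnd_add f g : pbnd f -> pbnd g -> pbnd (fun a => f a + g a).
Proof.
move=> [c [d H]] [c' [d' H']]; exists (c + c'), (d + d') => a.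
rewrite mulnDl; apply: leq_add.
  by apply: leq_trans (H a) _; rewrite leq_mul2l leq_pexp2l ?orbT ?sz_gt0 ?leq_addr.
by apply: leq_trans (H' a) _; rewrite leq_mul2l leq_pexp2l ?orbT ?sz_gt0 ?leq_addl.
Qed.

Lemma pbnd_mul f g : pbnd f -> pbnd g -> pbnd (fun a => f a * g a).
Proof.
move=> [c [d H]] [c' [d' H']]; exists (c * c'), (d + d') => a.
by rewrite expnD mulnACA leq_mul.
Qed.

Lemma pbnd_exp f k : pbnd f -> pbnd (fun a => f a ^ k).
Proof.
move=> Hf; elim: k => [|k IH]; first exact: pbnd_cst 1.
have [c [d H]] := pbnd_mul Hf IH.
by exists c, d => a; rewrite expnS.
Qed.

Lemma pbnd_S f : pbnd f -> pbnd (fun a => (f a).+1).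
Proof.
move=> H; apply: pbnd_le (pbnd_add H (pbnd_cst 1)) => a.
by rewrite addn1.
Qed.

Lemma pbnd_comp B {eB : Enc B} (h : A -> B) (k : B -> nat) :
  pbnd (fun a => sz (h a)) -> pbnd k -> pbnd (fun a => k (h a)).
Proof.
move=> Hh [c [d H]].
by apply: pbnd_le (pbnd_mul (pbnd_cst c) (pbnd_exp d Hh)) => a.
Qed.

End Pbnd.

Ltac pbd := repeat first
  [ assumption | apply: pbnd_cst | apply: pbnd_sz | apply: pbnd_S
  | apply: pbnd_add | apply: pbnd_mul | apply: pbnd_exp ].

(** The size of the result is bounded apart from the time: [PNode] can share a subtree, so a short
    run may build a tree of exponential size, and in a composition the bounds of the second function
    refer to that size. *)
Definition ptime A B {eA : Enc A} {eB : Enc B} (f : A -> B) :=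
  exists p t, [/\ pbnd t, pbnd (fun a => sz (f a))
    & forall a, exists2 n, n <= t a & run p (enc a) (enc (f a)) n].

Section Basic.
Context {A : Type} {eA : Enc A}.

Lemma pt_sz B {eB : Enc B} (f : A -> B) : ptime f -> pbnd (fun a => sz (f a)).
Proof. by move=> [p [t []]]. Qed.

Lemma pt_ext B {eB : Enc B} (f g : A -> B) : f =1 g -> ptime f -> ptime g.
Proof.
move=> E [p [t [h1 h2 h3]]]; exists p, t; split=> //.
  by apply: pbnd_le h2 => a; rewrite E.
by move=> a; rewrite -E.
Qed.

(** Several conversions leave the tree unchanged, such as reading an option as a list of length at
    most one or a unary number as a list of leaves. *)
Lemma pt_coerce B {eB : Enc B} (f : A -> B) :
  (forall a, enc (f a) = enc a) -> ptime f.
Proof.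
move=> E; exists PId, (fun=> 1); split; first exact: pbnd_cst.
  by apply: pbnd_le pbnd_sz => a; rewrite /sz E.
by move=> a; exists 1 => //; rewrite E; exact: RunId.
Qed.

Lemma pt_id : ptime (fun a : A => a).
Proof. exact: pt_coerce. Qed.

Lemma pt_comp B C {eB : Enc B} {eC : Enc C} (f : A -> B) (g : B -> C) :
  ptime g -> ptime f -> ptime (fun a => g (f a)).
Proof.
move=> [q [t' [h1' h2' h3']]] [p [t [h1 h2 h3]]].
exists (PSeq p q), (fun a => (t a + t' (f a)).+1); split.
- by apply: pbnd_S; apply: pbnd_add => //; exact: pbnd_comp.
- exact: (pbnd_comp h2 h2').
- move=> a; have [n hn rn] := h3 a; have [m hm rm] := h3' (f a).
  by exists (n + m).+1; [lia | exact: RunSeq rn rm].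
Qed.

Lemma pt_node B C D {eB : Enc B} {eC : Enc C} {eD : Enc D}
    (f : A -> B) (g : A -> C) (h : A -> D) :
  (forall a, enc (h a) = Node (enc (f a)) (enc (g a))) ->
  ptime f -> ptime g -> ptime h.
Proof.
move=> E [p [t [h1 h2 h3]]] [q [t' [h1' h2' h3']]].
exists (PNode p q), (fun a => (t a + t' a).+1); split.
- by pbd.
- apply: (@pbnd_le _ _ _ (fun a => (sz (f a) + sz (g a)).+1)); last by pbd.
  by move=> a; rewrite /sz E.
- move=> a; have [n hn rn] := h3 a; have [m hm rm] := h3' a.
  by exists (n + m).+1; [lia | rewrite E; exact: RunNode rn rm].
Qed.

Lemma pt_pair B C {eB : Enc B} {eC : Enc C} (f : A -> B) (g : A -> C) :
  ptime f -> ptime g -> ptime (fun a => (f a, g a)).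
Proof. exact: pt_node. Qed.

Lemma pt_cons B {eB : Enc B} (f : A -> B) (g : A -> seq B) :
  ptime f -> ptime g -> ptime (fun a => f a :: g a).
Proof. exact: pt_node. Qed.

Lemma pt_tree_cst (x : tree) : ptime (fun _ : A => x).
Proof.
elim: x => [|x IHx y IHy].
  exists PLeaf, (fun=> 1); split; try exact: pbnd_cst.
  by move=> a; exists 1 => //; exact: RunLeaf.
exact: (@pt_node _ _ _ _ _ _ (fun=> x) (fun=> y)).
Qed.

Lemma pt_cst B {eB : Enc B} (b : B) : ptime (fun _ : A => b).
Proof.
by have [p [t [h1 h2 h3]]] := pt_tree_cst (enc b); exists p, t; split.
Qed.

Lemma pt_some B {eB : Enc B} (f : A -> B) : ptime f -> ptime (fun a => Some (f a)).
Proof. by move=> h; exact: (pt_node (g := fun=> Leaf) _ h (pt_cst _)). Qed.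

Lemma pt_hd B D {eB : Enc B} {eD : Enc D} (f : A -> B) (h : A -> D) :
  (forall a, enc (h a) = tree_hd (enc (f a))) -> ptime f -> ptime h.
Proof.
move=> E [p [t [h1 h2 h3]]].
exists (PSeq p PHd), (fun a => (t a + 1).+1); split.
- by pbd.
- apply: pbnd_le h2 => a; rewrite /sz E; case: (enc (f a)) => //= x y; lia.
- move=> a; have [n hn rn] := h3 a.
  by exists (n + 1).+1; [lia | rewrite E; apply: RunSeq rn _; exact: RunHd].
Qed.

Lemma pt_tl B D {eB : Enc B} {eD : Enc D} (f : A -> B) (h : A -> D) :
  (forall a, enc (h a) = tree_tl (enc (f a))) -> ptime f -> ptime h.
Proof.
move=> E [p [t [h1 h2 h3]]].
exists (PSeq p PTl), (fun a => (t a + 1).+1); split.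
- by pbd.
- apply: pbnd_le h2 => a; rewrite /sz E; case: (enc (f a)) => //= x y; lia.
- move=> a; have [n hn rn] := h3 a.
  by exists (n + 1).+1; [lia | rewrite E; apply: RunSeq rn _; exact: RunTl].
Qed.

Lemma pt_fst B C {eB : Enc B} {eC : Enc C} (f : A -> B * C) :
  ptime f -> ptime (fun a => (f a).1).
Proof. exact: pt_hd. Qed.

Lemma pt_snd B C {eB : Enc B} {eC : Enc C} (f : A -> B * C) :
  ptime f -> ptime (fun a => (f a).2).
Proof. exact: pt_tl. Qed.

Lemma pt_behead B {eB : Enc B} (f : A -> seq B) :
  ptime f -> ptime (fun a => behead (f a)).
Proof. by apply: pt_tl => a; case: (f a). Qed.

Lemma pt_predn (f : A -> nat) : ptime f -> ptime (fun a => (f a).-1).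
Proof. by apply: pt_tl => a; case: (f a). Qed.

Lemma pt_succn (f : A -> nat) : ptime f -> ptime (fun a => (f a).+1).
Proof. by move=> h; exact: (pt_node (f := fun=> Leaf) _ (pt_cst _) h). Qed.

Lemma pt_if_tree B D {eB : Enc B} {eD : Enc D} (b : A -> D) (f g h : A -> B) :
  (forall a, h a = if enc (b a) is Node _ _ then f a else g a) ->
  ptime b -> ptime f -> ptime g -> ptime h.
Proof.
move=> E [p [t [h1 h2 h3]]] [q [t' [h1' h2' h3']]] [r [t'' [h1'' h2'' h3'']]].
exists (PIf p q r), (fun a => (t a + (t' a + t'' a)).+1); split.
- by pbd.
- apply: (@pbnd_le _ _ _ (fun a => sz (f a) + sz (g a))); last by pbd.
  by move=> a; rewrite E; case: (enc (b a)) => [|? ?]; lia.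
- move=> a; have [n hn rn] := h3 a; rewrite E.
  case Eb: (enc (b a)) rn => [|x y] rn.
    have [m hm rm] := h3'' a; exists (n + m).+1; [lia | exact: RunIfFalse rn rm].
  by have [m hm rm] := h3' a; exists (n + m).+1; [lia | exact: RunIfTrue rn rm].
Qed.

Lemma pt_if B {eB : Enc B} (b : A -> bool) (f g : A -> B) :
  ptime b -> ptime f -> ptime g -> ptime (fun a => if b a then f a else g a).
Proof. by apply: pt_if_tree => a; case: (b a). Qed.

Lemma pt_nilp B {eB : Enc B} (f : A -> seq B) :
  ptime f -> ptime (fun a => nilp (f a)).
Proof.
move=> hf; apply: (pt_if_tree _ hf (pt_cst false) (pt_cst true)) => a.
by case: (f a).
Qed.

Lemma pt_eq0 (f : A -> nat) : ptime f -> ptime (fun a => f a == 0).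
Proof.
move=> hf; apply: (pt_if_tree _ hf (pt_cst false) (pt_cst true)) => a.
by case: (f a).
Qed.

Lemma pt_andb (f g : A -> bool) : ptime f -> ptime g -> ptime (fun a => f a && g a).
Proof. by move=> hf hg; apply: (pt_if hf hg (pt_cst false)). Qed.

Lemma pt_orb (f g : A -> bool) : ptime f -> ptime g -> ptime (fun a => f a || g a).
Proof. by move=> hf hg; apply: (pt_if hf (pt_cst true) hg). Qed.

Lemma pt_negb (f : A -> bool) : ptime f -> ptime (fun a => ~~ f a).
Proof. by move=> hf; apply: (pt_if hf (pt_cst false) (pt_cst true)). Qed.

Lemma pt_implyb (f g : A -> bool) :
  ptime f -> ptime g -> ptime (fun a => f a ==> g a).
Proof. by move=> hf hg; apply: (pt_if hf hg (pt_cst true)). Qed.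

Lemma pt_head B {eB : Enc B} (d : A -> B) (f : A -> seq B) :
  ptime d -> ptime f -> ptime (fun a => head (d a) (f a)).
Proof.
move=> [q [t' [h1' h2' h3']]] [p [t [h1 h2 h3]]].
(* [p] runs once for the test and again for its value, since the test of a conditional does not
   change the variable. *)
exists (PIf p (PSeq p PHd) q), (fun a => (t a + (t a + 2) + t' a).+1); split.
- by pbd.
- apply: (@pbnd_le _ _ _ (fun a => sz (f a) + sz (d a))); last by pbd.
  move=> a; case: (f a) => [|x s] /=; rewrite ?sz_nil ?sz_cons; lia.
- move=> a; have [n hn rn] := h3 a; have [m hm rm] := h3' a.
  case Ef: (f a) rn => [|x s] rn.
    by exists (n + m).+1; [lia | exact: RunIfFalse rn rm].
  exists (n + (n + 1).+1).+1; first by lia.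
  by apply: RunIfTrue (rn) _; apply: RunSeq rn _; exact: RunHd.
Qed.

End Basic.

Section Options.
Context {A : Type} {eA : Enc A}.

Lemma pt_isSome B {eB : Enc B} (f : A -> option B) :
  ptime f -> ptime (fun a => isSome (f a)).
Proof.
move=> hf; apply: (pt_if_tree _ hf (pt_cst true) (pt_cst false)) => a.
by case: (f a).
Qed.

Lemma pt_odflt B {eB : Enc B} (d : A -> B) (f : A -> option B) :
  ptime d -> ptime f -> ptime (fun a => odflt (d a) (f a)).
Proof.
move=> hd hf.
have hg : ptime (fun o : option B => if o is Some x then [:: x] else [::]).
  by apply: pt_coerce => -[].
apply: pt_ext (pt_head hd (pt_comp hg hf)) => a.
by case: (f a).
Qed.

Lemma pt_match_opt B C {eB : Enc B} {eC : Enc C} (b0 : B)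
    (o : A -> option B) (f : A -> B -> C) (g : A -> C) :
  ptime o -> ptime (fun p : A * B => f p.1 p.2) -> ptime g ->
  ptime (fun a => if o a is Some b then f a b else g a).
Proof.
move=> ho hf hg.
apply: (@pt_ext _ _ _ _
  (fun a => if isSome (o a) then f a (odflt b0 (o a)) else g a)).
  by move=> a; case: (o a).
apply: pt_if (pt_isSome ho) _ hg.
exact: (pt_comp (f := fun a => (a, odflt b0 (o a))) hf
  (pt_pair pt_id (pt_odflt (pt_cst b0) ho))).
Qed.

End Options.

(** * Loops over lists *)

Section Folds.
Context {A X B : Type} {eA : Enc A} {eX : Enc X} {eB : Enc B}.
Variables (step : A -> B -> X -> B) (init : A -> B) (l : A -> seq X).
Hypothesis hstep : ptime (fun p : A * (X * B) => step p.1 p.2.2 p.2.1).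
Hypotheses (hinit : ptime init) (hl : ptime l).

(** The loop variable holds the parameter, the rest of the list and the accumulator. A polynomial
    [step] alone is not enough, since its iterates may grow exponentially; hence the bound [K] on
    every intermediate accumulator. *)
Lemma pt_foldl :
  (exists2 K : A -> nat, pbnd K & forall a l1 l2, l a = l1 ++ l2 ->
     sz (foldl (step a) (init a) l1) <= K a) ->
  ptime (fun a => foldl (step a) (init a) (l a)).
Proof.
move=> [K hK H].
have [q [t' [h1' h2' h3']]] := hstep.
have [p [t [h1 h2 h3]]] :=
  pt_pair (@pt_id A eA) (pt_pair hl hinit).
have [c' [d' H']] := h1'.
(* One round costs at most [M a]: a constant for taking the triple apart and rebuilding it, and the
   time of [step] on the largest argument that can occur. *)
pose M a := (30 + c' * (@sz _ eA a + @sz _ (@Enc_seq X eX) (l a) + K a + 2) ^ d').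
have hM : pbnd M by rewrite /M; pbd; exact: pt_sz.
pose body := PNode PHd (PNode (PSeq PTl (PSeq PHd PTl)) 
  (PSeq (PNode PHd (PNode (PSeq PTl (PSeq PHd PHd)) (PSeq PTl PTl))) q)).
pose w := PWhile (PSeq PTl PHd) body.
exists (PSeq p (PSeq w (PSeq PTl PTl))),
  (fun a => t a + (sz (l a) + 1) * M a + 20); split.
- by pbd; exact: pt_sz.
- by apply: pbnd_le hK => a; apply: (H a (l a) [::]); rewrite cats0.
move=> a; have [n hn rn] := h3 a.
have W l1 l2 : l a = l1 ++ l2 -> exists2 k, k <= (size l2 + 1) * M a &
   run w (enc (a, (l2, foldl (step a) (init a) l1)))
     (enc (a, (@nil X, foldl (step a) (init a) (l a)))) k; last first.
  have [k hk rk] := W [::] (l a) erefl.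
  exists (n + (k + (1 + 1).+1).+1).+1.
    have : (size (l a) + 1) * M a <= (sz (l a) + 1) * M a.
      by rewrite leq_mul2r; have := @size_sz _ eX (l a); lia.
    lia.
  apply: RunSeq rn _; apply: RunSeq rk _.
  by apply: RunSeq; [exact: RunTl | exact: RunTl].
elim: l2 l1 => [|x l2 IH] l1 E.
  exists ((1 + 1).+1).+1; first by rewrite /M; lia.
  have -> : foldl (step a) (init a) (l a) = foldl (step a) (init a) l1.
    by rewrite E cats0.
  apply: RunWhileStop.
  by apply: RunSeq; [exact: RunTl | exact: RunHd].
have [|k hk rk] := IH (rcons l1 x); first by rewrite cat_rcons.
set acc := foldl (step a) (init a) l1 in rk *.
have [m hm rm] := h3' (a, (x, acc)).
have {}hm : m <= c' * (sz a + sz (l a) + K a + 2) ^ d'.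
  apply: leq_trans hm _; apply: leq_trans (H' _) _.
  rewrite leq_mul2l; apply/orP; right.
  case: (posnP d') => [->//|d'0]; rewrite leq_exp2r //.
  rewrite !sz_pair /=.
  have hx : sz x <= sz (l a).
    by rewrite E; have := @sz_cat _ eX l1 (x :: l2); rewrite sz_cons;
       have := @sz_gt0 _ (@Enc_seq X eX) l1; lia.
  have := H a l1 (x :: l2) E; rewrite -/acc; lia.
exists ((1 + 1).+1 + (1 + ((1 + (1 + 1).+1).+1
  + ((1 + ((1 + (1 + 1).+1).+1 + (1 + 1).+1).+1).+1 + m).+1).+1).+1 + k).+1.
  move: hk; rewrite /M /=; nia.
apply: (RunWhileStep (a := enc x) (b := enc l2) _ _ rk).
  by apply: RunSeq; [exact: RunTl | exact: RunHd].
rewrite foldl_rcons -/acc.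
apply: RunNode; first exact: RunHd.
apply: RunNode.
  by apply: RunSeq; [exact: RunTl | apply: RunSeq; [exact: RunHd | exact: RunTl]].
apply: RunSeq rm.
apply: RunNode; first exact: RunHd.
apply: RunNode.
  by apply: RunSeq; [exact: RunTl | apply: RunSeq; [exact: RunHd | exact: RunHd]].
by apply: RunSeq; [exact: RunTl | exact: RunTl].
Qed.

End Folds.

Lemma pt_rev A B {eA : Enc A} {eB : Enc B} (f : A -> seq B) :
  ptime f -> ptime (fun a => rev (f a)).
Proof.
move=> hf; have E s : foldl (fun acc x => x :: acc) [::] s = rev s :> seq B.
  by rewrite /rev; elim: s [::] => //= x s IH acc; rewrite IH.
apply: (@pt_ext _ _ _ _ (fun a => foldl (fun acc x => x :: acc) [::] (f a))).
  by move=> a; exact: E.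
apply: pt_foldl => //.
- by apply: pt_cons; [apply: pt_fst | apply: pt_snd]; apply: pt_snd; exact: pt_id.
- exact: pt_cst.
- exists (fun a => sz (f a)); first exact: pt_sz.
  move=> a l1 l2 ->; rewrite E sz_rev.
  have h : sz (l1 ++ l2) + 1 = sz l1 + sz l2 by exact: sz_cat.
  have h' : 0 < sz l2 by exact: sz_gt0.
  lia.
Qed.

Lemma pt_foldr A X B {eA : Enc A} {eX : Enc X} {eB : Enc B}
    (step : A -> X -> B -> B) (init : A -> B) (l : A -> seq X) :
  ptime (fun p : A * (X * B) => step p.1 p.2.1 p.2.2) ->
  ptime init -> ptime l ->
  (exists2 K : A -> nat, pbnd K & forall a l1 l2, l a = l1 ++ l2 ->
     sz (foldr (step a) (init a) l2) <= K a) ->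
  ptime (fun a => foldr (step a) (init a) (l a)).
Proof.
move=> hs hi hl [K hK H].
apply: (@pt_ext _ _ _ _
  (fun a => foldl (fun acc x => step a x acc) (init a) (rev (l a)))).
  by move=> a; rewrite foldl_rev.
apply: (pt_foldl (step := fun a acc x => step a x acc)) => //; first exact: pt_rev.
exists K => // a l1 l2 E.
rewrite -[l1]revK foldl_rev; apply: (H a (rev l2)).
by rewrite -rev_cat -E revK.
Qed.

Section Seqs.
Context {A : Type} {eA : Enc A}.

Lemma pt_cat B {eB : Enc B} (f g : A -> seq B) :
  ptime f -> ptime g -> ptime (fun a => f a ++ g a).
Proof.
move=> hf hg.
have E (s1 s2 : seq B) : foldr cons s2 s1 = s1 ++ s2 by elim: s1 => //= x s1 ->.
apply: (@pt_ext _ _ _ _ (fun a => foldr cons (g a) (f a))).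
  by move=> a; rewrite E.
apply: (pt_foldr (step := fun _ => cons)) => //.
  by apply: pt_cons; [apply: pt_fst | apply: pt_snd]; apply: pt_snd; exact: pt_id.
exists (fun a => sz (f a) + sz (g a)); first by apply: pbnd_add; exact: pt_sz.
move=> a l1 l2 ->; rewrite E.
have h : sz (l1 ++ l2) + 1 = sz l1 + sz l2 by exact: sz_cat.
have h' : 0 < sz l1 by exact: sz_gt0.
have h2 : sz (l2 ++ g a) + 1 = sz l2 + sz (g a) by exact: sz_cat.
lia.
Qed.

End Seqs.

Section MapFilter.
Context {A : Type} {eA : Enc A}.

(** Turns a bound in the size of the pair into one in the size of [a] alone, which is the form
    needed to bound the accumulators of a fold. *)
Lemma pt_arg2_bound X B {eX : Enc X} {eB : Enc B} (f : A -> X -> B)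
    (l : A -> seq X) :
  ptime (fun p : A * X => f p.1 p.2) -> ptime l ->
  exists2 K : A -> nat, pbnd K & forall a l1 x l2, l a = l1 ++ x :: l2 ->
    sz (f a x) <= K a.
Proof.
move=> hf hl; have [c [d H]] := pt_sz hf.
exists (fun a => c * (sz a + sz (l a) + 1) ^ d).
  by pbd; exact: pt_sz.
move=> a l1 x l2 E; apply: leq_trans (H (a, x)) _.
have h : sz (l1 ++ x :: l2) + 1 = sz l1 + (sz x + sz l2).+1 by exact: sz_cat.
have h' : 0 < sz l1 by exact: sz_gt0.
rewrite leq_mul2l; apply/orP; right.
case: (posnP d) => [->//|d0]; rewrite leq_exp2r // sz_pair /= E; lia.
Qed.

Lemma pt_map X B {eX : Enc X} {eB : Enc B} (f : A -> X -> B) (l : A -> seq X) :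
  ptime (fun p : A * X => f p.1 p.2) -> ptime l ->
  ptime (fun a => [seq f a x | x <- l a]).
Proof.
move=> hf hl.
have E a (s : seq X) : foldr (fun x acc => f a x :: acc) [::] s = map (f a) s.
  by elim: s => //= x s ->.
apply: (@pt_ext _ _ _ _
  (fun a => foldr (fun x acc => f a x :: acc) [::] (l a))).
  by move=> a; rewrite E.
apply: (pt_foldr (step := fun a x acc => f a x :: acc)) => //.
- apply: pt_cons.
    apply: (pt_comp (f := fun p : A * (X * seq B) => (p.1, p.2.1)) hf).
    apply: pt_pair; first by apply: pt_fst; exact: pt_id.
    by apply: pt_fst; apply: pt_snd; exact: pt_id.
  by apply: pt_snd; apply: pt_snd; exact: pt_id.
- exact: pt_cst.
have [K hK H] := pt_arg2_bound hf hl.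
exists (fun a => sz (l a) * (K a).+1 + 1); first by pbd; exact: pt_sz.
move=> a l1 l2 El; rewrite E.
have : sz [seq f a x | x <- l2] <= size l2 * (K a).+1 + 1.
  elim: l2 l1 El => [|x l2 IH] l1 El /=; first by rewrite sz_nil.
  have h := H a _ _ _ El.
  have := IH (rcons l1 x); rewrite cat_rcons => /(_ El).
  rewrite sz_cons; lia.
have : size l2 < sz (l a).
  rewrite El; apply: leq_ltn_trans (size_sz (l1 ++ l2)).
  by rewrite size_cat leq_addl.
move=> h1 h2; apply: leq_trans h2 _.
by rewrite leq_add2r leq_mul2r (ltnW h1) orbT.
Qed.

Lemma pt_filter X {eX : Enc X} (f : A -> X -> bool) (l : A -> seq X) :
  ptime (fun p : A * X => f p.1 p.2) -> ptime l ->
  ptime (fun a => [seq x <- l a | f a x]).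
Proof.
move=> hf hl.
have E a (s : seq X) :
    foldr (fun x acc => if f a x then x :: acc else acc) [::] s = filter (f a) s.
  by elim: s => //= x s ->.
apply: (@pt_ext _ _ _ _
  (fun a => foldr (fun x acc => if f a x then x :: acc else acc) [::] (l a))).
  by move=> a; rewrite E.
have h1 : ptime (fun p : A * (X * seq X) => p.2.1).
  by apply: pt_fst; apply: pt_snd; exact: pt_id.
have h2 : ptime (fun p : A * (X * seq X) => p.2.2).
  by apply: pt_snd; apply: pt_snd; exact: pt_id.
apply: (pt_foldr (step := fun a x acc => if f a x then x :: acc else acc)) => //.
- apply: pt_if => //; last exact: pt_cons.
  apply: (pt_comp (f := fun p : A * (X * seq X) => (p.1, p.2.1)) hf).
  by apply: pt_pair => //; apply: pt_fst; exact: pt_id.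
- exact: pt_cst.
exists (fun a => sz (l a)); first exact: pt_sz.
move=> a l1 l2 ->; rewrite E.
have h : sz (l1 ++ l2) + 1 = sz l1 + sz l2 by exact: sz_cat.
have h' : 0 < sz l1 by exact: sz_gt0.
have : sz (filter (f a) l2) <= sz l2; last by lia.
elim: l2 {h} => //= x l2 IH; case: (f a x); rewrite !sz_cons; lia.
Qed.

Lemma pt_flatten B {eB : Enc B} (l : A -> seq (seq B)) :
  ptime l -> ptime (fun a => flatten (l a)).
Proof.
move=> hl; rewrite /flatten; apply: (pt_foldr (step := fun _ => cat)) => //.
- apply: pt_cat; first by apply: pt_fst; apply: pt_snd; exact: pt_id.
  by apply: pt_snd; apply: pt_snd; exact: pt_id.
- exact: pt_cst.
exists (fun a => sz (l a)); first exact: pt_sz.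
move=> a l1 l2 ->.
have h : sz (l1 ++ l2) + 1 = sz l1 + sz l2 by exact: sz_cat.
have h' : 0 < sz l1 by exact: sz_gt0.
have : sz (flatten l2) <= sz l2; last by rewrite /flatten; lia.
elim: l2 {h} => //= x l2 IH; rewrite sz_cons.
have : sz (x ++ flatten l2) + 1 = sz x + sz (flatten l2) by exact: sz_cat.
lia.
Qed.

Lemma pt_has X {eX : Enc X} (f : A -> X -> bool) (l : A -> seq X) :
  ptime (fun p : A * X => f p.1 p.2) -> ptime l ->
  ptime (fun a => has (f a) (l a)).
Proof.
move=> hf hl.
apply: (@pt_ext _ _ _ _ (fun a => ~~ nilp [seq x <- l a | f a x])).
  by move=> a; rewrite /nilp size_filter -lt0n -has_count.
by apply: pt_negb; apply: pt_nilp; exact: pt_filter.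
Qed.

(** A unary number has the encoding of a list of leaves, so iteration is a fold over that list. *)
Lemma pt_iter B {eB : Enc B} (step : A -> B -> B) (init : A -> B) (k : A -> nat) :
  ptime (fun p : A * B => step p.1 p.2) -> ptime init -> ptime k ->
  (exists2 K : A -> nat, pbnd K & forall a i, i <= k a ->
     sz (iter i (step a) (init a)) <= K a) ->
  ptime (fun a => iter (k a) (step a) (init a)).
Proof.
move=> hs hi hk [K hK H].
have E a n : foldl (fun acc (_ : tree) => step a acc) (init a) (nseq n Leaf)
    = iter n (step a) (init a).
  by elim: n (init a) => //= n IH b; rewrite IH -iterSr.
apply: (@pt_ext _ _ _ _ (fun a =>
  foldl (fun acc (_ : tree) => step a acc) (init a) (nseq (k a) Leaf))).
  by move=> a; rewrite E.
apply: (pt_foldl (step := fun a acc (_ : tree) => step a acc)) => //.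
- apply: (pt_comp (f := fun p : A * (tree * B) => (p.1, p.2.2)) hs).
  apply: pt_pair; first by apply: pt_fst; exact: pt_id.
  by apply: pt_snd; apply: pt_snd; exact: pt_id.
- apply: (pt_comp (g := fun n => nseq n Leaf) _ hk).
  by apply: pt_coerce => n; rewrite /enc /= /Enc_seq map_id.
exists K => // a l1 l2 El.
have hl1 : l1 = nseq (size l1) Leaf.
  rewrite -[LHS](take_size_cat l2 (erefl (size l1))) -El take_nseq //.
  by rewrite -[k a](size_nseq _ Leaf) El size_cat leq_addr.
rewrite hl1 E; apply: H.
by rewrite -[k a](size_nseq _ Leaf) El size_cat leq_addr.
Qed.

Lemma pt_subn (f g : A -> nat) : ptime f -> ptime g -> ptime (fun a => f a - g a).
Proof.
move=> hf hg; apply: (@pt_ext _ _ _ _ (fun a => iter (g a) predn (f a))).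
  by move=> a; rewrite iter_predn.
apply: (pt_iter (step := fun _ => predn)) => //.
  by apply: pt_predn; apply: pt_snd; exact: pt_id.
exists (fun a => sz (f a)); first exact: pt_sz.
by move=> a i _; rewrite !sz_nat iter_predn; lia.
Qed.

Lemma pt_leq (f g : A -> nat) : ptime f -> ptime g -> ptime (fun a => f a <= g a).
Proof. by move=> hf hg; apply: pt_eq0; exact: pt_subn. Qed.

Lemma pt_ltn (f g : A -> nat) : ptime f -> ptime g -> ptime (fun a => f a < g a).
Proof. by move=> hf hg; apply: pt_leq => //; exact: pt_succn. Qed.

Lemma pt_eqn (f g : A -> nat) : ptime f -> ptime g -> ptime (fun a => f a == g a).
Proof.
move=> hf hg; apply: (@pt_ext _ _ _ _ (fun a => (f a <= g a) && (g a <= f a))).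
  by move=> a; rewrite eqn_leq.
by apply: pt_andb; exact: pt_leq.
Qed.

Lemma pt_eqb (f g : A -> bool) : ptime f -> ptime g -> ptime (fun a => f a == g a).
Proof.
move=> hf hg; apply: (@pt_ext _ _ _ _ (fun a => if f a then g a else ~~ g a)).
  by move=> a; case: (f a); case: (g a).
by apply: pt_if => //; exact: pt_negb.
Qed.

End MapFilter.

Ltac ptv := cbv beta; lazymatch goal with
  | |- @ptime _ _ _ _ (fun x => x) => exact pt_id
  | |- @ptime _ _ _ _ id => exact pt_id
  | |- @ptime _ _ _ _ (fun x => fst (@?f x)) => refine (pt_fst (f := f) _); ptv
  | |- @ptime _ _ _ _ (fun x => snd (@?f x)) => refine (pt_snd (f := f) _); ptv
  | |- @ptime _ _ _ _ fst => refine (pt_fst (f := fun x => x) pt_id)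
  | |- @ptime _ _ _ _ snd => refine (pt_snd (f := fun x => x) pt_id)
  | |- _ => idtac
  end.

(** As a class, equality tests at products, lists and options are assembled by instance resolution,
    so that the tactic [pt] can treat [==] at all these types. *)
Class EqPt (T : eqType) {eT : Enc T} :=
  eq_pt : ptime (fun p : T * T => p.1 == p.2).
Arguments EqPt T {eT}.

Lemma pt_eq A (T : eqType) {eA : Enc A} {eT : Enc T} {hT : EqPt T} (f g : A -> T) :
  ptime f -> ptime g -> ptime (fun a => f a == g a).
Proof.
by move=> hf hg; exact: (pt_comp (f := fun a => (f a, g a)) hT (pt_pair hf hg)).
Qed.

#[global] Instance EqPt_nat : EqPt nat.
Proof. by apply: pt_eqn; [apply: pt_fst | apply: pt_snd]; exact: pt_id. Qed.

#[global] Instance EqPt_bool : EqPt bool.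
Proof. by apply: pt_eqb; [apply: pt_fst | apply: pt_snd]; exact: pt_id. Qed.

#[global] Instance EqPt_prod (T U : eqType) {eT : Enc T} {eU : Enc U}
  {hT : EqPt T} {hU : EqPt U} : @EqPt (T * U)%type (@Enc_prod T U eT eU).
Proof.
apply: (@pt_ext _ _ _ _ (fun p : (T * U) * (T * U) =>
  (p.1.1 == p.2.1) && (p.1.2 == p.2.2))) => //.
by apply: pt_andb; refine (pt_eq _ _); ptv.
Qed.

(** Compares two lists in a single fold over one of them: the other is consumed alongside, and they
    agree if the flag survives and nothing is left over. *)
Definition seq_cmp (T : eqType) (p : bool * seq T) (x : T) : bool * seq T :=
  (p.1 && (~~ nilp p.2 && (x == head x p.2)), behead p.2).

Lemma seq_cmpE (T : eqType) p (s : seq T) :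
  (foldl (@seq_cmp T) p s).1 && nilp (foldl (@seq_cmp T) p s).2
  = p.1 && (s == p.2).
Proof.
elim: s p => [|x s IH] [b [|y r]] //=.
  by rewrite IH /= !andbF.
by rewrite IH /= eqseq_cons andbA.
Qed.

Lemma seq_cmp2 (T : eqType) p (s : seq T) :
  (foldl (@seq_cmp T) p s).2 = drop (size s) p.2.
Proof.
elim: s p => [|x s IH] p /=; first by rewrite drop0.
by rewrite IH /=; case: p.2.
Qed.

#[global] Instance EqPt_seq (T : eqType) {eT : Enc T} {hT : EqPt T} :
  @EqPt (seq T) (@Enc_seq T eT).
Proof.
pose r (p : seq T * seq T) := foldl (@seq_cmp T) (true, p.2) p.1.
apply: (@pt_ext _ _ _ _ (fun p => (r p).1 && nilp (r p).2)).
  by move=> p; rewrite /r seq_cmpE.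
have hr : ptime r.
  apply: (pt_foldl (step := fun _ => @seq_cmp T)); try by ptv.
  - apply: pt_pair; last by apply: pt_behead; ptv.
    apply: pt_andb; first by ptv.
    apply: pt_andb; first by apply: pt_negb; apply: pt_nilp; ptv.
    by refine (pt_eq _ _); [ptv | apply: pt_head; ptv].
  - by apply: pt_pair; [exact: pt_cst | ptv].
  exists (fun p : seq T * seq T => 4 + sz p.2); first by pbd; apply: pt_sz; ptv.
  move=> p l1 l2 _; case E: (foldl _ _ _) => [b s].
  have := seq_cmp2 (true, p.2) l1; rewrite E /= => ->.
  rewrite sz_pair /=.
  have h : sz (take (size l1) p.2 ++ drop (size l1) p.2) + 1
    = sz (take (size l1) p.2) + sz (drop (size l1) p.2) by exact: sz_cat.
  have h' : 0 < sz (take (size l1) p.2) by exact: sz_gt0.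
  rewrite cat_take_drop in h; have := sz_bool b; lia.
by apply: pt_andb; [|apply: pt_nilp]; ptv.
Qed.

#[global] Instance EqPt_opt (T : eqType) {eT : Enc T} {hT : EqPt T} :
  @EqPt (option T) (@Enc_opt T eT).
Proof.
pose r (o : option T) := if o is Some x then [:: x] else [::].
apply: (@pt_ext _ _ _ _ (fun p => r p.1 == r p.2)).
  by move=> [[x|] [y|]] //; rewrite /r /= eqseq_cons andbT.
have hr : ptime r by apply: pt_coerce => -[].
by refine (pt_eq _ _); apply: (pt_comp hr); ptv.
Qed.

Lemma pt_mem A (T : eqType) {eA : Enc A} {eT : Enc T} {hT : EqPt T}
    (f : A -> T) (l : A -> seq T) :
  ptime f -> ptime l -> ptime (fun a => f a \in l a).
Proof.
move=> hf hl; apply: (@pt_ext _ _ _ _ (fun a => has (fun x => x == f a) (l a))).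
  by move=> a; exact: has_pred1.
apply: (pt_has (f := fun a x => x == f a)) => //.
by refine (pt_eq _ _); [ptv | apply: (pt_comp hf); ptv].
Qed.

Lemma pt_index A (T : eqType) {eA : Enc A} {eT : Enc T} {hT : EqPt T}
    (f : A -> T) (l : A -> seq T) :
  ptime f -> ptime l -> ptime (fun a => index (f a) (l a)).
Proof.
move=> hf hl.
have E a s : foldr (fun x n => if x == f a then 0 else n.+1) 0 s = index (f a) s.
  by elim: s => //= x s ->.
apply: (@pt_ext _ _ _ _
  (fun a => foldr (fun x n => if x == f a then 0 else n.+1) 0 (l a))).
  by move=> a; rewrite E.
apply: (pt_foldr (step := fun a x n => if x == f a then 0 else n.+1)) => //.
- apply: pt_if; [|exact: pt_cst|by apply: pt_succn; ptv].
  by refine (pt_eq _ _); [ptv | apply: (pt_comp hf); ptv].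
- exact: pt_cst.
exists (fun a => 2 * sz (l a) + 1); first by pbd; exact: pt_sz.
move=> a l1 l2 ->; rewrite E sz_nat.
have := index_size (f a) l2; have := @size_sz _ eT (l1 ++ l2).
rewrite size_cat; lia.
Qed.

Lemma pt_drop A B {eA : Enc A} {eB : Enc B} (k : A -> nat) (l : A -> seq B) :
  ptime k -> ptime l -> ptime (fun a => drop (k a) (l a)).
Proof.
move=> hk hl; have E n (s : seq B) : iter n behead s = drop n s.
  elim: n s => [|n IH] s; first by rewrite drop0.
  by rewrite iterSr IH; case: s.
apply: (@pt_ext _ _ _ _ (fun a => iter (k a) behead (l a))).
  by move=> a; rewrite E.
apply: (pt_iter (step := fun _ => behead)) => //.
  by apply: pt_behead; ptv.
exists (fun a => sz (l a)); first exact: pt_sz.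
move=> a i _; rewrite E.
have h : sz (take i (l a) ++ drop i (l a)) + 1
  = sz (take i (l a)) + sz (drop i (l a)) by exact: sz_cat.
have h' : 0 < sz (take i (l a)) by exact: sz_gt0.
rewrite cat_take_drop in h; lia.
Qed.

Ltac pt_hook := fail.

Ltac pt_step := cbv beta; lazymatch goal with
  | |- @ptime _ _ _ _ (fun x => x) => exact pt_id
  | |- @ptime _ _ _ _ id => exact pt_id
  | |- @ptime _ _ _ _ (fun _ => ?c) => exact (pt_cst c)
  | |- @ptime _ _ _ _ fst => refine (pt_fst (f := fun x => x) pt_id)
  | |- @ptime _ _ _ _ snd => refine (pt_snd (f := fun x => x) pt_id)
  | |- @ptime _ _ _ _ (fun x => fst (@?f x)) => refine (pt_fst (f := f) _)
  | |- @ptime _ _ _ _ (fun x => snd (@?f x)) => refine (pt_snd (f := f) _)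
  | |- @ptime _ _ _ _ (fun x => pair (@?f x) (@?g x)) =>
      refine (pt_pair (f := f) (g := g) _ _)
  | |- @ptime _ _ _ _ (fun x => cons (@?f x) (@?g x)) =>
      refine (pt_cons (f := f) (g := g) _ _)
  | |- @ptime _ _ _ _ (fun x => Some (@?f x)) => refine (pt_some (f := f) _)
  | |- @ptime _ _ _ _ (fun x => if _ then _ else _) => refine (pt_if _ _ _)
  | |- @ptime _ _ _ _ (fun x => andb (@?f x) (@?g x)) =>
      refine (pt_andb (f := f) (g := g) _ _)
  | |- @ptime _ _ _ _ (fun x => orb (@?f x) (@?g x)) =>
      refine (pt_orb (f := f) (g := g) _ _)
  | |- @ptime _ _ _ _ (fun x => implb (@?f x) (@?g x)) =>
      refine (pt_implyb (f := f) (g := g) _ _)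
  | |- @ptime _ _ _ _ (fun x => negb (@?f x)) => refine (pt_negb (f := f) _)
  | |- @ptime _ _ _ _ (fun x => leq (S (@?f x)) (@?g x)) =>
      refine (pt_ltn (f := f) (g := g) _ _)
  | |- @ptime _ _ _ _ (fun x => leq (@?f x) (@?g x)) =>
      refine (pt_leq (f := f) (g := g) _ _)
  | |- @ptime _ _ _ _ (fun x => eq_op (@?f x) (@?g x)) =>
      refine (pt_eq (f := f) (g := g) _ _)
  | |- @ptime _ _ _ _ (fun x => subn (@?f x) (@?g x)) =>
      refine (pt_subn (f := f) (g := g) _ _)
  | |- @ptime _ _ _ _ (fun x => S (@?f x)) => refine (pt_succn (f := f) _)
  | |- @ptime _ _ _ _ (fun x => cat (@?f x) (@?g x)) =>
      refine (pt_cat (f := f) (g := g) _ _)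
  | |- @ptime _ _ _ _ (fun x => map (@?f x) (@?l x)) =>
      refine (pt_map (f := f) (l := l) _ _)
  | |- @ptime _ _ _ _ (fun x => filter (@?f x) (@?l x)) =>
      refine (pt_filter (f := f) (l := l) _ _)
  | |- @ptime _ _ _ _ (fun x => flatten (@?l x)) => refine (pt_flatten (l := l) _)
  | |- @ptime _ _ _ _ (fun x => rev (@?l x)) => refine (pt_rev (f := l) _)
  | |- @ptime _ _ _ _ (fun x => behead (@?l x)) => refine (pt_behead (f := l) _)
  | |- @ptime _ _ _ _ (fun x => isSome (@?l x)) => refine (pt_isSome (f := l) _)
  | |- @ptime _ _ _ _ (fun x => has (@?f x) (@?l x)) =>
      refine (pt_has (f := f) (l := l) _ _)
  | |- @ptime _ _ _ _ (fun x => in_mem (@?f x) (mem (@?l x))) =>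
      refine (pt_mem (f := f) (l := l) _ _)
  | |- @ptime _ _ _ _ (fun x => index (@?f x) (@?l x)) =>
      refine (pt_index (f := f) (l := l) _ _)
  | |- @ptime _ _ _ _ (fun x => drop (@?k x) (@?l x)) =>
      refine (pt_drop (k := k) (l := l) _ _)
  | |- _ => first [assumption | pt_hook]
  end.

Ltac pt := repeat pt_step.

(** * Binary arithmetic *)

Section Nth.
Context {A : Type} {eA : Enc A}.

Lemma pt_size B {eB : Enc B} (l : A -> seq B) :
  ptime l -> ptime (fun a => size (l a)).
Proof.
move=> hl; apply: (@pt_ext _ _ _ _ (fun a => foldr (fun _ => succn) 0 (l a))).
  by move=> a; elim: (l a) => //= x s ->.
apply: (pt_foldr (step := fun _ _ => succn)) => //.
- by apply: pt_succn; ptv.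
- exact: pt_cst.
exists (fun a => 2 * sz (l a) + 1); first by pbd; exact: pt_sz.
move=> a l1 l2 ->; have -> : foldr (fun _ => succn) 0 l2 = size l2.
  by elim: l2 => //= x s ->.
rewrite sz_nat; have := @size_sz _ eB (l1 ++ l2).
by rewrite size_cat; lia.
Qed.

Lemma pt_nth B {eB : Enc B} (x0 : B) (l : A -> seq B) (i : A -> nat) :
  ptime l -> ptime i -> ptime (fun a => nth x0 (l a) (i a)).
Proof.
move=> hl hi; apply: (@pt_ext _ _ _ _ (fun a => head x0 (drop (i a) (l a)))).
  by move=> a; rewrite -nth0 nth_drop addn0.
by apply: pt_head; [exact: pt_cst | exact: pt_drop].
Qed.

Lemma pt_maxn (f g : A -> nat) : ptime f -> ptime g -> ptime (fun a => maxn (f a) (g a)).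
Proof. by move=> hf hg; apply: pt_if => //; exact: pt_ltn. Qed.

Lemma pt_iota (k : A -> nat) : ptime k -> ptime (fun a => iota 0 (k a)).
Proof.
move=> hk.
pose st (p : nat * seq nat) := (p.1.+1, p.1 :: p.2).
have E n : iter n st (0, [::]) = (n, rev (iota 0 n)).
  elim: n => // n IH; rewrite iterS IH /st; congr pair.
  by rewrite -(addn1 n) iotaD rev_cat add0n.
have h : ptime (fun a => iter (k a) st (0, [::])).
  apply: (pt_iter (step := fun _ => st)) => //.
  - apply: pt_pair; first by apply: pt_succn; ptv.
    by apply: pt_cons; ptv.
  - exact: pt_cst.
  exists (fun a => (sz (k a) + 2) * (sz (k a) + 2) + 10).
    by pbd; exact: pt_sz.
  move=> a i hi; rewrite E sz_pair /= sz_rev.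
  have h : sz (iota 0 i) <= size (iota 0 i) * (sz (k a)).+1 + 1.
    apply: sz_bounded; apply/allP => j; rewrite mem_iota !sz_nat; lia.
  rewrite size_iota !sz_nat in h *; nia.
apply: (@pt_ext _ _ _ _ (fun a => rev (iter (k a) st (0, [::])).2)).
  by move=> a; rewrite E revK.
by apply: pt_rev; ptv.
Qed.

End Nth.

Notation bits := (seq bool).

(** Zeros at the end of the list are allowed, so a number has many representations and all
    statements about costs go through [bval]. *)
Fixpoint bval (s : bits) : nat := if s is b :: s' then b + (bval s').*2 else 0.

Lemma bval_nseq n : bval (nseq n false) = 0.
Proof. by elim: n => //= n ->. Qed.

Lemma bval_cat s n : bval (s ++ nseq n false) = bval s.
Proof. by elim: s => [|b s IH] /=; rewrite ?bval_nseq ?IH. Qed.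

Lemma bval_nat_bits n : bval (nat_bits n) = n.
Proof.
rewrite /nat_bits -[RHS](bin_of_natK n); case: (bin_of_nat n) => //= p.
by elim: p => //= p IH; rewrite IH NatTrec.doubleE; lia.
Qed.

(** Padding to a common length makes addition and comparison a single fold over pairs of digits. *)
Definition bpairs (x y : bits) : seq (bool * bool) :=
  [seq (nth false x i, nth false y i) | i <- iota 0 (maxn (size x) (size y))].

Lemma bval_pad x n : size x <= n -> bval [seq nth false x i | i <- iota 0 n] = bval x.
Proof.
move=> h; rewrite -(bval_cat x (n - size x)); congr bval.
apply: (@eq_from_nth _ false); first by rewrite size_map size_iota size_cat size_nseq subnKC.
move=> i; rewrite size_map size_iota => hi.
rewrite (nth_map 0) ?size_iota // nth_iota // add0n nth_cat nth_nseq.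
by case: ltnP => // hx; rewrite nth_default //; case: ifP.
Qed.

Lemma bpairs1 x y : bval (unzip1 (bpairs x y)) = bval x.
Proof. by rewrite /bpairs /unzip1 -map_comp bval_pad // leq_maxl. Qed.

Lemma bpairs2 x y : bval (unzip2 (bpairs x y)) = bval y.
Proof. by rewrite /bpairs /unzip2 -map_comp bval_pad // leq_maxr. Qed.

Lemma size_bpairs x y : size (bpairs x y) = maxn (size x) (size y).
Proof. by rewrite size_map size_iota. Qed.

Definition badd_step (r : bool * bits) (p : bool * bool) : bool * bits :=
  ((p.1 && p.2) || (r.1 && (p.1 || p.2)), p.1 (+) p.2 (+) r.1 :: r.2).

Definition badd (x y : bits) : bits :=
  let r := foldl badd_step (false, [::]) (bpairs x y) in rev (r.1 :: r.2).

Lemma badd_stepE r p :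
  let r' := foldl badd_step r p in
  size r'.2 = size r.2 + size p /\
  exists2 o, rev (r'.1 :: r'.2) = rev r.2 ++ o &
    bval o = r.1 + bval (unzip1 p) + bval (unzip2 p).
Proof.
elim: p r => [|[a b] p IH] r /=.
  split; first by rewrite addn0.
  by exists [:: r.1]; rewrite ?rev_cons ?cats1 //=; lia.
have /= [-> [o -> ho]] := IH (badd_step r (a, b)); split; first by rewrite addSnnS.
exists (a (+) b (+) r.1 :: o); first by rewrite rev_cons cat_rcons.
by rewrite /= ho /=; case: (a) (b) (r.1) => [] [] []; rewrite /=; lia.
Qed.

Lemma bval_add x y : bval (badd x y) = bval x + bval y.
Proof.
rewrite /badd; have [_ [o -> ->]] := badd_stepE (false, [::]) (bpairs x y).
by rewrite bpairs1 bpairs2.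
Qed.

Lemma size_badd x y : size (badd x y) = (maxn (size x) (size y)).+1.
Proof.
rewrite /badd size_rev /=; have [-> _] := badd_stepE (false, [::]) (bpairs x y).
by rewrite size_bpairs.
Qed.

Definition ble (x y : bits) : bool :=
  foldl (fun r p => if p.1 == p.2 then r else p.2) true (bpairs x y).

Lemma bval_le x y : ble x y = (bval x <= bval y).
Proof.
rewrite /ble -(bpairs1 x y) -(bpairs2 x y).
(* The verdict [r] on the lower digits acts like a carry: a more significant pair overrides it
   unless its two digits agree. *)
have: forall p r, foldl (fun r p => if p.1 == p.2 then r else p.2 : bool) r p
  = (bval (unzip1 p) < bval (unzip2 p) + r).
  elim=> [|[a b] p IH] r /=; first by case: r.
  by rewrite IH; case: a; case: b; case: r => /=; lia.
by move=> ->; rewrite addn1 ltnS.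
Qed.

Definition bmax (x y : bits) : bits := if ble x y then y else x.

Lemma bval_max x y : bval (bmax x y) = maxn (bval x) (bval y).
Proof. by rewrite /bmax bval_le; case: leqP => h; lia. Qed.

Definition bmul (x y : bits) : bits :=
  foldr (fun (b : bool) acc => badd (if b then y else [::]) (false :: acc)) [::] x.

Lemma bval_mul x y : bval (bmul x y) = bval x * bval y.
Proof.
elim: x => //= b x IH; rewrite bval_add /= IH.
by case: b; rewrite /= -!mul2n mulnDl ?mul1n ?mul0n mulnA.
Qed.

(** Each digit of [x] adds at most two, one for the shift and one for the carry. A length that is
    additive in the factors is what keeps iterated products polynomial. *)
Lemma size_bmul x y : size (bmul x y) <= size y + 2 * size x.
Proof. by elim: x => //= b x IH; rewrite size_badd; case: b => /=; lia. Qed.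

Definition bsum (l : seq bits) : bits := foldr badd [::] l.

Lemma bval_sum l : bval (bsum l) = \sum_(x <- l) bval x.
Proof. by elim: l => [|x l IH]; rewrite ?big_nil ?big_cons //= bval_add IH. Qed.

Definition bprod (l : seq bits) : bits := foldr bmul [:: true] l.

Lemma bval_prod l : bval (bprod l) = \prod_(x <- l) bval x.
Proof. by elim: l => [|x l IH]; rewrite ?big_nil ?big_cons //= bval_mul IH. Qed.

Lemma sz_bits_le (s : bits) n : size s <= n -> sz s <= 4 * n + 1.
Proof. by move=> h; apply: leq_trans (sz_bits s) _; lia. Qed.

Section BitsPtime.
Context {A : Type} {eA : Enc A}.
Implicit Types f g : A -> bits.

Lemma pt_bpairs f g : ptime f -> ptime g -> ptime (fun a => bpairs (f a) (g a)).
Proof.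
move=> hf hg; apply: (pt_map (f := fun a i => (nth false (f a) i, nth false (g a) i))).
  by apply: pt_pair; apply: pt_nth; ptv; [apply: (pt_comp hf) | apply: (pt_comp hg)]; ptv.
by apply: pt_iota; apply: pt_maxn; exact: pt_size.
Qed.

Lemma pt_badd f g : ptime f -> ptime g -> ptime (fun a => badd (f a) (g a)).
Proof.
move=> hf hg.
have h : ptime (fun a => foldl badd_step (false, [::]) (bpairs (f a) (g a))).
  apply: (pt_foldl (step := fun _ => badd_step)); last 1 first.
  - exists (fun a => 4 * sz (bpairs (f a) (g a)) + 10).
      by pbd; apply: pt_sz; exact: pt_bpairs.
    move=> a l1 l2 E; rewrite sz_pair.
    have [h _] := badd_stepE (false, [::]) l1.
    have := sz_bits (foldl badd_step (false, [::]) l1).2.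
    have := sz_bool (foldl badd_step (false, [::]) l1).1.
    have : size (bpairs (f a) (g a)) < sz (bpairs (f a) (g a)) by exact: size_sz.
    by rewrite h E size_cat /=; lia.
  - rewrite /badd_step; apply: pt_pair; first by pt.
    apply: pt_cons; last by pt.
    apply: (@pt_ext _ _ _ _ (fun p : A * (bool * bool * (bool * bits)) =>
      ~~ ((~~ (p.2.1.1 == p.2.1.2)) == p.2.2.1))).
      by move=> [a [[[] []] [[] ?]]].
    by pt.
  - exact: pt_cst.
  - exact: pt_bpairs.
by apply: (pt_rev (f := fun a => (foldl badd_step (false, [::]) (bpairs (f a) (g a))).1 :: _)); pt.
Qed.

Lemma pt_ble f g : ptime f -> ptime g -> ptime (fun a => ble (f a) (g a)).
Proof.
move=> hf hg; rewrite /ble.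
apply: (pt_foldl (step := fun _ r p => if p.1 == p.2 then r else p.2)); try by pt.
  exact: pt_bpairs.
by exists (fun=> 3); [exact: pbnd_cst | move=> *; exact: sz_bool].
Qed.

Lemma pt_bmax f g : ptime f -> ptime g -> ptime (fun a => bmax (f a) (g a)).
Proof. by move=> hf hg; apply: pt_if => //; exact: pt_ble. Qed.

End BitsPtime.

Section BitsMul.
Context {A : Type} {eA : Enc A}.

Lemma pt_bmul (f g : A -> bits) :
  ptime f -> ptime g -> ptime (fun a => bmul (f a) (g a)).
Proof.
move=> hf hg; rewrite /bmul.
apply: (pt_foldr (step := fun a (b : bool) acc =>
   badd (if b then g a else [::]) (false :: acc))) => //.
- apply: pt_badd; pt.
  by apply: (pt_comp hg); pt.
- exact: pt_cst.
exists (fun a => 4 * (sz (g a) + 2 * sz (f a)) + 1).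
  by pbd; exact: pt_sz.
move=> a l1 l2 E; apply: sz_bits_le; apply: leq_trans (size_bmul l2 (g a)) _.
have : size (f a) < sz (f a) by exact: size_sz.
have : size (g a) < sz (g a) by exact: size_sz.
rewrite E size_cat; lia.
Qed.

End BitsMul.

Section BitsSumProd.
Context {A : Type} {eA : Enc A}.

Lemma size_bsum l : size (bsum l) <= sz l.
Proof.
elim: l => //= x l IH; rewrite size_badd sz_cons.
have : size x < sz x by exact: size_sz.
lia.
Qed.

Lemma pt_bsum (l : A -> seq bits) : ptime l -> ptime (fun a => bsum (l a)).
Proof.
move=> hl; apply: (pt_foldr (step := fun _ => badd)) => //.
- by apply: pt_badd; pt.
- exact: pt_cst.
exists (fun a => 4 * sz (l a) + 1); first by pbd; exact: pt_sz.
move=> a l1 l2 E; apply: sz_bits_le; apply: leq_trans (size_bsum l2) _.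
have h : sz (l1 ++ l2) + 1 = sz l1 + sz l2 by exact: sz_cat.
have h' : 0 < sz l1 by exact: sz_gt0.
rewrite E; lia.
Qed.

Lemma size_bprod l : size (bprod l) <= 2 * sz l.
Proof.
elim: l => //= x l IH; rewrite sz_cons; apply: leq_trans (size_bmul _ _) _.
have : size x < sz x by exact: size_sz.
lia.
Qed.

Lemma pt_bprod (l : A -> seq bits) : ptime l -> ptime (fun a => bprod (l a)).
Proof.
move=> hl; apply: (pt_foldr (step := fun _ => bmul)) => //.
- by apply: pt_bmul; pt.
- exact: pt_cst.
exists (fun a => 4 * (2 * sz (l a)) + 1); first by pbd; exact: pt_sz.
move=> a l1 l2 E; apply: sz_bits_le; apply: leq_trans (size_bprod l2) _.
have h : sz (l1 ++ l2) + 1 = sz l1 + sz l2 by exact: sz_cat.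
have h' : 0 < sz l1 by exact: sz_gt0.
rewrite E; lia.
Qed.

End BitsSumProd.

Ltac pt_hook ::= lazymatch goal with
  | |- @ptime _ _ _ _ (fun x => badd (@?f x) (@?g x)) => refine (pt_badd (f := f) (g := g) _ _)
  | |- @ptime _ _ _ _ (fun x => ble (@?f x) (@?g x)) => refine (pt_ble (f := f) (g := g) _ _)
  | |- @ptime _ _ _ _ (fun x => bmax (@?f x) (@?g x)) => refine (pt_bmax (f := f) (g := g) _ _)
  | |- @ptime _ _ _ _ (fun x => bmul (@?f x) (@?g x)) => refine (pt_bmul (f := f) (g := g) _ _)
  | |- @ptime _ _ _ _ (fun x => bsum (@?f x)) => refine (pt_bsum (l := f) _)
  | |- @ptime _ _ _ _ (fun x => bprod (@?f x)) => refine (pt_bprod (l := f) _)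
  | |- @ptime _ _ _ _ (fun x => iota 0 (@?f x)) => refine (pt_iota (k := f) _)
  | |- @ptime _ _ _ _ (fun x => size (@?f x)) => refine (pt_size (l := f) _)
  | |- @ptime _ _ _ _ (fun x => nth ?d (@?f x) (@?i x)) => refine (pt_nth d (l := f) (i := i) _ _)
  end.

(** * Shortest paths *)

Section ShortestPath.
Variables K L : eqType.

(* Source, target, weight and label; [None] is both the source and the sink. *)
Definition arc : eqType := (option K * (option K * (bits * L)))%type.
Implicit Types (a : arc) (p q : seq arc).

Definition asrc a := a.1.
Definition atgt a := a.2.1.
Definition awt a := a.2.2.1.
Definition alab a := a.2.2.2.

Definition weight p : nat := \sum_(a <- p) bval (awt a).

Definition bweight p : bits := bsum [seq awt a | a <- p].

Lemma bval_weight p : bval (bweight p) = weight p.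
Proof. by rewrite bval_sum big_map. Qed.

Definition best_step p (o : option (seq arc)) : option (seq arc) :=
  if o is Some q then if ble (bweight p) (bweight q) then Some p else Some q
  else Some p.

Definition best (l : seq (seq arc)) : option (seq arc) := foldr best_step None l.

Lemma best_mem l p : best l = Some p -> p \in l.
Proof.
elim: l => //= q l IH; rewrite /best_step inE.
case E: (best l) IH => [r|] IH; last by case=> ->; rewrite eqxx.
case: ifP => _; first by case=> ->; rewrite eqxx.
by move/IH=> ->; rewrite orbT.
Qed.

Lemma best_le l p : p \in l -> exists2 q, best l = Some q & weight q <= weight p.
Proof.
elim: l => //= q l IH; rewrite inE /best_step => /orP[/eqP->|/IH[r -> hr]].
  case: (best l) => [r|]; last by exists q.
  rewrite bval_le !bval_weight; case: leqP => h; first by exists q.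
  by exists r => //; exact: ltnW.
rewrite bval_le !bval_weight; case: leqP => h; last by exists r.
by exists q => //; exact: leq_trans h hr.
Qed.

(* Paths are kept in reverse order, last arc first. *)
Definition ptgt p : option K := head None [seq atgt a | a <- p].

(** A Bellman-Ford round indexed by the last arc rather than by the state: with at most one walk per
    arc, the table stays polynomial and is a plain list. *)
Definition sp_arc (T : seq (seq arc)) a : seq (seq arc) :=
  if asrc a == None then [:: [:: a]]
  else if best [seq p <- T | ptgt p == asrc a] is Some p then [:: a :: p] else [::].

Definition sp_step (arcs : seq arc) (T : seq (seq arc)) : seq (seq arc) :=
  flatten [seq sp_arc T a | a <- arcs].

Definition sp (N : nat) (arcs : seq arc) : option (seq arc) :=
  if best [seq p <- iter N (sp_step arcs) [::] | ptgt p == None] is Some p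
  then Some (rev p) else None.

Fixpoint pchain (k : option K) p (k' : option K) : bool :=
  if p is a :: p' then (asrc a == k) && pchain (atgt a) p' k' else k == k'.

Lemma pchain_rcons k p a k' :
  pchain k (rcons p a) k' = pchain k p (asrc a) && (atgt a == k').
Proof.
elim: p k => [|b p IH] k /=; last by rewrite IH andbA.
by congr andb; rewrite eq_sym.
Qed.

(** Because [None] is source and sink at once, a chain may come back to it midway and would then be
    several solutions in a row; the third conjunct excludes this. *)
Definition proper (arcs : seq arc) p k :=
  [&& p != [::], all [in arcs] p, all (fun a => asrc a != None) (behead p)
    & pchain None p k].

Lemma iter_sound arcs n q : q \in iter n (sp_step arcs) [::] ->
  proper arcs (rev q) (ptgt q) && (size q <= n).
Proof.
elim: n q => //= n IH q; rewrite /sp_step => /flatten_mapP[a aA].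
rewrite /sp_arc; case: ifP => [/eqP a0|a0].
  by rewrite inE => /eqP->; rewrite /proper /= aA a0 !eqxx.
case E: best => [r|] //; rewrite inE => /eqP->.
have := best_mem E; rewrite mem_filter => /andP[/eqP hr /IH /andP[]].
rewrite /proper rev_cons => /and4P[h1 h2 h3 h4] h5.
rewrite all_rcons aA h2 pchain_rcons /= -hr h4 eqxx !andbT ltnS h5 andbT.
apply/andP; split; first by case: (rev r).
case: (rev r) h1 h3 => //= b s _ h3.
by rewrite all_rcons h3 a0.
Qed.

Lemma sp_sound N arcs p : sp N arcs = Some p -> proper arcs p None.
Proof.
rewrite /sp; case E: best => [q|] // [<-].
have := best_mem E; rewrite mem_filter => /andP[/eqP hq /iter_sound].
by rewrite hq => /andP[].
Qed.

Lemma weight_rcons p a : weight (rcons p a) = weight p + bval (awt a).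
Proof. by rewrite /weight -cats1 big_cat big_seq1. Qed.

Lemma weight_rev p : weight (rev p) = weight p.
Proof. by rewrite /weight big_rev. Qed.

Lemma iter_complete arcs n p k :
  p != [::] -> all [in arcs] p -> pchain None p k -> size p <= n ->
  exists q, [/\ q \in iter n (sp_step arcs) [::], ptgt q = k & weight q <= weight p].
Proof.
elim: n p k => [|n IH] p k; first by case: p.
case/lastP: p => // p a _; rewrite all_rcons pchain_rcons size_rcons ltnS.
case/andP=> aA pA /andP[hp /eqP <-] sp.
have mem q : q \in sp_arc (iter n (sp_step arcs) [::]) a ->
    q \in iter n.+1 (sp_step arcs) [::].
  by move=> h; apply/flatten_mapP; exists a.
rewrite weight_rcons.
(* If the last arc leaves the source, this arc alone reaches the same state at no greater weight. *)
case E: (asrc a == None).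
  exists [:: a]; split=> //; last by rewrite /weight big_seq1 leq_addl.
  by apply: mem; rewrite /sp_arc E inE.
have p0 : p != [::] by move: hp; case: (p) => //=; rewrite eq_sym E.
have [q [hq hk hw]] := IH _ _ p0 pA hp sp.
have /best_le[r Er hr] : q \in [seq p <- iter n (sp_step arcs) [::] | ptgt p == asrc a].
  by rewrite mem_filter hk eqxx.
exists (a :: r); split=> //; first by apply: mem; rewrite /sp_arc E Er inE.
rewrite {1}/weight big_cons addnC leq_add2r; exact: leq_trans hr hw.
Qed.

Lemma sp_complete N arcs p :
  p != [::] -> all [in arcs] p -> pchain None p None -> size p <= N ->
  exists2 q, sp N arcs = Some q & weight q <= weight p.
Proof.
move=> h1 h2 h3 h4; have [q [hq hk hw]] := iter_complete h1 h2 h3 h4.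
have /best_le[r Er hr] : q \in [seq p <- iter N (sp_step arcs) [::] | ptgt p == None].
  by rewrite mem_filter hk eqxx.
exists (rev r); first by rewrite /sp Er.
by rewrite weight_rev; exact: leq_trans hr hw.
Qed.

End ShortestPath.

Section SpPtime.
Variables K L : eqType.
Context {eK : Enc K} {eL : Enc L} {hK : EqPt K}.

#[local] Instance Enc_arc : Enc (arc K L) :=
  @Enc_prod (option K) (option K * (bits * L)) _ _.

Lemma pt_bweight A {eA : Enc A} (f : A -> seq (arc K L)) :
  ptime f -> ptime (fun a => bweight (f a)).
Proof. by move=> hf; rewrite /bweight /awt; pt. Qed.

Lemma pt_best A {eA : Enc A} (f : A -> seq (seq (arc K L))) :
  ptime f -> ptime (fun a => best (f a)).
Proof.
move=> hf; rewrite /best.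
apply: (pt_foldr (step := fun _ => @best_step K L)) => //.
- apply: (pt_match_opt [::] (o := fun p : A * (seq (arc K L) * option (seq (arc K L))) => p.2.2)).
  + by pt.
  + by pt; apply: pt_bweight; pt.
  + by pt.
- exact: pt_cst.
exists (fun a => sz (f a) + 2); first by pbd; exact: pt_sz.
move=> a l1 l2 ->.
case E: (foldr _ _ l2) => [p|] //; last by rewrite addnC.
have h : sz p <= sz (l1 ++ l2).
  by apply: sz_mem; rewrite mem_cat (best_mem E) orbT.
by rewrite sz_some; lia.
Qed.

Lemma pt_ptgt A {eA : Enc A} (f : A -> seq (arc K L)) :
  ptime f -> ptime (fun a => ptgt (f a)).
Proof. by move=> hf; apply: pt_head; rewrite /atgt; pt. Qed.

(** The table has at most one walk per arc, and each walk has at most [n] arcs, all taken from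
    [arcs]. *)
Lemma sz_iter_sp n (arcs : seq (arc K L)) :
  sz (iter n (sp_step arcs) [::]) <= sz arcs * (n * (sz arcs).+1 + 1).+1 + 1.
Proof.
set T := iter _ _ _.
have h1 : size T <= size arcs.
  rewrite /T; case: n {T} => //= n; rewrite /sp_step.
  elim: {2 3}arcs => //= a s IH; rewrite size_cat.
  apply: (@leq_add _ _ 1); last exact: IH.
  by rewrite /sp_arc; case: ifP => // _; case: best.
have h2 : sz T <= size T * (n * (sz arcs).+1 + 1).+1 + 1.
  apply: sz_bounded; apply/allP => q /iter_sound /andP[/and4P[_ h _ _] hs].
  have hb : sz q <= size q * (sz arcs).+1 + 1.
    apply: sz_bounded; apply/allP => a aq; apply: sz_mem.
    by apply: (allP h); rewrite mem_rev.
  apply: leq_trans hb _; rewrite leq_add2r leq_mul2r hs orbT //.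
have h3 : size arcs < sz arcs by exact: size_sz.
apply: leq_trans h2 _; rewrite leq_add2r leq_mul2r (leq_trans h1 (ltnW h3)) orbT //.
Qed.

Lemma pt_sp A {eA : Enc A} (N : A -> nat) (arcs : A -> seq (arc K L)) :
  ptime N -> ptime arcs -> ptime (fun a => sp (N a) (arcs a)).
Proof.
move=> hN ha; rewrite /sp.
have hi : ptime (fun a => iter (N a) (sp_step (arcs a)) [::]).
  apply: (pt_iter (step := fun a => sp_step (arcs a))) => //.
  - rewrite /sp_step /sp_arc /asrc; pt; last by apply: (pt_comp ha); pt.
    apply: (pt_match_opt [::]); last exact: pt_cst.
      by apply: pt_best; pt; apply: pt_ptgt; pt.
    by pt.
  - exact: pt_cst.
  exists (fun a => sz (arcs a) * (sz (N a) * (sz (arcs a)).+1 + 1).+1 + 1).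
    by pbd; exact: pt_sz.
  move=> a i hi; apply: leq_trans (sz_iter_sp i (arcs a)) _.
  rewrite leq_add2r leq_mul2l ltnS leq_add2r leq_mul2r; apply/orP; right.
  by apply/orP; right; rewrite sz_nat; lia.
apply: (pt_match_opt [::]); last exact: pt_cst.
  by apply: pt_best; pt; apply: pt_ptgt; pt.
by pt.
Qed.

End SpPtime.

(** * Ear sequences along a path *)

(* A directed edge: edge number, tail, head, cost at the tail, cost at the head. *)
Definition dart : eqType := (nat * (nat * (nat * (bits * bits))))%type.
Implicit Types x y z : dart.

Definition did x := x.1.
Definition dtl x := x.2.1.
Definition dhd x := x.2.2.1.
Definition dct x := x.2.2.2.1.
Definition dch x := x.2.2.2.2.

Definition heads (p : seq dart) : seq nat := [seq dhd x | x <- p].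

Fixpoint dpath (u : nat) (p : seq dart) (v : nat) : bool :=
  if p is x :: p' then (dtl x == u) && dpath (dhd x) p' v else u == v.

Lemma dpath_cat u (p1 p2 : seq dart) v :
  dpath u (p1 ++ p2) v = dpath u p1 (last u (heads p1)) && dpath (last u (heads p1)) p2 v.
Proof. by elim: p1 u => [|x p IH] u /=; rewrite ?eqxx // IH andbA. Qed.

Lemma dpath_last u (p : seq dart) v : dpath u p v -> last u (heads p) = v.
Proof. by elim: p u => [|x p IH] u /=; [move/eqP | case/andP=> _ /IH]. Qed.

Definition satisfied (L : nat -> nat) (p : seq dart) :=
  {in p, forall x, bval (dct x) <= L (dtl x) /\ bval (dch x) <= L (dhd x)}.

Section Ear.
Variables (s t : nat) (Pv : seq nat).
Hypotheses (uPv : uniq Pv) (headP : nth s Pv 0 = s) (lastP : last s Pv = t).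
Hypothesis P0 : 1 < size Pv.
Local Notation m := (size Pv).-1.

Local Notation pos v := (index v Pv).
Local Notation vtx i := (nth s Pv i).

(* [x :: w] continues an ear sequence along [P] up to [t'], when the ear before
   the current one has ended at position [b]. *)
Fixpoint earok (P : seq nat) (t' : nat) (b : nat) x (w : seq dart) : bool :=
  if w is y :: w' then
    if dhd x \in P then
      [&& dhd x != t', b < index (dhd x) P, b <= index (dtl y) P,
          index (dtl y) P < index (dhd x) P & earok P t' (index (dhd x) P) y w']
    else (dtl y == dhd x) && earok P t' b y w'
  else dhd x == t'.
Local Notation ok := (earok Pv t).

(* [c] is the cost, still to be paid, at the vertex in position [b], and the cost
   of [x] at its tail is already paid. *)
Fixpoint ecost (P : seq nat) (b c : nat) x (w : seq dart) : nat :=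
  if w is y :: w' then
    if dhd x \in P then
      (if index (dtl y) P == b then maxn c (bval (dct y)) else c + bval (dct y))
      + ecost P (index (dhd x) P) (bval (dch x)) y w'
    else maxn (bval (dch x)) (bval (dct y)) + ecost P b c y w'
  else c + bval (dch x).

Lemma vtxm : vtx m = t.
Proof. by rewrite nth_last lastP. Qed.

Lemma sizeP : size Pv = m.+1.
Proof. by rewrite prednK // ltnW. Qed.

Lemma t_in : t \in Pv.
Proof. by rewrite -vtxm mem_nth // sizeP. Qed.

Lemma pos_vtx i : i <= m -> pos (vtx i) = i.
Proof. by move=> h; rewrite index_uniq // sizeP ltnS. Qed.

Lemma vtx_pos v : v \in Pv -> vtx (pos v) = v.
Proof. exact: nth_index. Qed.

Lemma pos_le v : v \in Pv -> pos v <= m.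
Proof. by rewrite -index_mem sizeP ltnS. Qed.

Lemma pos_t : pos t = m.
Proof. by rewrite -vtxm pos_vtx. Qed.

Lemma pos_lt v : v \in Pv -> v != t -> pos v < m.
Proof.
move=> hv; rewrite ltn_neqAle pos_le // andbT; apply: contra => /eqP h.
by rewrite -(vtx_pos hv) h vtxm.
Qed.

Lemma pos_in a v : pos v < a -> a <= m -> v \in Pv.
Proof. by move=> h1 h2; rewrite -index_mem sizeP; apply: leq_trans h1 (leqW h2). Qed.

Lemma earok_mono b b' x (w : seq dart) : b' <= b -> ok b x w -> ok b' x w.
Proof.
elim: w x b b' => //= y w IH x b b' h; case: ifP => _.
  by case/and5P=> -> h1 h2 -> ->; rewrite (leq_ltn_trans h h1) (leq_trans h h2).
by case/andP=> -> /(IH _ _ _ h).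
Qed.

(** End positions increase along the sequence, so what is valid after a later end is valid after
    [b]. *)
Lemma earok_suffix b x (w1 : seq dart) z (w2 : seq dart) : ok b x (w1 ++ z :: w2) -> ok b z w2.
Proof.
elim: w1 x b => [|y w1 IH] x b /=; case: ifP => _.
- by case/and5P=> _ h _ _; apply: earok_mono; exact: ltnW.
- by case/andP.
- by case/and5P=> _ h _ _ /IH; apply: earok_mono; exact: ltnW.
- by case/andP=> _ /IH.
Qed.

Definition offheads (P : seq nat) (w : seq dart) := [seq h <- heads w | h \notin P].

Lemma offheadsE x (w : seq dart) :
  offheads Pv (x :: w) = if dhd x \in Pv then offheads Pv w else dhd x :: offheads Pv w.
Proof. by rewrite /offheads /=; case: (dhd x \in Pv). Qed.

Lemma mem_offheads (w : seq dart) h : (h \in offheads Pv w) = (h \notin Pv) && (h \in heads w).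
Proof. by rewrite mem_filter. Qed.

Lemma earok_end b x (w : seq dart) z : ok b x (rcons w z) -> dhd z = t.
Proof.
elim: w x b => [|y w IH] x b /=; case: ifP => _.
- by case/and5P=> _ _ _ _ /eqP.
- by case/andP=> _ /eqP.
- by case/and5P=> _ _ _ _ /IH.
- by case/andP=> _ /IH.
Qed.

(* Two visits of a vertex off the path can be shortcut, by [earok_suffix]. *)
Lemma earok_uniq b x (w : seq dart) : ok b x w -> exists x' w',
  [/\ ok b x' w', dtl x' = dtl x, {subset x' :: w' <= x :: w}
    & uniq (offheads Pv (x' :: w'))].
Proof.
elim: w x b => [|y w IH] x b hok.
  by exists x, [::]; split=> //; rewrite offheadsE; case: ifP.
move: (hok) => /=; case: ifP => hx.
  case/and5P=> h1 h2 h3 h4 /IH[y' [w' [k1 k2 k3 k4]]].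
  exists x, (y' :: w'); split=> //.
  - by rewrite /= hx h1 h2 k2 h3 h4 k1.
  - by move=> z; rewrite !(in_cons x) => /orP[->//|/k3->]; rewrite orbT.
  - by rewrite offheadsE hx.
case/andP=> /eqP hxy /IH[y' [w' [k1 k2 k3 k4]]].
have sub r : {subset r <= y' :: w'} -> {subset x :: r <= x :: y :: w}.
  by move=> hr z; rewrite !(in_cons x) => /orP[->//|/hr /k3->]; rewrite orbT.
case hin: (dhd x \in offheads Pv (y' :: w')); last first.
  exists x, (y' :: w'); split=> //; last by rewrite offheadsE hx /= hin.
    by rewrite /= hx k2 hxy eqxx.
  exact: sub.
move: hin; rewrite mem_offheads hx => /mapP[z zw hz].
have [r1 [r2 Er]] : exists r1 r2, y' :: w' = r1 ++ z :: r2.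
  by case/splitPr: zw => r1 r2; exists r1, r2.
have hlast : ok b x (y' :: w') by rewrite /= hx k2 hxy eqxx.
(* If [z] were the last dart, its head would be [t], which lies on the path, whereas the repeated
   vertex does not. *)
case: r2 Er => [|z' r2] Er.
  move: hlast; rewrite Er cats1 => /earok_end; rewrite -hz => ht.
  by rewrite ht t_in in hx.
have okz : ok b z (z' :: r2).
  by move: hlast; rewrite Er => /earok_suffix.
move: (okz); rewrite /= -hz hx => /andP[htl okz'].
exists x, (z' :: r2); split=> //.
- by rewrite /= hx htl.
- by apply: sub => v hv; rewrite Er mem_cat in_cons hv !orbT.
- rewrite offheadsE hx cons_uniq; move: k4; rewrite Er /offheads /heads map_cat filter_cat.
  rewrite cat_uniq => /and3P[_ _] /=; rewrite -hz hx /=.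
  by case/andP=> -> ->.
Qed.

(** When an ear ends at position [k], the charges made for [P] fall on positions from [b] to
    [k - 1], and the rest of the sequence is charged from [k] on, so no position is charged twice.
    If [b] is already the last position, its level is used up by the final dart, and [c] has to
    vanish. *)
Lemma ecost_le (L : nat -> nat) b c x (w : seq dart) :
  ok b x w -> (forall y, y \in w -> bval (dct y) <= L (dtl y)) ->
  (forall y, y \in x :: w -> bval (dch y) <= L (dhd y)) ->
  c <= L (vtx b) -> b <= m -> (b < m) || (c == 0) ->
  ecost Pv b c x w <=
    \sum_(b <= i < m.+1) L (vtx i) + \sum_(h <- offheads Pv (x :: w)) L h.
Proof.
elim: w x b c => [|y w IH] x b c.
  move=> /eqP hx _ hh hc bm hbm; rewrite /= offheadsE hx t_in big_nil addn0.
  have ht : bval (dch x) <= L (vtx m) by rewrite vtxm -hx hh ?mem_head.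
  rewrite big_nat_recr //=; case/orP: hbm => [h|/eqP->]; last by rewrite leq_add.
  by rewrite leq_add // big_ltn // (leq_trans hc) // leq_addr.
move=> /= hok ht hh hc bm hbm.
have ht' z : z \in w -> bval (dct z) <= L (dtl z).
  by move=> zw; apply: ht; rewrite in_cons zw orbT.
have hh' z : z \in y :: w -> bval (dch z) <= L (dhd z).
  by move=> zw; apply: hh; rewrite in_cons zw orbT.
have hx : bval (dch x) <= L (dhd x) by rewrite hh ?mem_head.
have hy : bval (dct y) <= L (dtl y) by rewrite ht ?mem_head.
rewrite offheadsE; case: ifP hok => hxP.
  case/and5P=> xt bk ba ak hok.
  have km := pos_lt hxP xt.
  have aP := pos_in ak (ltnW km).
  have := IH y (pos (dhd x)) (bval (dch x)) hok ht' hh'.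
  rewrite vtx_pos // hx km (ltnW km) => /(_ isT isT isT) IH'.
  rewrite (@big_cat_nat _ _ _ (pos (dhd x))) ?(ltnW bk) ?(leqW (ltnW km)) //=.
  rewrite -addnA leq_add //.
  have hs a : b <= a -> a < pos (dhd x) ->
      \sum_(b <= i < pos (dhd x)) L (vtx i) =
      \sum_(b <= i < a) L (vtx i) + (L (vtx a) + \sum_(a.+1 <= i < pos (dhd x)) L (vtx i)).
    by move=> h1 h2; rewrite (@big_cat_nat _ _ _ a) ?(ltnW h2) //= (big_ltn h2).
  case: eqP => [ab|/eqP ab].
    rewrite (hs b) // big_geq // add0n (leq_trans _ (leq_addr _ _)) //.
    by rewrite geq_max hc -ab vtx_pos.
  have {ab} ab : b < pos (dtl y) by rewrite ltn_neqAle eq_sym ab ba.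
  rewrite (hs (pos (dtl y))) // vtx_pos // leq_add //; last by rewrite (leq_trans hy) ?leq_addr.
  by rewrite big_ltn // (leq_trans hc) ?leq_addr.
case/andP=> /eqP hxy hok; rewrite big_cons addnCA leq_add //.
  by rewrite geq_max hx -hxy hy.
exact: IH.
Qed.

(** Every dart but the last either enters a vertex off the path or ends an ear and thereby raises
    [b]. *)
Lemma earok_size b x (w : seq dart) : ok b x w -> b <= m ->
  size w + b <= size (offheads Pv (x :: w)) + m.
Proof.
elim: w x b => [|y w IH] x b; first by move=> _ h; rewrite add0n (leq_trans h) ?leq_addl.
rewrite offheadsE [ok _ _ _]/= [size (y :: w)]/=; case: ifP => hxP.
  case/and5P=> xt bk _ ak hok _.
  by rewrite addSnnS (leq_trans _ (IH _ _ hok (pos_le hxP))) ?leq_add2l.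
by case/andP=> _ hok bm; rewrite !addSn ltnS IH.
Qed.

Definition charge (v k : nat) : nat -> nat := fun u => if u == v then k else 0.

Lemma sum_charge n v k : \sum_(u < n) charge v k u <= k.
Proof.
case: (ltnP v n) => h.
  rewrite (bigD1 (Ordinal h)) //= /charge eqxx big1 ?addn0 // => u.
  by rewrite -val_eqE /= => /negbTE->.
rewrite big1 // => u _; rewrite /charge.
by case: eqP => // e; move: (ltn_ord u); rewrite e ltnNge h.
Qed.

(** A converse of [ecost_le] without distinct vertices: every summand of the cost becomes a charge
    at its vertex, and repeated visits merely add up. *)
Lemma ecost_levels n b c x (w : seq dart) : ok b x w -> b <= m -> exists L : nat -> nat,
  [/\ \sum_(v < n) L v <= ecost Pv b c x w, c <= L (vtx b),
      bval (dch x) <= L (dhd x) & satisfied L w].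
Proof.
have sumD (f g : nat -> nat) : \sum_(v < n) (f v + g v) = \sum_(v < n) f v + \sum_(v < n) g v.
  exact: big_split.
elim: w x b c => [|y w IH] x b c.
  move=> _ _; exists (fun v => charge (vtx b) c v + charge (dhd x) (bval (dch x)) v); split=> //.
  - by rewrite sumD leq_add ?sum_charge.
  - by rewrite {1}/charge eqxx leq_addr.
  - by rewrite /charge eqxx leq_addl.
have subs L L' w' : satisfied L w' -> (forall v, L v <= L' v) -> satisfied L' w'.
  by move=> h h' z /h[h1 h2]; split; [apply: leq_trans h1 _ | apply: leq_trans h2 _].
have cons L : satisfied L w -> bval (dct y) <= L (dtl y) ->
    bval (dch y) <= L (dhd y) -> satisfied L (y :: w).
  by move=> h h1 h2 z; rewrite inE => /orP[/eqP->|/h].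
move=> /=; case: ifP => hxP.
  case/and5P=> xt bk ba ak hok bm.
  have km := pos_lt hxP xt.
  have aP := pos_in ak (ltnW km).
  have [L [h1 h2 h3 h4]] := IH _ _ (bval (dch x)) hok (ltnW km).
  rewrite vtx_pos // in h2.
  case: eqP => [ab|/eqP ab].
    exists (fun v => charge (vtx b) (maxn c (bval (dct y))) v + L v); split.
    + by rewrite sumD leq_add ?sum_charge.
    + by rewrite /charge eqxx; apply: leq_trans (leq_maxl _ _) (leq_addr _ _).
    + by rewrite (leq_trans h2) ?leq_addl.
    apply: cons; last by rewrite (leq_trans h3) ?leq_addl.
      by apply: subs h4 _ => v; rewrite leq_addl.
    by rewrite -ab vtx_pos // /charge eqxx; apply: leq_trans (leq_maxr _ _) (leq_addr _ _).
  exists (fun v => charge (vtx b) c v + (charge (dtl y) (bval (dct y)) v + L v)); split.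
  + rewrite (sumD (charge (vtx b) c) (fun v => charge (dtl y) (bval (dct y)) v + L v)).
    by rewrite sumD addnA leq_add // leq_add ?sum_charge.
  + by rewrite {1}/charge eqxx leq_addr.
  + by rewrite addnA (leq_trans h2) ?leq_addl.
  apply: cons; last by rewrite addnA (leq_trans h3) ?leq_addl.
    by apply: subs h4 _ => v; rewrite addnA leq_addl.
  by rewrite addnCA {1}/charge eqxx leq_addr.
case/andP=> /eqP hxy hok bm; have [L [h1 h2 h3 h4]] := IH _ _ c hok bm.
exists (fun v => charge (dhd x) (maxn (bval (dch x)) (bval (dct y))) v + L v); split.
- by rewrite sumD leq_add ?sum_charge.
- by rewrite (leq_trans h2) ?leq_addl.
- by rewrite /charge eqxx; apply: leq_trans (leq_maxl _ _) (leq_addr _ _).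
apply: cons; last by rewrite (leq_trans h3) ?leq_addl.
  by apply: subs h4 _ => v; rewrite leq_addl.
by rewrite hxy /charge eqxx; apply: leq_trans (leq_maxr _ _) (leq_addr _ _).
Qed.

(** * Two disjoint paths from a path and an ear sequence *)

Section TwoPaths.
Variable p : seq dart.
Hypotheses (hp : dpath s p t) (hPv : Pv = s :: heads p).

Let seg i j := drop i (take j p).

Lemma size_p : size p = m.
Proof. by rewrite hPv /= size_map. Qed.

Lemma last_take_heads j : j <= m -> last s (heads (take j p)) = vtx j.
Proof.
move=> h; rewrite /heads map_take (last_nth s) size_take_min size_map size_p.
rewrite (minn_idPl h) hPv; case: j h => //= j h.
by rewrite nth_take.
Qed.

Lemma dpath_seg i j : i <= j -> j <= m -> dpath (vtx i) (seg i j) (vtx j).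
Proof.
move=> ij jm; have im := leq_trans ij jm.
have := hp; rewrite -{1}(cat_take_drop j p) dpath_cat => /andP[+ _].
rewrite last_take_heads // -{1}(cat_take_drop i (take j p)) dpath_cat.
by rewrite take_takel // last_take_heads // => /andP[].
Qed.

Lemma heads_seg i j v : j <= m -> v \in heads (seg i j) -> [/\ v \in Pv, i < pos v & pos v <= j].
Proof.
move=> jm; rewrite /heads map_drop map_take -/(heads p) => hv.
have hu : uniq (s :: take j (heads p)).
  by have := take_uniq j.+1 uPv; rewrite hPv.
have hj : v \in take j (heads p) by exact: mem_drop hv.
have hin : v \in Pv by rewrite hPv in_cons (mem_take hj) orbT.
have sv : s != v by move: hu => /= /andP[+ _]; apply: contraNneq => ->.
have hpos : pos v = (index v (take j (heads p))).+1.
  rewrite hPv /= (negbTE sv); congr _.+1.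
  by rewrite -[in LHS](cat_take_drop j (heads p)) index_cat hj.
split=> //; rewrite hpos ?ltnS.
  rewrite leqNgt; apply: contraTN hv => hi; move: hu => /= /andP[_].
  rewrite -{1}(cat_take_drop i (take j (heads p))) cat_uniq => /and3P[_ /hasPn h _].
  apply/negP => hv; have := h _ hv; rewrite /= in_take ?hi //.
have := hj; rewrite -index_mem size_take_min => h; apply: leq_trans h _.
by rewrite geq_minl.
Qed.

Lemma uniq_heads_seg i j : uniq (heads (seg i j)).
Proof.
rewrite /heads map_drop map_take drop_uniq // take_uniq //.
by have := uPv; rewrite hPv => /= /andP[].
Qed.

Lemma mem_seg i j x : x \in seg i j -> x \in p.
Proof. by move=> /mem_drop /mem_take. Qed.

(* After an ear ends at [vtx k], its continuation along the path and the path
   below it exchange their roles. *)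
Lemma ear_two_paths b x (w : seq dart) : ok b x w -> uniq (offheads Pv (x :: w)) -> b <= m ->
  exists A B, [/\ dpath (vtx b) A t, dpath (dtl x) (x :: B) t,
    uniq (vtx b :: heads A) && uniq (heads (x :: B)),
    {in heads A ++ heads (x :: B), forall v,
       if v \in Pv then (b < pos v) || (v == t) else v \in offheads Pv (x :: w)} &
    {in heads A, forall v, v \in heads (x :: B) -> v = t} /\
    {subset A ++ B <= p ++ w}].
Proof.
elim: w x b => [|y w IH] x b.
  move=> /eqP hx _ bm; exists (seg b m), [::]; split.
  - by rewrite -vtxm dpath_seg.
  - by rewrite /= hx !eqxx.
  - rewrite /= uniq_heads_seg !andbT; apply/negP => /heads_seg[//|_].
    by rewrite pos_vtx // ltnn.
  - move=> v; rewrite mem_cat => /orP[/heads_seg[//|-> ->//]|].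
    by rewrite inE => /eqP->; rewrite hx t_in eqxx orbT.
  - split; first by move=> v _; rewrite inE hx => /eqP.
    by move=> z; rewrite !cats0 => /mem_seg.
rewrite offheadsE /=; case: ifP => hxP.
  case/and5P=> xt bk ba ak hok hu bm.
  have km := pos_lt hxP xt.
  have aP := pos_in ak (ltnW km).
  have [A [B [h1 h2 h3 h4 [h5 h6]]]] := IH _ _ hok hu (ltnW km).
  rewrite vtx_pos // in h1 h3.
  have hA v : v \in heads A -> if v \in Pv then (pos (dhd x) < pos v) || (v == t)
      else v \in offheads Pv (y :: w).
    by move=> hv; apply: h4; rewrite mem_cat hv.
  have hB v : v \in heads (y :: B) -> if v \in Pv then (pos (dhd x) < pos v) || (v == t)
      else v \in offheads Pv (y :: w).
    by move=> hv; apply: h4; rewrite mem_cat hv orbT.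
  have low v : v \in Pv -> pos v <= pos (dhd x) -> (pos (dhd x) < pos v) || (v == t) = false.
    move=> vP hv; rewrite ltnNge hv /=; apply/eqP => vt.
    by move: (leq_trans (leq_ltn_trans hv km) (leqnn m)); rewrite vt pos_t ltnn.
  have segP v : v \in heads (seg b (pos (dtl y))) ->
      [/\ v \in Pv, b < pos v & pos v <= pos (dtl y)].
    by apply: heads_seg; exact: ltnW (ltn_trans ak km).
  (* For the rest of the sequence, [A] leaves the head of [x] and [y :: B] leaves the tail of [y].
     Extended to the front, the first gets [x] and the second the segment of the path from position
     [b]. *)
  exists (seg b (pos (dtl y)) ++ y :: B), A.
  have hAh : heads (seg b (pos (dtl y)) ++ y :: B) = heads (seg b (pos (dtl y))) ++ heads (y :: B).
    by rewrite /heads map_cat.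
  have d1 : dpath (vtx b) (seg b (pos (dtl y))) (dtl y).
    by rewrite -{2}(vtx_pos aP) dpath_seg // ltnW // (ltn_trans ak).
  case/andP: h3 => /= /andP[u1 u2] /andP[u3 u4].
  have uY : uniq (heads (y :: B)) by rewrite /= u3 u4.
  split.
  - by rewrite dpath_cat (dpath_last d1) d1.
  - by rewrite /= eqxx.
  - rewrite hAh mem_cat negb_or cat_uniq uniq_heads_seg uY u1 u2 !andbT -andbA.
    apply/and3P; split.
    + by apply/negP => /segP[_]; rewrite pos_vtx // ltnn.
    + have bP : vtx b \in Pv by apply: mem_nth; rewrite sizeP ltnS.
      by apply/negP => /hB; rewrite bP (low _ bP) // pos_vtx // ltnW.
    + apply/hasPn => v hv; apply/negP => /segP[vP _ va]; have := hB v hv.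
      by rewrite vP low // (leq_trans va) // ltnW.
  - move=> v; rewrite hAh !mem_cat -orbA => /or3P[/segP[-> -> _]//|/hB|].
    + by case: ifP => // _ /orP[h|->]; rewrite ?orbT // (ltn_trans bk h).
    + rewrite inE => /orP[/eqP->|/hA]; first by rewrite hxP bk.
      by case: ifP => // _ /orP[h|->]; rewrite ?orbT // (ltn_trans bk h).
  split.
  - move=> v; rewrite hAh mem_cat => /orP[/segP[vP _ va]|vB].
      rewrite inE => /orP[/eqP vx|/hA]; first by rewrite -vx ltnNge va in ak.
      by rewrite vP low // (leq_trans va) // ltnW.
    rewrite inE => /orP[/eqP vx|/h5]; last exact.
    by have := hB v vB; rewrite vx hxP low.
  - move=> z; have := h6 z; rewrite !mem_cat !in_cons => h.
    case/orP=> [/orP[/mem_seg->//|/orP[->|zB]]|zA]; first by rewrite orbT.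
      by move: h; rewrite zB ?orbT => /(_ isT)/orP[->|->]; rewrite ?orbT.
    by move: h; rewrite zA ?orbT => /(_ isT)/orP[->|->]; rewrite ?orbT.
case/andP=> /eqP hxy hok /andP[hx hu] bm.
have [A [B [h1 h2 h3 h4 [h5 h6]]]] := IH _ _ hok hu bm.
have xn v : v \in heads A ++ heads (y :: B) -> v != dhd x.
  move=> /h4; case: ifP => [vP _|_ hv]; last by apply: contraNneq hx => <-.
  by apply: contraFneq hxP => <-.
exists A, (y :: B); split=> //.
- by rewrite /= eqxx /= -hxy; move: h2; rewrite /= eqxx.
- case/andP: h3 => hA hB; apply/andP; split=> //.
  rewrite hB andbT.
  by apply/negP => hv; have := xn (dhd x); rewrite eqxx mem_cat hv orbT => /(_ isT).
- move=> v; rewrite mem_cat => /orP[hv|].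
    have := h4 v; rewrite mem_cat hv => /(_ isT).
    by case: ifP => // _ h; rewrite in_cons h orbT.
  rewrite in_cons => /orP[/eqP->|hv].
    by rewrite hxP mem_head.
  have := h4 v; rewrite mem_cat hv orbT => /(_ isT).
  by case: ifP => // _ h; rewrite in_cons h orbT.
split.
- move=> v hv; rewrite in_cons => /orP[/eqP vx|]; last exact: h5.
  by have := xn v; rewrite vx eqxx mem_cat -vx hv => /(_ isT).
- move=> z; have := h6 z; rewrite !mem_cat !in_cons => h.
  case/or3P=> [zA|->|zB]; last 1 first.
  + by move: h; rewrite zB ?orbT => /(_ isT)/orP[->|->]; rewrite ?orbT.
  + by move: h; rewrite zA ?orbT => /(_ isT)/orP[->|->]; rewrite ?orbT.
  + by rewrite orbT.
Qed.

End TwoPaths.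

(** The starts of the ears after the current one increase, so the sequence can be cut at the last
    ear that starts before [k]; all ears after that one start at [k] or later. *)
Lemma earok_cut b k x (w : seq dart) : ok b x w -> ok k x w \/
  exists y w', [/\ ok k y w', pos (dtl y) < k, b <= pos (dtl y) & {subset y :: w' <= w}].
Proof.
elim: w x b => [|y w IH] x b; first by left.
move=> /=; case: ifP => hx.
  case/and5P=> xt bk ba ak hok.
  case: (leqP k (pos (dtl y))) => hk.
    by left; rewrite xt hok ak (leq_ltn_trans hk ak).
  right; case: (IH _ _ hok) => [hok'|[z [w' [h1 h2 h3 h4]]]]; first by exists y, w; split.
  exists z, w'; split=> //; first by rewrite (leq_trans ba) // (leq_trans _ h3) // ltnW.
  by move=> v /h4; rewrite in_cons => ->; rewrite orbT.
case/andP=> hxy hok; case: (IH _ _ hok) => [hok'|[z [w' [h1 h2 h3 h4]]]].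
  by left; rewrite hxy.
right; exists z, w'; split=> // v /h4; rewrite in_cons => ->; exact: orbT.
Qed.

(** An ear under construction: its inner vertices are off the path, and its last head is left
    free. *)
Fixpoint offpath x (w : seq dart) : bool :=
  if w is y :: w' then [&& dhd x \notin Pv, dtl y == dhd x & offpath y w'] else true.

Lemma offpath_rcons x (w : seq dart) y :
  offpath x (rcons w y) =
  [&& offpath x w, dhd (last x w) \notin Pv & dtl y == dhd (last x w)].
Proof. by elim: w x => [|z w IH] x /=; rewrite ?andbT // IH -!andbA. Qed.

Lemma earok_cat b z (w w' : seq dart) : offpath z w -> ok b (last z w) w' -> ok b z (w ++ w').
Proof.
elim: w z => //= y w IH z /and3P[hz hzy /IH h] /h {}h.
by rewrite (negbTE hz) hzy.
Qed.

Variable good : pred dart.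

(** [jump j j.+1] is an ear that bypasses the vertex in position [j]. The case [jump 1 1] is for a
    path of length one, which has no inner vertex to bypass. *)
Definition jump j j' := exists z w,
  [/\ offpath z w, dtl z \in Pv, pos (dtl z) < j, all good (z :: w)
    & (dhd (last z w) \in Pv) && (j' <= pos (dhd (last z w)))].

(** Follow [q] until it reaches position [j'] or beyond; its last stretch off the path is the ear.
    The disjunction is the invariant: the walk is on the path before [j], or inside an ear that
    started there. A dart with both ends on the path has to be [good] only if it makes the crossing,
    which an edge of the path cannot do when [j'] is [j.+1]. *)
Lemma jump_dpath j j' u (q : seq dart) : j <= j' -> j' <= m ->
  (forall x, x \in q -> dhd x \in Pv -> (pos (dhd x) < j) || (j' <= pos (dhd x))) ->
  (forall x, x \in q ->
     (dtl x \in Pv -> dhd x \in Pv -> pos (dtl x) < j /\ j' <= pos (dhd x)) -> good x) ->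
  dpath u q t ->
  (u \in Pv) && (pos u < j) \/ u \notin Pv /\ (exists z w,
    [/\ offpath z w, dtl z \in Pv, pos (dtl z) < j, all good (z :: w) & dhd (last z w) = u]) ->
  jump j j'.
Proof.
move=> jj' jm; elim: q u => [|x q IH] u.
  move=> _ _ /eqP -> [/andP[_]|[]]; last by rewrite t_in.
  by rewrite pos_t => /leq_trans/(_ jj')/leq_trans/(_ jm); rewrite ltnn.
move=> hg hgood /= /andP[/eqP xu hq] hu.
have {}IH := IH (dhd x) _ _ hq.
have hg' y : y \in q -> dhd y \in Pv -> (pos (dhd y) < j) || (j' <= pos (dhd y)).
  by move=> yq; apply: hg; rewrite in_cons yq orbT.
have hgood' y : y \in q ->
     (dtl y \in Pv -> dhd y \in Pv -> pos (dtl y) < j /\ j' <= pos (dhd y)) -> good y.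
  by move=> yq; apply: hgood; rewrite in_cons yq orbT.
have {IH} := IH hg' hgood'.
have gx := hgood x (mem_head x q).
case hx: (dhd x \in Pv); last first.
  apply; right; split=> //; case: hu => [/andP[uP ul]|[uP [z [w [h1 h2 h3 h4 h5]]]]].
    exists x, [::]; split; rewrite ?xu //= gx // => _; by rewrite hx.
  exists z, (rcons w x); split; rewrite ?last_rcons //.
    by rewrite offpath_rcons h1 h5 uP xu eqxx.
  by case/andP: h4 => /= -> h4; rewrite all_rcons h4 gx // => _; rewrite hx.
case/orP: (hg x (mem_head x q) hx) => hpos; first by apply; left; rewrite hpos.
move=> _; case: hu => [/andP[uP ul]|[uP [z [w [h1 h2 h3 h4 h5]]]]].
  exists x, [::]; split; rewrite ?xu //= ?hx ?hpos ?gx // => _ _.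
  by rewrite xu.
exists z, (rcons w x); split; rewrite ?last_rcons ?hx ?hpos //.
  by rewrite offpath_rcons h1 h5 uP xu eqxx.
by case/andP: h4 => /= -> h4; rewrite all_rcons h4 gx // xu (negbTE uP).
Qed.

(** The sequence is built backwards from [t]. If it starts at a position [a > 0], an ear bypassing
    [a] is put in front of the part that [earok_cut] keeps at the end of this ear; the start
    decreases until it is [s]. *)
Lemma ear_exists : (forall j, 0 < j < m -> jump j j.+1) -> (m = 1 -> jump 1 1) ->
  exists x w, [/\ dtl x = s, ok 1 x w & all good (x :: w)].
Proof.
move=> hj h1.
suff main a : a < m -> (exists x w,
    [/\ dtl x \in Pv, pos (dtl x) = a, ok 1 x w & all good (x :: w)]) ->
    exists x w, [/\ dtl x = s, ok 1 x w & all good (x :: w)].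
  have close z w : dhd (last z w) \in Pv -> m <= pos (dhd (last z w)) -> offpath z w ->
      ok 1 z w.
    move=> hP hm /(@earok_cat 1 z w [::]); rewrite cats0; apply=> /=.
    have /eqP e : pos (dhd (last z w)) == m by rewrite eqn_leq pos_le.
    by rewrite -(vtx_pos hP) e vtxm.
  have m0 : 0 < m by rewrite -ltnS -sizeP.
  (* An ear that bypasses the last inner vertex can only end at [t], so it is a valid sequence by
     itself. *)
  case: (ltnP 1 m) => hm.
    have [z [w [k1 k2 k3 k4 /andP[k5 k6]]]] : jump m.-1 m.
      by have := hj m.-1; rewrite (ltn_predK hm) leqnn -ltnS (ltn_predK hm) hm; apply.
    apply: (main (pos (dtl z))); first exact: leq_trans k3 (leq_pred _).
    by exists z, w; split=> //; exact: close.
  have me : m = 1 by apply/eqP; rewrite eqn_leq hm.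
  have [z [w [k1 k2 k3 k4 /andP[k5 k6]]]] := h1 me.
  apply: (main (pos (dtl z))); first by rewrite me.
  by exists z, w; split=> //; apply: close => //; rewrite me.
have [n] := ubnP a; elim: n a => // n IH a /ltnSE an am [y [w [k1 k2 k3 k4]]].
case: (posnP a) => a0.
  by exists y, w; split=> //; rewrite -(vtx_pos k1) k2 a0 headP.
have [z [q [l1 l2 l3 l4 /andP[l5 l6]]]] : jump a a.+1 by apply: hj; rewrite a0.
apply: (IH (pos (dtl z))); [exact: leq_trans l3 an | exact: ltn_trans am|].
have l7 := pos_le l5.
case: (eqVneq (dhd (last z q)) t) => zt.
  exists z, q; split=> //; rewrite -[q]cats0; apply: earok_cat => //=; exact/eqP.
have [y' [w' [c1 c2 c3 c4]]] : exists y' w',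
    [/\ ok (pos (dhd (last z q))) y' w', pos (dtl y') < pos (dhd (last z q)),
      1 <= pos (dtl y') & {subset y' :: w' <= y :: w}].
  case: (earok_cut (pos (dhd (last z q))) k3) => [h|[y' [w' [c1 c2 c3 c4]]]].
    by exists y, w; split=> //; rewrite k2.
  exists y', w'; split=> // v /c4; rewrite in_cons => ->; exact: orbT.
exists z, (q ++ y' :: w'); split=> //.
  apply: earok_cat => //=; rewrite l5 zt c1 c2 c3 /= !andbT.
  exact: leq_ltn_trans c3 c2.
rewrite -cat_cons all_cat l4; apply/allP => v /c4; exact: (allP k4).
Qed.

End Ear.

(** * Cheapest ear sequences *)

Definition estate : eqType := (nat * (bits * dart))%type.
Definition earc : eqType := arc estate (seq dart).

Section EarAlgorithm.
Variables (s t : nat) (Pv : seq nat) (ds : seq dart).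

(* Nothing is pending when the first ear starts; position 1 with cost 0 stands for
   that, since the other ears need not start at [s]. *)
Definition ear_init : seq earc :=
  [seq (None, (Some (1, ([::], x)), (dct x, [:: x]))) | x <- [seq x <- ds | dtl x == s]].

(** A pending end is the head of some dart and its pending cost is the cost of that dart there, so
    these pairs exhaust the possible values and the state space is polynomial. *)
Definition ear_pend : seq (nat * bits) :=
  (1, [::]) :: [seq (index (dhd x) Pv, dch x) | x <- ds].

Definition ear_next (pd : nat * bits) (x y : dart) : seq earc :=
  if dhd x \in Pv then
    if [&& dhd x != t, pd.1 < index (dhd x) Pv, pd.1 <= index (dtl y) Pv &
           index (dtl y) Pv < index (dhd x) Pv] then
      [:: (Some (pd.1, (pd.2, x)), (Some (index (dhd x) Pv, (dch x, y)),
            (if index (dtl y) Pv == pd.1 then bmax pd.2 (dct y) else badd pd.2 (dct y),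
             [:: y])))]
    else [::]
  else if dtl y == dhd x then
    [:: (Some (pd.1, (pd.2, x)), (Some (pd.1, (pd.2, y)), (bmax (dch x) (dct y), [:: y])))]
  else [::].

Definition ear_fin (pd : nat * bits) (x : dart) : seq earc :=
  if dhd x == t then [:: (Some (pd.1, (pd.2, x)), (None, (badd pd.2 (dch x), [::])))]
  else [::].

Definition ear_arcs : seq earc :=
  ear_init ++ flatten [seq flatten [seq ear_fin pd x ++
    flatten [seq ear_next pd x y | y <- ds] | x <- ds] | pd <- ear_pend].

Definition ear (N : nat) : option (bits * seq dart) :=
  if sp N ear_arcs is Some p
  then Some (bweight p, flatten [seq alab a | a <- p]) else None.

Lemma ear_arc_None a : a \in ear_arcs -> asrc a = None -> exists x,
  [/\ x \in ds, dtl x = s & a = (None, (Some (1, ([::], x)), (dct x, [:: x])))].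
Proof.
rewrite mem_cat => /orP[/mapP[x]|].
  by rewrite mem_filter => /andP[/eqP h1 h2] -> _; exists x.
case/flatten_mapP=> pd _ /flatten_mapP[x _]; rewrite mem_cat => /orP[|/flatten_mapP[y _]].
  by rewrite /ear_fin; case: ifP => // _; rewrite inE => /eqP->.
by rewrite /ear_next; case: (dhd x \in Pv); case: ifP => // _; rewrite inE => /eqP->.
Qed.

Lemma ear_arc_Some a b c x : a \in ear_arcs -> asrc a = Some (b, (c, x)) ->
  a \in ear_fin (b, c) x \/ exists2 y, y \in ds & a \in ear_next (b, c) x y.
Proof.
rewrite mem_cat => /orP[/mapP[y _ ->] //|].
case/flatten_mapP=> -[b' c'] _ /flatten_mapP[x' _].
rewrite mem_cat => /orP[ha|/flatten_mapP[y yds ha]] hs.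
  by move: ha hs; rewrite /ear_fin; case: ifP => // e;
    rewrite inE => /eqP-> [<- <- <-]; left; rewrite e mem_head.
right; exists y => //; move: ha hs; rewrite /ear_next.
case e: (dhd x' \in Pv); case: ifP => // h; rewrite inE => /eqP-> [<- <- <-].
  by rewrite e h mem_head.
by rewrite e h mem_head.
Qed.

Lemma ear_walk_sound p b c x :
  pchain (Some (b, (c, x))) p None -> all [in ear_arcs] p ->
  all (fun a => asrc a != None) p -> exists w,
  [/\ flatten [seq alab a | a <- p] = w, all [in ds] w, earok Pv t b x w
    & ecost Pv b (bval c) x w = weight p].
Proof.
elim: p b c x => //= a p IH b c x /andP[/eqP ha hp] /andP[aA pA] /andP[_ pN].
rewrite /weight big_cons -/(weight p).
case: (ear_arc_Some aA ha) => [|[y yds]].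
  rewrite /ear_fin; case: ifP => // hx; rewrite inE => /eqP ea.
  move: hp pN; rewrite ea /=; case: p pA {IH} => [|a' p] //= pA.
    by move=> _ _; exists [::]; split=> //=; rewrite /weight big_nil /awt /= bval_add addn0.
  by case/andP=> /eqP-> .
rewrite /ear_next; case hx: (dhd x \in Pv); case: ifP => // h; rewrite inE => /eqP ea.
  move: hp; rewrite ea /= => hp; have [w [h1 h2 h3 h4]] := IH _ _ _ hp pA pN.
  exists (y :: w); split; rewrite ?h1 //=; first by rewrite yds.
    by rewrite hx; case/and4P: h => -> -> -> ->.
  by rewrite hx h4 /awt /=; case: ifP => _; rewrite ?bval_max ?bval_add.
move: hp; rewrite ea /= => hp; have [w [h1 h2 h3 h4]] := IH _ _ _ hp pA pN.
exists (y :: w); split; rewrite ?h1 //=; first by rewrite yds.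
  by rewrite hx h.
by rewrite hx h4 /awt /= bval_max.
Qed.

Lemma ear_sound N c ws : ear N = Some (c, ws) -> exists x w,
  [/\ ws = x :: w, all [in ds] ws, dtl x = s, earok Pv t 1 x w
    & bval c = bval (dct x) + ecost Pv 1 0 x w].
Proof.
rewrite /ear; case E: sp => [[|a p]|] // [<- <-]; case/and4P: (sp_sound E) => //= _.
case/andP=> aA pA pN /andP[/eqP a0 hp].
have [x [xds xs ea]] := ear_arc_None aA a0.
move: hp; rewrite ea /= => hp.
have [w [h1 h2 h3 h4]] := ear_walk_sound hp pA pN.
exists x, w; split=> //; rewrite ?h1 //=; first by rewrite xds.
by rewrite bval_weight /weight big_cons h4.
Qed.

Lemma ear_walk_complete b c x w : (b, c) \in ear_pend -> all [in ds] (x :: w) ->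
  earok Pv t b x w -> exists p,
  [/\ pchain (Some (b, (c, x))) p None, all [in ear_arcs] p, size p = (size w).+1
    & weight p = ecost Pv b (bval c) x w].
Proof.
have mem pd x' a : pd \in ear_pend -> x' \in ds ->
    a \in ear_fin pd x' ++ flatten [seq ear_next pd x' y | y <- ds] -> a \in ear_arcs.
  move=> h1 h2 h3; rewrite mem_cat; apply/orP; right.
  by apply/flatten_mapP; exists pd => //; apply/flatten_mapP; exists x'.
elim: w b c x => [|y w IH] b c x hpd /=.
  move=> /andP[xds _] hx.
  exists [:: (Some (b, (c, x)), (None, (badd c (dch x), [::])))]; split=> //=.
  - by rewrite eqxx.
  - rewrite andbT; apply: (mem (b, c) x) => //.
    by rewrite mem_cat /ear_fin hx mem_head.
  - by rewrite /weight big_seq1 /awt /= bval_add.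
case/and3P=> xds yds wds; case: ifP => hx.
  case/and5P=> k1 k2 k3 k4 hok.
  have hpd' : (index (dhd x) Pv, dch x) \in ear_pend.
    by rewrite in_cons (map_f (fun x => (index (dhd x) Pv, dch x))) ?orbT.
  have [|p [h1 h2 h3 h4]] := IH _ _ y hpd' _ hok; first by rewrite /= yds.
  set wt := if index (dtl y) Pv == b then bmax c (dct y) else badd c (dct y).
  exists ((Some (b, (c, x)), (Some (index (dhd x) Pv, (dch x, y)), (wt, [:: y]))) :: p).
  split=> /=; rewrite ?h3 ?h2 ?h1 ?eqxx //.
    rewrite andbT; apply: (mem (b, c) x) => //.
    rewrite mem_cat; apply/orP; right; apply/flatten_mapP; exists y => //.
    by rewrite /ear_next hx /= k1 k2 k3 k4 mem_head.
  rewrite /weight big_cons -/(weight p) h4 /awt /= /wt.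
  by case: ifP => _; rewrite ?bval_max ?bval_add.
case/andP=> k1 hok.
have [|p [h1 h2 h3 h4]] := IH _ _ y hpd _ hok; first by rewrite /= yds.
exists ((Some (b, (c, x)), (Some (b, (c, y)), (bmax (dch x) (dct y), [:: y]))) :: p).
split=> /=; rewrite ?h3 ?h2 ?h1 ?eqxx //.
  rewrite andbT; apply: (mem (b, c) x) => //.
  rewrite mem_cat; apply/orP; right; apply/flatten_mapP; exists y => //.
  by rewrite /ear_next hx k1 mem_head.
by rewrite /weight big_cons -/(weight p) h4 /awt /= bval_max.
Qed.

(** The sequence [x :: w] corresponds to [size w + 2] arcs: the initial one, one for each dart of
    [w], and the final one. *)
Lemma ear_complete N x w : all [in ds] (x :: w) -> dtl x = s ->
  earok Pv t 1 x w -> size w + 2 <= N -> exists c ws,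
  ear N = Some (c, ws) /\ bval c <= bval (dct x) + ecost Pv 1 0 x w.
Proof.
move=> hds xs hok hN.
have [|p [h1 h2 h3 h4]] := @ear_walk_complete 1 [::] x w _ hds hok; first exact: mem_head.
pose a : earc := (None, (Some (1, ([::], x)), (dct x, [:: x]))).
have aA : a \in ear_arcs.
  rewrite mem_cat; apply/orP; left; apply/mapP; exists x => //.
  by rewrite mem_filter xs eqxx; case/andP: hds.
have [||||q Eq hq] := @sp_complete _ _ N ear_arcs (a :: p); rewrite //= ?aA ?h3 //.
  by move: hN; rewrite addn2.
exists (bweight q), (flatten [seq alab a | a <- q]); split; first by rewrite /ear Eq.
by rewrite bval_weight (leq_trans hq) // /weight big_cons -/(weight p) h4.
Qed.

End EarAlgorithm.

#[global] Instance Enc_dart : Enc dart := @Enc_prod nat (nat * (nat * (bits * bits))) _ _.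
#[global] Instance EqPt_dart : EqPt dart :=
  @EqPt_prod nat (nat * (nat * (bits * bits)))%type _ _ _ _.
#[global] Instance Enc_estate : Enc estate := @Enc_prod nat (bits * dart) _ _.
#[global] Instance EqPt_estate : EqPt estate :=
  @EqPt_prod nat (bits * dart)%type _ _ _ _.
#[global] Instance Enc_earc : Enc earc := Enc_arc (K := estate) (L := seq dart).

Lemma pt_ear A {eA : Enc A} (s t N : A -> nat) (Pv : A -> seq nat) (ds : A -> seq dart) :
  ptime s -> ptime t -> ptime N -> ptime Pv -> ptime ds ->
  ptime (fun a => ear (s a) (t a) (Pv a) (ds a) (N a)).
Proof.
move=> hs ht hN hP hd; rewrite /ear.
have hPv : ptime (fun a : A * A => Pv a.1) by apply: (pt_comp hP); pt.
have ha : ptime (fun a => ear_arcs (s a) (t a) (Pv a) (ds a)).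
  rewrite /ear_arcs /ear_init /ear_pend /ear_fin /ear_next /dtl /dhd /dct /dch; pt.
  all: try solve [by apply: (pt_comp hs); pt | by apply: (pt_comp ht); pt
    | by apply: (pt_comp hP); pt | by apply: (pt_comp hd); pt].
apply: (pt_match_opt [::]); last exact: pt_cst.
  by apply: (pt_sp (K := estate) (L := seq dart)).
by rewrite /alab; pt; apply: (pt_bweight (K := estate) (L := seq dart)); pt.
Qed.

(** * Augmenting a path *)

Definition cut (v : nat) (q : seq dart) : seq dart :=
  if v \in heads q then drop (index v (heads q)).+1 q else q.

(** Loop erasure from the right: a dart is put in front of a path that no longer returns to its
    head. *)
Definition erase (s : nat) (p : seq dart) : seq dart :=
  cut s (foldr (fun x q => x :: cut (dhd x) q) [::] p).

Lemma cutP v (q : seq dart) t : dpath v q t -> uniq (heads q) ->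
  [/\ dpath v (cut v q) t, uniq (v :: heads (cut v q)) & {subset cut v q <= q}].
Proof.
rewrite /cut; case: ifP => hv hq hu; last by split=> //=; rewrite hv.
have hi : index v (heads q) < size q by rewrite -(size_map dhd) index_mem.
have E : q = take (index v (heads q)).+1 q ++ drop (index v (heads q)).+1 q.
  by rewrite cat_take_drop.
have hl : last v (heads (take (index v (heads q)).+1 q)) = v.
  rewrite (take_nth (head (0, (0, (0, ([::], [::])))) q)) //.
  rewrite /heads map_rcons last_rcons -(nth_map _ 0) // nth_index //.
split; last by move=> x /mem_drop.
  by move: hq; rewrite {1}E dpath_cat hl => /andP[].
move: hu; rewrite {1}E /heads map_cat cat_uniq => /and3P[_ /hasPn h hd].
rewrite cons_uniq hd andbT; apply/negP => hin; have /negP := h v hin; apply.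
by rewrite -{1}hl; case: (q) hi => //= x q' _; rewrite mem_last.
Qed.

Lemma eraseP s (p : seq dart) t : dpath s p t ->
  [/\ dpath s (erase s p) t, uniq (s :: heads (erase s p)) & {subset erase s p <= p}].
Proof.
move=> hp; rewrite /erase; set q := foldr _ _ _.
have [h1 h2 h3] : [/\ dpath s q t, uniq (heads q) & {subset q <= p}].
  rewrite /q; elim: p s hp {q} => [|x p IH] s //= /andP[-> /IH[h1 h2 h3]].
  have [k1 k2 k3] := cutP h1 h2; split=> //.
  by move=> z; rewrite !in_cons => /orP[->//|/k3 /h3 ->]; rewrite orbT.
have [k1 k2 k3] := cutP h1 h2; split=> //.
by move=> z /k3 /h3.
Qed.

Lemma pt_cut A {eA : Enc A} (v : A -> nat) (q : A -> seq dart) :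
  ptime v -> ptime q -> ptime (fun a => cut (v a) (q a)).
Proof.
move=> hv hq; rewrite /cut /heads /dhd; pt.
Qed.

Lemma pt_erase A {eA : Enc A} (s : A -> nat) (p : A -> seq dart) :
  ptime s -> ptime p -> ptime (fun a => erase (s a) (p a)).
Proof.
move=> hs hp; apply: pt_cut => //.
apply: (pt_foldr (step := fun _ (x : dart) q => x :: cut (dhd x) q)) => //.
- by pt; rewrite /dhd; apply: pt_cut; pt.
- exact: pt_cst.
exists (fun a => sz (p a)); first exact: pt_sz.
move=> a l1 l2 ->.
have h : sz (l1 ++ l2) + 1 = sz l1 + sz l2 by exact: sz_cat.
have h' : 0 < sz l1 by exact: sz_gt0.
have h2 : sz (foldr (fun (x : dart) q => x :: cut (dhd x) q) [::] l2) <= sz l2; last first.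
  by apply: leq_trans h2 _; rewrite -(leq_add2r 1) h addnC leq_add2r.
elim: l2 {h} => //= x l IH; rewrite !sz_cons ltnS leq_add2l; apply: leq_trans _ IH.
set r := foldr _ _ _; rewrite /cut; case: ifP => // _; set i := _.+1.
have h : sz (take i r ++ drop i r) + 1 = sz (take i r) + sz (drop i r) by exact: sz_cat.
have h0 : 0 < sz (take i r) by exact: sz_gt0.
rewrite cat_take_drop in h.
by rewrite -(leq_add2r 1) h addnC leq_add2r.
Qed.

Definition drev x : dart := (did x, (dhd x, (dtl x, (dch x, dct x)))).

Definition dids (p : seq dart) : seq nat := [seq did x | x <- p].

Definition wfd (n : nat) (ds : seq dart) :=
  {in ds, forall x, [/\ dtl x < n, dhd x < n & dtl x != dhd x]} /\
  {in ds &, forall x y, did x = did y -> y = x \/ y = drev x}.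

Lemma satisfied_sub L (p q : seq dart) : {subset q <= p} -> satisfied L p -> satisfied L q.
Proof. by move=> h hs x /h /hs. Qed.

Lemma satisfied_cat L (p q : seq dart) : satisfied L p -> satisfied L q -> satisfied L (p ++ q).
Proof. by move=> h1 h2 x; rewrite mem_cat => /orP[/h1|/h2]. Qed.

Lemma dpath_dtl u (p : seq dart) v x : dpath u p v -> x \in p -> dtl x \in u :: heads p.
Proof.
elim: p u => //= y p IH u /andP[/eqP <- hp]; rewrite in_cons => /orP[/eqP->|/(IH _ hp)].
  exact: mem_head.
by rewrite !in_cons => ->; rewrite orbT.
Qed.

Lemma dhd_in (p : seq dart) x : x \in p -> dhd x \in heads p.
Proof. exact: map_f. Qed.

Lemma dpath_first u (p : seq dart) v x : dpath u p v -> uniq (u :: heads p) -> x \in p ->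
  dtl x = u -> exists q, p = x :: q.
Proof.
case: p => //= y p /andP[/eqP yu hp] /andP[+ _]; rewrite in_cons => hu.
case/orP=> [/eqP->|xp xu]; first by exists p.
by have := dpath_dtl hp xp; rewrite xu in_cons (negbTE hu).
Qed.

Lemma sum_uniq_le n (L : nat -> nat) (l : seq nat) : uniq l ->
  {in l, forall v, v < n} -> \sum_(v <- l) L v <= \sum_(v < n) L v.
Proof.
move=> hu hl; rewrite -(big_mkord xpredT) /index_iota subn0.
have /permPl/(perm_big _) -> /= : perm_eql (iota 0 n) (l ++ [seq v <- iota 0 n | v \notin l]).
  apply/permPl; apply: uniq_perm; rewrite ?iota_uniq // ?cat_uniq ?hu ?filter_uniq ?iota_uniq //.
    by rewrite andbT /=; apply/hasPn => v; rewrite mem_filter => /andP[].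
  move=> v; rewrite mem_cat mem_filter mem_iota /= add0n.
  by case hv: (v \in l) => //=; rewrite hl.
by rewrite big_cat leq_addr.
Qed.

(** Edge numbers are compared separately, because a single edge from [u] to [v] taken twice has no
    inner vertex to share. *)
Definition disjoint_dpaths (u v : nat) A B :=
  [/\ dpath u A v, dpath u B v, uniq (u :: heads A), uniq (u :: heads B) &
    {in heads A, forall r, r \in heads B -> r = v} /\
    {in A & B, forall x y, did x <> did y}].

(** * Cheapest paths and cheapest augmentations between two nodes *)

Section Stage.
Variables (n u v : nat) (ds : seq dart).
Hypotheses (wf : wfd n ds) (uv : u != v).

Lemma ear_finish (Pv : seq nat) (L : nat -> nat) (good : pred dart) ds' N :
  {subset ds' <= ds} ->
  uniq Pv -> nth u Pv 0 = u -> last u Pv = v -> 1 < size Pv ->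
  {in Pv, forall r, r < n} ->
  (forall x, good x -> [/\ x \in ds', bval (dct x) <= L (dtl x) & bval (dch x) <= L (dhd x)]) ->
  (forall j, 0 < j < (size Pv).-1 -> jump Pv good j j.+1) ->
  ((size Pv).-1 = 1 -> jump Pv good 1 1) -> n <= N ->
  exists c ws, ear u v Pv ds' N = Some (c, ws) /\
    bval c <= \sum_(r < n) L r.
Proof.
move=> sub0 uP hP lP sP nP hg hj h1 nN.
have [x0 [w0 [xs0 hok0 hg0]]] := ear_exists hP lP sP hj h1.
have [x [w [hok xs sub hu]]] := earok_uniq lP sP hok0.
have {xs0} xs : dtl x = u by rewrite xs.
have gw z : z \in x :: w -> good z by move=> /sub; exact: (allP hg0).
have hsz := earok_size sP hok.
have m1 : 1 <= (size Pv).-1 by rewrite -ltnS prednK // ltnW.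
have uPo : uniq (Pv ++ offheads Pv (x :: w)).
  rewrite cat_uniq uP hu andbT /=; apply/hasPn => z.
  by rewrite mem_offheads => /andP[].
have nPo : {in Pv ++ offheads Pv (x :: w), forall r, r < n}.
  move=> z; rewrite mem_cat => /orP[/nP//|]; rewrite mem_offheads => /andP[_ /mapP[y yw ->]].
  by case: (hg y (gw y yw)) => /sub0/(proj1 wf)[].
have [||c [ws [E hc]]] := @ear_complete u v Pv ds' N x w _ xs hok.
- by apply/allP => z zw; case: (hg z (gw z zw)).
- have hsize : size (Pv ++ offheads Pv (x :: w)) <= n.
    rewrite -(size_iota 0 n); apply: uniq_leq_size => // z /nPo.
    by rewrite mem_iota add0n.
  move: (hsz m1) hsize (m1) (sP) nN; rewrite size_cat.
  by move: (size w) (size (offheads _ _)) (size Pv) => a b k; lia.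
exists c, ws; split=> //; apply: leq_trans hc _.
apply: leq_trans (sum_uniq_le L uPo nPo); rewrite big_cat /=.
have hc := @ecost_le u v Pv lP sP L 1 0 x w hok.
have -> : \sum_(r <- Pv) L r = \sum_(0 <= i < (size Pv).-1.+1) L (nth u Pv i).
  by rewrite prednK ?(ltnW sP) // (big_nth u).
(* Position 0 pays for the tail of the first dart, which [ecost] leaves out. *)
rewrite big_ltn // hP -addnA leq_add //.
  by rewrite -xs; case: (hg x (gw x (mem_head _ _))).
apply: hc => //; last by rewrite orbT.
  by move=> y yw; case: (hg y); rewrite ?gw // in_cons yw orbT.
by move=> y /gw /hg[].
Qed.

(** An ear could end early only at [u], but its position 0 does not exceed the initial [b = 1];
    hence there is a single ear. *)
Lemma virtual_sound (N : nat) c ws : ear u v [:: u; v] ds N = Some (c, ws) ->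
  [/\ dpath u ws v, {subset ws <= ds} &
    exists2 L : nat -> nat, \sum_(r < n) L r <= bval c & satisfied L ws].
Proof.
case/ear_sound=> x [w [-> hds xs hok hc]].
have uP : uniq [:: u; v] by rewrite /= inE uv.
split.
- rewrite /= xs eqxx; elim: w x hok {hds hc xs} => [|y w IH] x.
    by move/eqP=> ->; rewrite /= eqxx.
  rewrite [earok _ _ _ _ _]/=; case: ifP => hx; last by case/andP=> hyx /IH; rewrite /= hyx.
  case/and5P=> xv i1 _ _ _; move: hx i1; rewrite !inE (negbTE xv) orbF => /eqP ->.
  by rewrite /= eqxx.
- by move=> z /(allP hds).
have [L [h1 h2 h3 h4]] := ecost_levels (erefl : last u [:: u; v] = v) isT n 0 hok isT.
exists (fun r => charge (dtl x) (bval (dct x)) r + L r).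
  by rewrite big_split /= hc leq_add // sum_charge.
move=> z; rewrite in_cons => /orP[/eqP->|/h4[k1 k2]].
  by rewrite {1}/charge eqxx leq_addr (leq_trans h3) ?leq_addl.
by rewrite (leq_trans k1) ?leq_addl ?(leq_trans k2) ?leq_addl.
Qed.

Lemma virtual_complete (N : nat) L R : {subset R <= ds} -> satisfied L R -> dpath u R v ->
  u < n -> v < n -> n <= N ->
  exists c ws, ear u v [:: u; v] ds N = Some (c, ws) /\ bval c <= \sum_(r < n) L r.
Proof.
move=> Rds hL hR un vn nN.
have uP : uniq [:: u; v] by rewrite /= inE uv.
apply: (@ear_finish [:: u; v] L [in R] ds N) => //.
- by move=> r; rewrite !inE => /orP[]/eqP->.
- by move=> x xR; split; [exact: Rds | case: (hL x xR) ..].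
- by move=> [|[]].
move=> _; apply: (jump_dpath uP (erefl : last u [:: u; v] = v) _ _ _ _ _ hR) => //.
- by move=> x _ _; case: index.
- by left; rewrite mem_head /= eqxx.
Qed.

Section WithPath.
Variable P : seq dart.
Hypotheses (Pds : {subset P <= ds}) (hP : dpath u P v) (uP : uniq (u :: heads P)).
Let Pv := u :: heads P.
Let ds2 := [seq x <- ds | did x \notin dids P].

Lemma lastPv : last u Pv = v.
Proof. exact: dpath_last hP. Qed.

Lemma sizePv : 1 < size Pv.
Proof. by rewrite /Pv; case: (P) hP => [/eqP e|x q] //=; have := uv; rewrite e eqxx. Qed.

Lemma path_pos x : x \in P ->
  [/\ dtl x \in Pv, dhd x \in Pv & index (dhd x) Pv = (index (dtl x) Pv).+1].
Proof.
move=> xP; split; first exact: dpath_dtl hP xP.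
  by rewrite in_cons dhd_in ?orbT.
have [q1 [q2 E]] : exists q1 q2, P = q1 ++ x :: q2.
  by case/splitPr: xP => q1 q2; exists q1, q2.
have := hP; rewrite E dpath_cat => /andP[_ /andP[/eqP ht _]].
have Eh : Pv = (u :: heads q1) ++ dhd x :: heads q2 by rewrite /Pv E /heads map_cat.
have hidx : index (dhd x) Pv = (size q1).+1.
  have := uP; rewrite -/Pv Eh cat_uniq index_cat => /and3P[_ /hasPn h _].
  by rewrite (negbTE (h _ (mem_head _ _))) /= eqxx addn0 size_map.
rewrite hidx ht; congr _.+1.
have <- : nth u Pv (size q1) = last u (heads q1).
  by rewrite Eh nth_cat /= size_map ltnS leqnn -(size_map dhd) (last_nth u).
by rewrite index_uniq // Eh size_cat /= size_map ltnS leq_addr.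
Qed.

Lemma stage_sound N c ws : ear u v Pv ds2 N = Some (c, ws) ->
  [/\ {subset ws <= ds}, exists2 L : nat -> nat, \sum_(r < n) L r <= bval c & satisfied L ws &
    exists A B, disjoint_dpaths u v A B /\ {subset A ++ B <= P ++ ws}].
Proof.
case/ear_sound=> x0 [w0 [-> hds xs0 hok0 hc]].
have sub2 : {subset ds2 <= ds} by move=> z; rewrite mem_filter => /andP[].
have m1 : 0 < (size Pv).-1 by rewrite -ltnS prednK ?sizePv // ltnW // sizePv.
split.
- by move=> z /(allP hds) /sub2.
- have [L [h1 h2 h3 h4]] := ecost_levels lastPv sizePv n 0 hok0 m1.
  exists (fun r => charge (dtl x0) (bval (dct x0)) r + L r).
    by rewrite big_split /= hc leq_add // sum_charge.
  move=> z; rewrite in_cons => /orP[/eqP->|/h4[k1 k2]].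
    by rewrite {1}/charge eqxx leq_addr (leq_trans h3) ?leq_addl.
  by rewrite (leq_trans k1) ?leq_addl ?(leq_trans k2) ?leq_addl.
have [x [w [hok xs sub hu]]] := earok_uniq lastPv sizePv hok0.
have {xs0} xs : dtl x = u by rewrite xs.
have [A [B [h1 h2 /andP[h3 h4] h5 [h6 h7]]]] :=
  ear_two_paths uP lastPv sizePv hP erefl hok hu m1.
have hw z : z \in x :: w -> z \in ds2 by move=> /sub /(allP hds).
have [e [P' EP]] : exists e P', P = e :: P'.
  by case: (P) hP => [|e P'] /=; [by move/eqP=> e; have := uv; rewrite e eqxx | by exists e, P'].
have heu : dtl e = u by have := hP; rewrite EP /= => /andP[/eqP].
have e1 : nth u Pv 1 = dhd e by rewrite /Pv EP.
rewrite e1 in h1 h3.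
have uNe : u != dhd e by have := uP; rewrite EP /= in_cons negb_or => /andP[/andP[]].
have Bh r : r \in heads A ++ heads (x :: B) -> r != u /\ (r = dhd e -> r = v).
  move=> /h5; case: ifP => rP.
    case/orP=> [h|/eqP->]; last by split=> //; rewrite eq_sym.
    split; first by apply: contraTneq h => ->; rewrite /= eqxx.
    move=> re; move: h; rewrite re -e1 index_uniq ?sizePv //.
  move=> _; split; first by apply: contraFneq rP => ->; rewrite mem_head.
  by move=> re; rewrite re -e1 mem_nth ?sizePv in rP.
(* [ear_two_paths] was applied from position 1, the head of the first edge [e] of [P]; with [e] in
   front, both paths start at [u]. *)
exists (e :: A), (x :: B); split; last first.
  move=> z; rewrite cat_cons in_cons mem_cat in_cons mem_cat.
  have hz := h7 z; rewrite !mem_cat in hz.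
  have sw y : y \in w -> y \in x0 :: w0 by move=> yw; apply: sub; rewrite in_cons yw orbT.
  case/or3P=> [/eqP->|zA|/orP[/eqP->|zB]].
  - by rewrite EP mem_head.
  - by move: hz; rewrite zA => /(_ isT)/orP[->//|/sw->]; rewrite orbT.
  - by rewrite sub ?mem_head ?orbT.
  - by move: hz; rewrite zB orbT => /(_ isT)/orP[->//|/sw->]; rewrite orbT.
have uA : uniq (u :: heads (e :: A)).
  rewrite cons_uniq h3 andbT /= in_cons negb_or uNe.
  by apply/negP => hin; have [] := Bh u; rewrite ?mem_cat ?hin ?eqxx.
have uB : uniq (u :: heads (x :: B)).
  rewrite cons_uniq h4 andbT; apply/negP => hin.
  by have [] := Bh u; rewrite ?mem_cat ?hin ?orbT ?eqxx.
have dA : dpath u (e :: A) v by rewrite /= heu eqxx.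
have dB : dpath u (x :: B) v by rewrite -xs.
have common r : r \in heads (e :: A) -> r \in heads (x :: B) -> r = v.
  rewrite /= in_cons => /orP[/eqP re|rA] rB; last exact: h6.
  by have [|_] := Bh r; [rewrite mem_cat rB orbT | apply].
split=> //; split=> // y z yA zB did_eq.
have yds : y \in ds.
  move: yA; rewrite in_cons => /orP[/eqP->|yA]; first by apply: Pds; rewrite EP mem_head.
  have := h7 y; rewrite !mem_cat yA => /(_ isT)/orP[/Pds//|yw].
  by apply: sub2; apply: hw; rewrite in_cons yw orbT.
have zds : z \in ds.
  move: zB; rewrite in_cons => /orP[/eqP->|zB]; first by apply: sub2; apply: hw; rewrite mem_head.
  have := h7 z; rewrite !mem_cat zB orbT => /(_ isT)/orP[/Pds//|zw].
  by apply: sub2; apply: hw; rewrite in_cons zw orbT.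
have tA y' : y' \in e :: A -> dtl y' = u \/ dtl y' \in heads (e :: A).
  by move=> /(dpath_dtl dA); rewrite in_cons => /orP[/eqP|]; [left|right].
have tB z' : z' \in x :: B -> dtl z' = u \/ dtl z' \in heads (x :: B).
  by move=> /(dpath_dtl dB); rewrite in_cons => /orP[/eqP|]; [left|right].
have nA y' : y' \in e :: A -> dhd y' != u.
  by move=> /dhd_in hy; apply: contraTneq hy => ->; move: uA; rewrite cons_uniq => /andP[].
have nB z' : z' \in x :: B -> dhd z' != u.
  by move=> /dhd_in hy; apply: contraTneq hy => ->; move: uB; rewrite cons_uniq => /andP[].
have [_ _ yloop] := proj1 wf y yds.
(* A common edge traversed in opposite directions would have both ends equal to [v]. In the same
   direction it would lead from [u] to [v] and thus be both [e] and [x], but [x] is not an edge of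
   [P]. *)
case: (proj2 wf y z yds zds did_eq) => ez; last first.
  have zt : dtl z = dhd y by rewrite ez.
  have zh : dhd z = dtl y by rewrite ez.
  have e1' : dhd y = v.
    apply: common; first exact: dhd_in.
    case: (tB z zB) => [zu|]; last by rewrite zt.
    by have := nA y yA; rewrite -zt zu eqxx.
  have e2' : dtl y = v.
    apply: common; last by rewrite -zh; exact: dhd_in.
    case: (tA y yA) => // yu.
    by have := nB z zB; rewrite zh yu eqxx.
  by rewrite e1' e2' eqxx in yloop.
subst z.
have yv : dhd y = v by apply: common; exact: dhd_in.
have yu : dtl y = u.
  case: (tA y yA) => // h1'; case: (tB y zB) => // h2'.
  by rewrite yv (common _ h1' h2') eqxx in yloop.
have [q [ey _]] := dpath_first dA uA yA yu.
have [q' [ey' _]] := dpath_first dB uB zB yu.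
have := hw x (mem_head _ _); rewrite mem_filter ey' -ey => /andP[+ _].
by rewrite /dids EP /= mem_head.
Qed.

(** Since [A] and [B] meet only at their ends, one of them avoids a given inner vertex of [P] and
    supplies an ear that bypasses it. If [P] is a single edge, one of them avoids that edge. *)
Lemma stage_complete L A B N : {subset A <= ds} -> {subset B <= ds} ->
  satisfied L A -> satisfied L B -> disjoint_dpaths u v A B -> u < n -> n <= N ->
  exists c ws, ear u v Pv ds2 N = Some (c, ws) /\ bval c <= \sum_(r < n) L r.
Proof.
move=> Ads Bds LA LB [dA dB uA uB [cAB dAB]] un nN.
have sub2 : {subset ds2 <= ds} by move=> z; rewrite mem_filter => /andP[].
pose good x := (did x \notin dids P) && (x \in A ++ B).
have ABds : {subset A ++ B <= ds} by move=> z; rewrite mem_cat => /orP[/Ads|/Bds].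
have LAB : satisfied L (A ++ B) by exact: satisfied_cat.
have sP := sizePv.
apply: (@ear_finish Pv L good ds2 N) => //.
- exact: lastPv.
- move=> r; rewrite in_cons => /orP[/eqP->//|/mapP[x xP ->]].
  by case: (proj1 wf x (Pds xP)).
- move=> x /andP[h1 h2]; case: (LAB x h2) => *; split=> //.
  by rewrite mem_filter h1 ABds.
- move=> j /andP[j0 jm].
  have [q [dq sq nq]] : exists q, [/\ dpath u q v, {subset q <= A ++ B}
       & nth u Pv j \notin heads q].
    case hA: (nth u Pv j \in heads A); last first.
      by exists A; rewrite hA; split=> // z zA; rewrite mem_cat zA.
    exists B; split=> //; first by move=> z zB; rewrite mem_cat zB orbT.
    apply/negP => hB; have jv := cAB _ hA hB.
    have : index (nth u Pv j) Pv = index v Pv by rewrite jv.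
    rewrite index_uniq ?(leq_trans jm (leq_pred _)) // -lastPv -nth_last.
    rewrite index_uniq ?(ltn_predK sP) // => je.
    by rewrite je ltnn in jm.
  apply: (jump_dpath uP lastPv sP _ _ _ _ dq) => //.
  + move=> x xq hx; rewrite -neq_ltn; apply: contraNneq nq => <-.
    by rewrite nth_index // dhd_in.
  (* An edge of [P], in either direction, joins consecutive positions and cannot skip position
     [j]. *)
  + move=> x xq hpos; rewrite /good sq // andbT; apply/negP => /mapP[y yP dxy].
    have [k1 k2 k3] := path_pos yP.
    case: (proj2 wf y x (Pds yP) (ABds _ (sq _ xq)) (esym dxy)) => ex.
      case: hpos; rewrite ex // k3 => h1 h2.
      by move: (leq_ltn_trans (h2 : j <= _) h1); rewrite ltnn.
    have ht : dtl x = dhd y by rewrite ex.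
    have hh : dhd x = dtl y by rewrite ex.
    have [||h1 h2] := hpos; rewrite ?ht ?hh //.
    move: h1 h2; rewrite ht hh k3 => h1 h2; by move: (ltn_trans h2 (ltnW h1)); rewrite ltnn.
  + by left; rewrite mem_head /= eqxx.
move=> m1.
have [e EP] : exists e, P = [:: e].
  by move: m1; rewrite /Pv /= size_map; case: (P) => [|e [|]] //; exists e.
have [q [dq sq nq]] : exists q, [/\ dpath u q v, {subset q <= A ++ B}
     & did e \notin dids q].
  case hA: (did e \in dids A); last first.
    by exists A; rewrite hA; split=> // z zA; rewrite mem_cat zA.
  exists B; split=> //; first by move=> z zB; rewrite mem_cat zB orbT.
  case/mapP: hA => x xA ex; apply/negP => /mapP[y yB ey].
  by apply: (dAB x y xA yB); rewrite -ex -ey.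
apply: (jump_dpath uP lastPv sP _ _ _ _ dq) => //.
- by move=> x _ _; case: index.
- move=> x xq _; rewrite /good sq // andbT EP /dids /= inE.
  by apply: contraNneq nq => <-; exact: map_f.
- by left; rewrite mem_head /= eqxx.
Qed.

End WithPath.

End Stage.

(** * Two disjoint paths with given levels at the ends *)

Definition dzero (u v : nat) x : dart :=
  (did x, (dtl x, (dhd x,
    (if (dtl x == u) || (dtl x == v) then [::] else dct x,
     if (dhd x == u) || (dhd x == v) then [::] else dch x)))).

Definition dlevel (u : nat) (a : bits) x : bool :=
  ((dtl x == u) ==> ble (dct x) a) && ((dhd x == u) ==> ble (dch x) a).

(** Edges above the guessed levels are dropped and the others become free at the two ends, whose
    levels are paid by the outer search. *)
Definition restrict (u : nat) (a : bits) (v : nat) (b : bits) (ds : seq dart) : seq dart :=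
  [seq dzero u v x | x <- [seq x <- ds | dlevel u a x && dlevel v b x]].

Definition pair_alg (N u v : nat) (ds : seq dart) : option (bits * seq nat) :=
  if ear u v [:: u; v] ds N is Some r1 then
    if ear u v (u :: heads (erase u r1.2))
         [seq x <- ds | did x \notin dids (erase u r1.2)] N is Some r2
    then Some (badd r1.1 r2.1, dids (erase u r1.2) ++ dids r2.2) else None
  else None.

Definition res N u a v b ds := pair_alg N u v (restrict u a v b ds).

Definition skel x := (did x, (dtl x, dhd x)).

Lemma eq_skel x y : skel x = skel y -> [/\ did x = did y, dtl x = dtl y & dhd x = dhd y].
Proof. by case. Qed.

Section SkelMap.
Variable f : dart -> dart.

Lemma map_skel (p : seq dart) : {in p, forall x, skel (f x) = skel x} ->
  heads (map f p) = heads p /\ dids (map f p) = dids p.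
Proof.
by move=> h; split; rewrite /heads /dids -map_comp; apply/eq_in_map => x /h /eq_skel[].
Qed.

Lemma dpath_map u (p : seq dart) v : {in p, forall x, skel (f x) = skel x} ->
  dpath u (map f p) v = dpath u p v.
Proof.
elim: p u => //= x p IH u h; have /eq_skel[_ -> ->] := h x (mem_head _ _).
by rewrite IH // => y yp; apply: h; rewrite in_cons yp orbT.
Qed.

Lemma disjoint_map u v A B : {in A ++ B, forall x, skel (f x) = skel x} ->
  disjoint_dpaths u v A B -> disjoint_dpaths u v (map f A) (map f B).
Proof.
move=> h [h1 h2 h3 h4 [h5 h6]].
have hA : {in A, forall x, skel (f x) = skel x} by move=> x xA; apply: h; rewrite mem_cat xA.
have hB : {in B, forall x, skel (f x) = skel x}.
  by move=> x xA; apply: h; rewrite mem_cat xA orbT.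
have [eA _] := map_skel hA; have [eB _] := map_skel hB.
split; rewrite ?dpath_map ?eA ?eB //; split=> //.
move=> _ _ /mapP[x xA ->] /mapP[y yB ->].
have /eq_skel[-> _ _] := hA x xA; have /eq_skel[-> _ _] := hB y yB.
exact: h6.
Qed.

End SkelMap.

(** Undoes [dzero]: number and end nodes suffice to find a dart of [ds] with its original costs. *)
Definition unskel (ds : seq dart) x := head x [seq y <- ds | skel y == skel x].

Lemma unskelP ds x : skel x \in map skel ds ->
  unskel ds x \in ds /\ skel (unskel ds x) = skel x.
Proof.
case/mapP=> y yds e; rewrite /unskel.
have : y \in [seq y <- ds | skel y == skel x] by rewrite mem_filter e eqxx.
case E: [seq y <- ds | skel y == skel x] => [|z r] // _ /=.
have : z \in [seq y <- ds | skel y == skel x] by rewrite E mem_head.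
by rewrite mem_filter => /andP[/eqP].
Qed.

Lemma dzero_drev u v x : dzero u v (drev x) = drev (dzero u v x).
Proof. by []. Qed.

Lemma restrict_mem u a v b ds x : x \in restrict u a v b ds -> exists y,
  [/\ y \in ds, x = dzero u v y, dlevel u a y & dlevel v b y].
Proof.
by case/mapP=> y; rewrite mem_filter => /andP[/andP[h1 h2] yds] ->; exists y.
Qed.

Lemma restrict_wf n u a v b ds : wfd n ds -> wfd n (restrict u a v b ds).
Proof.
move=> [h1 h2]; split; first by move=> _ /restrict_mem[x [xds -> _ _]]; exact: (h1 x xds).
move=> _ _ /restrict_mem[x [xds -> _ _]] /restrict_mem[y [yds -> _ _]] e.
by case: (h2 x y xds yds e) => ->; [left | right; rewrite dzero_drev].
Qed.

Section Res.
Variables (n u v : nat) (a b : bits) (ds : seq dart) (N : nat).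
Hypotheses (wf : wfd n ds) (uv : u != v).
Let ds' := restrict u a v b ds.
Let wf' : wfd n ds' := restrict_wf u a v b wf.

Lemma res_sound c es : res N u a v b ds = Some (c, es) ->
  (exists2 L : nat -> nat, \sum_(r < n) L r <= bval c &
     forall x, x \in ds -> did x \in es ->
       bval (dct x) <= charge u (bval a) (dtl x) + charge v (bval b) (dtl x) + L (dtl x) /\
       bval (dch x) <= charge u (bval a) (dhd x) + charge v (bval b) (dhd x) + L (dhd x)) /\
  exists A B, [/\ disjoint_dpaths u v A B, {subset A ++ B <= ds} &
                  {subset dids (A ++ B) <= es}].
Proof.
rewrite /res /pair_alg -/ds'; case E1: ear => [[c1 w1]|] //=.
case E2: ear => [[c2 w2]|] // [<- <-].
have [h1 h2 [L1 h3 h4]] := virtual_sound n uv E1.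
set P := erase u w1 in E2 *.
have [k1 k2 k3] := eraseP h1.
have Pds : {subset P <= ds'} by move=> x /k3 /h2.
have [w2ds [L2 h5 h6] [A [B [hAB sAB]]]] := stage_sound wf' uv Pds k1 k2 E2.
have sds : {subset P ++ w2 <= ds'} by move=> x; rewrite mem_cat => /orP[/Pds|/w2ds].
split.
  exists (fun r => L1 r + L2 r); first by rewrite big_split bval_add leq_add.
  move=> x xds; rewrite /dids -map_cat => /mapP[y' yP e].
  have [y [yds ey l1 l2]] := restrict_mem (sds y' yP).
  have hy' : bval (dct y') <= L1 (dtl y') + L2 (dtl y') /\
             bval (dch y') <= L1 (dhd y') + L2 (dhd y').
    move: yP; rewrite mem_cat => /orP[/k3 /h4|/h6] [i1 i2].
      by split; [apply: leq_trans i1 (leq_addr _ _) | apply: leq_trans i2 (leq_addr _ _)].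
    by split; [apply: leq_trans i1 (leq_addl _ _) | apply: leq_trans i2 (leq_addl _ _)].
  have hy : bval (dct y) <= charge u (bval a) (dtl y) + charge v (bval b) (dtl y) +
                (L1 (dtl y) + L2 (dtl y)) /\
            bval (dch y) <= charge u (bval a) (dhd y) + charge v (bval b) (dhd y) +
                (L1 (dhd y) + L2 (dhd y)).
    (* At an end the cost is within the guessed level because the edge passed [dlevel]; elsewhere
       [dzero] did not change it. *)
    have aux (r : nat) (d : bits) k : bval (if (r == u) || (r == v) then [::] else d) <= k ->
        (r == u) ==> ble d a -> (r == v) ==> ble d b ->
        bval d <= charge u (bval a) r + charge v (bval b) r + k.
      rewrite !bval_le /charge; case: eqP => _; case: eqP => _ /=; lia.
    move: hy' l1 l2; rewrite ey => -[i1 i2] /andP[l1 l2] /andP[l3 l4].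
    by split; apply: aux.
  have edid : did y = did x by rewrite e ey.
  by case: (proj2 wf y x yds xds edid) => -> //; case: hy; split.
pose f := unskel ds.
have hf x : x \in A ++ B -> f x \in ds /\ skel (f x) = skel x.
  move=> /sAB /sds /restrict_mem[y [yds -> _ _]]; apply: unskelP.
  by apply/mapP; exists y.
exists (map f A), (map f B); split.
- by apply: disjoint_map => // x /hf[].
- by rewrite -map_cat => _ /mapP[x /hf[xds _] ->].
- rewrite -map_cat /dids -!map_cat => _ /mapP[_ /mapP[x xAB ->] ->].
  have [_ /eq_skel[-> _ _]] := hf x xAB.
  by apply: map_f; exact: sAB.
Qed.

(** Away from [u] and [v] the two given paths visit different nodes, so a cheapest path costs at
    most half of the sum, and the augmentation at most the whole sum. Doubling gives the factors 2
    and 1 + 2 = 3. *)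
Lemma res_complete L A B : {subset A ++ B <= ds} -> satisfied L (A ++ B) ->
  disjoint_dpaths u v A B -> L u <= bval a -> L v <= bval b -> u < n -> v < n -> n <= N ->
  exists c es, res N u a v b ds = Some (c, es) /\
    2 * bval c <= 3 * \sum_(r < n | (val r != u) && (val r != v)) L r.
Proof.
move=> sAB LAB hAB La Lb un vn nN.
pose f := dzero u v.
have hf x : skel (f x) = skel x by [].
have hAB' : disjoint_dpaths u v (map f A) (map f B) by apply: disjoint_map.
have hlev r e : r \in [:: u; v] -> L r <= bval e -> {in A ++ B, forall x, dlevel r e x}.
  move=> _ hr x xAB; have [i1 i2] := LAB x xAB.
  rewrite /dlevel !bval_le; apply/andP; split; apply/implyP => /eqP er.
    by apply: leq_trans i1 _; rewrite er.
  by apply: leq_trans i2 _; rewrite er.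
have sAB' : {subset map f (A ++ B) <= ds'}.
  move=> _ /mapP[x xAB ->]; apply: map_f; rewrite mem_filter sAB //.
  by rewrite (hlev u a) ?(hlev v b) ?inE ?eqxx ?orbT.
have sA' : {subset map f A <= ds'} by move=> x xA; apply: sAB'; rewrite map_cat mem_cat xA.
have sB' : {subset map f B <= ds'}.
  by move=> x xA; apply: sAB'; rewrite map_cat mem_cat xA orbT.
pose L0 r := if (r == u) || (r == v) then 0 else L r.
have LAB0 : satisfied L0 (map f (A ++ B)).
  move=> _ /mapP[x xAB ->]; have [i1 i2] := LAB x xAB; rewrite /L0 /f /dzero.
  split; rewrite /dct /dch /dtl /dhd /=; case: ifP => _ //.
have LA0 : satisfied L0 (map f A).
  by apply: satisfied_sub LAB0 => x xA; rewrite map_cat mem_cat xA.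
have LB0 : satisfied L0 (map f B).
  by apply: satisfied_sub LAB0 => x xA; rewrite map_cat mem_cat xA orbT.
(* Levels may drop to zero off the heads of [p]: the only other node visited is [u], whose level is
   already zero. *)
have only p : dpath u p v -> satisfied L0 p ->
    satisfied (fun r => if r \in heads p then L0 r else 0) p.
  move=> hp hL x xp; have [i1 i2] := hL x xp; split; last by rewrite dhd_in.
  have := dpath_dtl hp xp; rewrite in_cons => /orP[/eqP xu|->] //.
  by move: i1; rewrite xu {1}/L0 eqxx leqn0 => /eqP->.
case: (hAB') => dA dB uA uB [cAB dAB].
have [c1 [w1 [E1 hA1]]] := virtual_complete wf' uv sA' (only _ dA LA0) dA un vn nN.
have [c1' [w1' [E1' hB1]]] := virtual_complete wf' uv sB' (only _ dB LB0) dB un vn nN.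
move: E1'; rewrite E1 => -[ec _]; rewrite -{c1' w1'}ec in hB1.
have half : 2 * bval c1 <= \sum_(r < n) L0 r.
  rewrite mul2n -addnn; apply: leq_trans (leq_add hA1 hB1) _.
  rewrite -big_split /=; apply: leq_sum => r _.
  case hA: (val r \in heads (map f A)); case hB: (val r \in heads (map f B)) => //.
    by rewrite (cAB _ hA hB) /L0 eqxx orbT.
  by rewrite addn0.
have [h1 h2 _] := virtual_sound n uv E1.
have [k1 k2 k3] := eraseP h1.
have Pds : {subset erase u w1 <= ds'} by move=> x /k3 /h2.
have [c2 [w2 [E2 h2']]] := stage_complete wf' uv Pds k1 k2 sA' sB' LA0 LB0 hAB' un nN.
exists (badd c1 c2), (dids (erase u w1) ++ dids w2); split.
  by rewrite /res /pair_alg -/ds' E1 /= E2.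
have -> : \sum_(r < n | (val r != u) && (val r != v)) L r = \sum_(r < n) L0 r.
  rewrite big_mkcond; apply: eq_bigr => r _; rewrite /L0.
  by case: eqP; case: eqP.
rewrite bval_add; lia.
Qed.

End Res.

Lemma pt_res A {eA : Enc A} (N u v : A -> nat) (a b : A -> bits) (ds : A -> seq dart) :
  ptime N -> ptime u -> ptime v -> ptime a -> ptime b -> ptime ds ->
  ptime (fun i => res (N i) (u i) (a i) (v i) (b i) (ds i)).
Proof.
move=> hN hu hv ha hb hd.
have hr : ptime (fun i => restrict (u i) (a i) (v i) (b i) (ds i)).
  rewrite /restrict /dzero /dlevel /did /dtl /dhd /dct /dch; pt.
  all: try solve [by apply: (pt_comp hu); pt | by apply: (pt_comp hv); pt
    | by apply: (pt_comp ha); pt | by apply: (pt_comp hb); pt].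
rewrite /res /pair_alg.
apply: (pt_match_opt ([::], [::])); last exact: pt_cst.
  by apply: pt_ear => //; pt.
have he : ptime (fun p : A * (bits * seq dart) => erase (u p.1) p.2.2).
  by apply: pt_erase; [apply: (pt_comp hu); pt | pt].
have hdid : ptime did by rewrite /did; pt.
apply: (pt_match_opt ([::], [::])); last exact: pt_cst.
  apply: pt_ear.
  - by apply: (pt_comp hu); pt.
  - by apply: (pt_comp hv); pt.
  - by apply: (pt_comp hN); pt.
  - by rewrite /heads /dhd; pt; apply: (pt_comp hu); pt.
  - rewrite /dids /did; pt; first by apply: (pt_comp he); pt.
    by apply: (pt_comp hr); pt.
rewrite /dids /did; pt.
by apply: (pt_comp he); pt.
Qed.

(** * Edge-disjoint paths *)

Definition edge_disjoint_dpaths (u v : nat) A B :=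
  [/\ dpath u A v, dpath u B v & {in A & B, forall x y, did x <> did y}].

Definition drevp (p : seq dart) : seq dart := rev (map drev p).

Lemma dpath_drevp u (p : seq dart) v : dpath u p v -> dpath v (drevp p) u.
Proof.
elim: p u => [|x p IH] u /=; first by rewrite eq_sym.
case/andP=> /eqP xu /IH; rewrite /drevp /= rev_cons -cats1 dpath_cat => h.
by rewrite (dpath_last h) h /= -[dtl (drev x)]/(dhd x) -[dhd (drev x)]/(dtl x) xu !eqxx.
Qed.

Lemma mem_drevp x (p : seq dart) : x \in drevp p -> exists2 y, y \in p & x = drev y.
Proof. by rewrite mem_rev => /mapP. Qed.

Lemma dpath_split u (p : seq dart) v r : dpath u p v -> r \in u :: heads p ->
  exists p1 p2, [/\ p = p1 ++ p2, dpath u p1 r & dpath r p2 v].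
Proof.
elim: p u => [|x p IH] u.
  by move=> /= /eqP <-; rewrite inE => /eqP->; exists [::], [::]; rewrite /= !eqxx.
move=> /= /andP[xu hp]; rewrite in_cons => /orP[/eqP->|/(IH _ hp)].
  by exists [::], (x :: p); rewrite /= eqxx xu.
by move=> [p1 [p2 [-> h1 h2]]]; exists (x :: p1), p2; rewrite /= xu h1 h2.
Qed.

Lemma dpath_last_hit (S : pred nat) u (p : seq dart) v : dpath u p v -> S u ->
  exists p1 p2 r, [/\ p = p1 ++ p2, dpath u p1 r, dpath r p2 v, S r &
    {in heads p2, forall h, ~~ S h}].
Proof.
elim/last_ind: p v => [|p x IH] v.
  by move=> /= /eqP<- Su; exists [::], [::], u; rewrite /= !eqxx.
rewrite -cats1 dpath_cat => /andP[hp /= /andP[/eqP xl /eqP xv]] Su.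
case Sv: (S v).
  exists (p ++ [:: x]), [::], v; split; rewrite ?cats0 //=.
  by rewrite dpath_cat hp /= xl xv !eqxx.
have [p1 [p2 [r [e h1 h2 h3 h4]]]] := IH _ hp Su.
exists p1, (p2 ++ [:: x]), r; split; rewrite ?e ?catA //.
  by rewrite dpath_cat (dpath_last h2) h2 /= -xl xv !eqxx.
move=> h; rewrite /heads map_cat mem_cat inE => /orP[/h4//|/eqP->].
by rewrite xv Sv.
Qed.

(** A version of [dpath_last_hit] for an end that may itself lie in [S]: the last hit is sought
    before the final dart. *)
Lemma dpath_inner_hit (S : pred nat) u (p : seq dart) v : dpath u p v -> S u -> p != [::] ->
  exists p1 p2 r, [/\ p = p1 ++ p2, dpath u p1 r, dpath r p2 v, S r &
    p2 != [::] /\ {in heads p2, forall h, S h -> h = v}].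
Proof.
case/lastP: p => // p x; rewrite -cats1 dpath_cat => /andP[hp hx] Su _.
have [p1 [p2 [r [e h1 h2 h3 h4]]]] := dpath_last_hit hp Su.
exists p1, (p2 ++ [:: x]), r; split; rewrite ?e ?catA //.
  by rewrite dpath_cat (dpath_last h2) h2.
split; first by case: (p2).
move=> h; rewrite /heads map_cat mem_cat inE => /orP[/h4/negbTE->//|/eqP->] _.
by move: hx => /= /andP[_ /eqP].
Qed.

Section Wf.
Variables (n : nat) (ds : seq dart).
Hypotheses (wf : wfd n ds).

Lemma did_ends x y : x \in ds -> y \in ds -> did x = did y ->
  (dtl y = dtl x /\ dhd y = dhd x) \/ (dtl y = dhd x /\ dhd y = dtl x).
Proof. by move=> xd yd e; case: (proj2 wf x y xd yd e) => ->; [left|right]. Qed.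

Lemma uniq_dids u (p : seq dart) v : {subset p <= ds} -> dpath u p v -> uniq (u :: heads p) ->
  uniq (dids p).
Proof.
elim: p u => //= x p IH u hs /andP[/eqP xu hp] /andP[hu /andP[hx hh]].
have xds : x \in ds by apply: hs; exact: mem_head.
have pds : {subset p <= ds} by move=> y yp; apply: hs; rewrite in_cons yp orbT.
rewrite (IH _ pds hp) /= ?hx // andbT; apply/negP => /mapP[y yp e].
case: (did_ends xds (pds y yp) e) => -[e1 e2].
  by have := dhd_in yp; rewrite e2 (negbTE hx).
by have := dhd_in yp; rewrite e2 xu => h; rewrite in_cons h orbT in hu.
Qed.

(** Both ends of an edge of [A] are visited by [A], so an edge with an unvisited head is not among
    them. *)
Lemma dids_disjoint_off u A B v : {subset A <= ds} -> {subset B <= ds} -> dpath u A v ->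
  {in heads B, forall h, h \notin u :: heads A} -> {in A & B, forall x y, did x <> did y}.
Proof.
move=> Ads Bds hA hB x y xA yB e.
have := hB _ (dhd_in yB); rewrite negb_or.
have hx : dhd x \in u :: heads A by rewrite in_cons dhd_in ?orbT.
have tx := dpath_dtl hA xA.
by case: (did_ends (Ads x xA) (Bds y yB) e) => -[_ ->]; rewrite -negb_or -in_cons ?hx ?tx.
Qed.

Hypothesis dsrev : {in ds, forall x, drev x \in ds}.

(* [b1] and [b2] are where two paths coming from [v] first meet [A1]. *)
Lemma edge_disjoint_reroute s u v A1 X Y Z A2 b1 b2 B1 B2 :
  A1 = X ++ Y ++ Z -> uniq (dids A1) -> dpath s X b1 -> dpath b1 Y b2 -> dpath b2 Z u ->
  dpath s A2 u -> dpath b1 B1 v -> dpath b2 B2 v ->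
  {in A1 & A2, forall x y, did x <> did y} -> {in B1 & B2, forall x y, did x <> did y} ->
  {in A1 ++ A2 & B1 ++ B2, forall x y, did x <> did y} ->
  edge_disjoint_dpaths s v (X ++ B1) (A2 ++ drevp Z ++ B2).
Proof.
move=> E hu hX hY hZ hA2 hB1 hB2 dA dB dAB; split.
- by rewrite dpath_cat (dpath_last hX) hX.
- by rewrite !dpath_cat (dpath_last hA2) hA2 (dpath_last (dpath_drevp hZ)) hB2 dpath_drevp.
move=> x y; rewrite !mem_cat => /orP[xX|xB] /or3P[yA|/mem_drevp[z zZ ->]|yB].
- by apply: dA; rewrite ?E ?mem_cat ?xX.
- move=> e; move: hu; rewrite E /dids !map_cat cat_uniq => /and3P[_ /hasPn h _].
  have /h/negP : did z \in map did Y ++ map did Z by rewrite mem_cat (map_f did zZ) orbT.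
  by apply; rewrite /= -[did z]/(did (drev z)) -e map_f.
- by apply: dAB; rewrite ?mem_cat ?E ?mem_cat ?xX ?yB ?orbT.
- by move=> e; apply: (dAB y x); rewrite ?mem_cat ?yA ?xB ?orbT.
- move=> e; apply: (dAB z x); rewrite ?mem_cat ?E ?mem_cat ?zZ ?xB ?orbT //.
- exact: dB.
Qed.

(** Each [B] path is used only from its last visit to the loop-erased [A] paths on, and so shares no
    edge with them. If the two last visits lie on different [A] paths, each of these is left there.
    If both lie on the same one, it is left at the earlier visit, while the other [A] path runs to
    [u] and then back along the first to the later visit. *)
Lemma edge_disjoint_trans s u v A1 A2 B1 B2 :
  {subset A1 ++ A2 ++ B1 ++ B2 <= ds} ->
  edge_disjoint_dpaths s u A1 A2 -> edge_disjoint_dpaths u v B1 B2 ->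
  exists C1 C2, [/\ edge_disjoint_dpaths s v C1 C2, {subset C1 ++ C2 <= ds} &
    {subset dids (C1 ++ C2) <= dids (A1 ++ A2 ++ B1 ++ B2)}].
Proof.
move=> sub [hA1 hA2 dA] [hB1 hB2 dB].
have [kA1 uA1 sA1] := eraseP hA1; have [kA2 uA2 sA2] := eraseP hA2.
set A1' := erase s A1 in kA1 uA1 sA1; set A2' := erase s A2 in kA2 uA2 sA2.
have {}dA : {in A1' & A2', forall x y, did x <> did y}.
  by move=> x y /sA1 xA /sA2 yA; exact: dA.
have subA1 : {subset A1' <= ds} by move=> x /sA1 xA; apply: sub; rewrite mem_cat xA.
have subA2 : {subset A2' <= ds}.
  by move=> x /sA2 xA; apply: sub; rewrite !mem_cat xA orbT.
pose S h := (h \in s :: heads A1') || (h \in s :: heads A2').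
have Su : S u.
  apply/orP; left.
  by rewrite -(dpath_last kA1) mem_last.
have [P1 [B1' [b1 [e1 _ k1 S1 o1]]]] := dpath_last_hit hB1 Su.
have [P2 [B2' [b2 [e2 _ k2 S2 o2]]]] := dpath_last_hit hB2 Su.
have subB1 : {subset B1' <= ds}.
  by move=> x xB; apply: sub; rewrite e1 !mem_cat xB !orbT.
have subB2 : {subset B2' <= ds}.
  by move=> x xB; apply: sub; rewrite e2 !mem_cat xB !orbT.
have {}dB : {in B1' & B2', forall x y, did x <> did y}.
  by move=> x y xB yB; apply: dB; rewrite ?e1 ?e2 mem_cat ?xB ?yB orbT.
have off : {in heads (B1' ++ B2'), forall h, h \notin s :: heads A1' /\ h \notin s :: heads A2'}.
  move=> h; rewrite /heads map_cat mem_cat => hh.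
  have : ~~ S h by case/orP: hh => [/o1|/o2].
  by rewrite negb_or => /andP[].
have subB : {subset B1' ++ B2' <= ds} by move=> x; rewrite mem_cat => /orP[/subB1|/subB2].
have dAB : {in A1' ++ A2' & B1' ++ B2', forall x y, did x <> did y}.
  move=> x y; rewrite mem_cat => /orP[xA|xA] yB.
    by apply: (dids_disjoint_off subA1 subB kA1 _ xA yB) => h /off[].
  by apply: (dids_disjoint_off subA2 subB kA2 _ xA yB) => h /off[].
have fin C1 C2 : edge_disjoint_dpaths s v C1 C2 ->
    {subset C1 ++ C2 <= (A1' ++ A2' ++ B1' ++ B2') ++ drevp (A1' ++ A2')} ->
    exists C1 C2, [/\ edge_disjoint_dpaths s v C1 C2, {subset C1 ++ C2 <= ds} &
    {subset dids (C1 ++ C2) <= dids (A1 ++ A2 ++ B1 ++ B2)}].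
  move=> hC sC; exists C1, C2.
  have base x : x \in A1' ++ A2' ++ B1' ++ B2' -> x \in A1 ++ A2 ++ B1 ++ B2.
    rewrite !mem_cat e1 e2 !mem_cat => /or4P[/sA1->|/sA2->|->|->]; rewrite ?orbT //.
  have base' x : x \in A1' ++ A2' -> x \in A1' ++ A2' ++ B1' ++ B2'.
    by rewrite !mem_cat orbA => ->.
  split=> //.
    move=> x /sC; rewrite mem_cat => /orP[/base/sub//|/mem_drevp[y yA ->]].
    by apply: dsrev; apply: sub; apply: base; exact: base'.
  move=> _ /mapP[x /sC xC ->]; move: xC; rewrite mem_cat => /orP[/base xA|].
    exact: map_f.
  by case/mem_drevp=> y /base'/base yA ->; rewrite -[did _]/(did y) map_f.
pose dd (X Y : seq dart) := {in X & Y, forall x y, did x <> did y}.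
have ddC X Y : dd X Y -> dd Y X by move=> h x y xX yY e; apply: (h y x).
have ddS X Y X' Y' : {subset X' <= X} -> {subset Y' <= Y} -> dd X Y -> dd X' Y'.
  by move=> hX hY h x y /hX xX /hY yY; exact: h.
have swap (X Y : seq dart) : {subset X ++ Y <= Y ++ X}.
  by move=> x; rewrite !mem_cat orbC.
have same A A' B B' b b' : dpath s A u -> uniq (dids A) -> dpath s A' u ->
    b \in s :: heads A -> b' \in s :: heads A -> dpath b B v -> dpath b' B' v ->
    dd A A' -> dd B B' -> dd (A ++ A') (B ++ B') ->
    {subset A ++ A' <= A1' ++ A2'} -> {subset B ++ B' <= B1' ++ B2'} ->
    exists C1 C2, [/\ edge_disjoint_dpaths s v C1 C2, {subset C1 ++ C2 <= ds} &
    {subset dids (C1 ++ C2) <= dids (A1 ++ A2 ++ B1 ++ B2)}].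
  move=> hA hu hA' + + hB hB' dAA' dBB' dAABB sA sB.
  (* By symmetry, [b] comes before [b'] on [A]. *)
  wlog: b b' B B' hB hB' dBB' dAABB sB / exists X Y Z,
      [/\ A = X ++ Y ++ Z, dpath s X b, dpath b Y b' & dpath b' Z u].
    move=> hw hb hb'; have [X [Y [e hX hY]]] := dpath_split hA hb.
    have [h|h] : b' \in (s :: heads X) \/ b' \in b :: heads Y.
      move: hb'; rewrite e /heads map_cat -cat_cons mem_cat => /orP[h|h]; first by left.
      by right; rewrite in_cons h orbT.
    - have [X1 [X2 [eX k1' k2']]] := dpath_split hX h.
      apply: (hw b' b B' B) => //; first exact: ddC.
      + exact: ddS (fun _ => id) (swap _ _) dAABB.
      + by move=> x /swap /sB.
      + by exists X1, X2, Y; rewrite e eX catA; split.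
    have [Y1 [Y2 [eY k1' k2']]] := dpath_split hY h.
    by apply: (hw b b' B B') => //; exists X, Y1, Y2; rewrite e eY; split.
  case=> X [Y [Z [e hX hY hZ]]] _ _.
  apply: (fin _ _ (edge_disjoint_reroute e hu hX hY hZ hA' hB hB' dAA' dBB' dAABB)).
  have inA x : x \in A ++ A' -> x \in (A1' ++ A2' ++ B1' ++ B2') ++ drevp (A1' ++ A2').
    by move=> /sA; rewrite catA !mem_cat => ->.
  have inB x : x \in B ++ B' -> x \in (A1' ++ A2' ++ B1' ++ B2') ++ drevp (A1' ++ A2').
    by move=> /sB h; rewrite catA mem_cat [in X in X || _]mem_cat h orbT.
  move=> x; rewrite !(mem_cat x) -orbA => /or4P[xX|xB|xA'|].
  - by rewrite -!mem_cat inA // e !mem_cat xX.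
  - by rewrite -!mem_cat inB // mem_cat xB.
  - by rewrite -!mem_cat inA // mem_cat xA' orbT.
  case/orP=> [/mem_drevp[y yZ ->]|xB']; last by rewrite -!mem_cat inB // mem_cat xB' orbT.
  apply/orP; right; rewrite mem_rev map_f //; apply: sA.
  by rewrite e !mem_cat yZ !orbT.
have cross A A' B B' b b' : dpath s A u -> dpath s A' u ->
    b \in s :: heads A -> b' \in s :: heads A' -> dpath b B v -> dpath b' B' v ->
    dd A A' -> dd B B' -> dd (A ++ A') (B ++ B') ->
    {subset A ++ A' <= A1' ++ A2'} -> {subset B ++ B' <= B1' ++ B2'} ->
    exists C1 C2, [/\ edge_disjoint_dpaths s v C1 C2, {subset C1 ++ C2 <= ds} &
    {subset dids (C1 ++ C2) <= dids (A1 ++ A2 ++ B1 ++ B2)}].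
  move=> hA hA' hb hb' hB hB' dAA' dBB' dAABB sA sB.
  have [X [Y [e hX _]]] := dpath_split hA hb; have [Z [T [e' hZ _]]] := dpath_split hA' hb'.
  have sX : {subset X <= A} by move=> x xX; rewrite e mem_cat xX.
  have sZ : {subset Z <= A'} by move=> x xX; rewrite e' mem_cat xX.
  apply: (fin (X ++ B) (Z ++ B')); last first.
    have sAB x : x \in (A ++ A') ++ (B ++ B') ->
        x \in (A1' ++ A2' ++ B1' ++ B2') ++ drevp (A1' ++ A2').
      rewrite mem_cat [in X in _ -> X]mem_cat catA [in X in _ -> X]mem_cat.
      by case/orP=> [/sA->|/sB->]; rewrite ?orbT.
    move=> x xC; apply: sAB; move: xC; rewrite !mem_cat.
    by case/orP=> /orP[]; [move/sX| |move/sZ|]; move=> ->; rewrite ?orbT.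
  split; rewrite ?dpath_cat ?(dpath_last hX) ?hX ?(dpath_last hZ) ?hZ //.
  move=> x y; rewrite !mem_cat => /orP[/sX xX|xB] /orP[/sZ yZ|yB].
  - exact: dAA'.
  - by apply: dAABB; rewrite mem_cat ?xX ?yB ?orbT.
  - by move=> ee; apply: (dAABB y x); rewrite ?mem_cat ?yZ ?xB ?orbT.
  - exact: dBB'.
have uA1' := uniq_dids subA1 kA1 uA1; have uA2' := uniq_dids subA2 kA2 uA2.
have dAB21 : dd (A2' ++ A1') (B1' ++ B2') := ddS _ _ _ _ (swap _ _) (fun _ => id) dAB.
case/orP: S1 => m1; case/orP: S2 => m2.
- exact: (same A1' A2' B1' B2' b1 b2).
- exact: (cross A1' A2' B1' B2' b1 b2).
- by apply: (cross A2' A1' B1' B2' b1 b2) => //; exact: ddC.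
- by apply: (same A2' A1' B1' B2' b1 b2) => //; exact: ddC.
Qed.

End Wf.

(** * Sequences of blocks *)

Definition level : eqType := (nat * bits)%type.
Definition oarc : eqType := arc level (seq nat).

Section Outer.
Variables (direct : bool) (N s t : nat) (ds : seq dart).

(** The level of a visited node is the cost of one of the used edges there, so these are all the
    guesses needed. *)
Definition levels : seq level := [seq (dtl x, dct x) | x <- ds].

(** With [direct] set, a block must go from [s] to [t]; the search then merely tries all levels at
    the two ends, which is the algorithm for internally disjoint paths. *)
Definition outer_mid (k l : level) : seq oarc :=
  if (k.1 != l.1) && (direct ==> (k.1 == s) && (l.1 == t)) then
    if res N k.1 k.2 l.1 l.2 ds is Some r
    then [:: (Some k, (Some l, (badd r.1 l.2, r.2)))] else [::]
  else [::].

Definition outer_arcs : seq oarc :=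
  [seq (None, (Some k, (k.2, [::]))) | k <- [seq k <- levels | k.1 == s]] ++
  [seq (Some k, (None, ([::], [::]))) | k <- [seq k <- levels | k.1 == t]] ++
  flatten [seq flatten [seq outer_mid k l | l <- levels] | k <- levels].

Definition outer : option (seq nat) :=
  if sp N.+2 outer_arcs is Some p then Some (flatten [seq alab a | a <- p]) else None.

Lemma outer_arc_None a : a \in outer_arcs -> asrc a = None -> exists k,
  [/\ k \in levels, k.1 = s & a = (None, (Some k, (k.2, [::])))].
Proof.
rewrite !mem_cat => /or3P[/mapP[k]|/mapP[k]|/flatten_mapP[k _ /flatten_mapP[l _]]].
- by rewrite mem_filter => /andP[/eqP h1 h2] -> _; exists k.
- by move=> _ ->.
- by rewrite /outer_mid; case: ifP => // _; case: res => // r; rewrite inE => /eqP->.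
Qed.

Lemma outer_arc_Some a k : a \in outer_arcs -> asrc a = Some k ->
  (k.1 = t /\ a = (Some k, (None, ([::], [::])))) \/
  exists l c es, [/\ l \in levels, k.1 <> l.1, direct ==> (k.1 == s) && (l.1 == t),
    res N k.1 k.2 l.1 l.2 ds = Some (c, es) & a = (Some k, (Some l, (badd c l.2, es)))].
Proof.
rewrite !mem_cat => /or3P[/mapP[l _ ->] //|/mapP[l]|/flatten_mapP[l _ /flatten_mapP[l' ll']]].
  by rewrite mem_filter => /andP[/eqP h1 _] -> [<-]; left.
rewrite /outer_mid; case: ifP => // /andP[/eqP h1 h2]; case E: res => [[c es]|] //.
by rewrite inE => /eqP-> [<-]; right; exists l', c, es.
Qed.

Variable n : nat.
Hypotheses (wf : wfd n ds) (dsrev : {in ds, forall x, drev x \in ds}) (st : s != t).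

(* The level [k.2] of [k.1] is paid for by the arc that enters the state [k]. *)
Definition paid (L : nat -> nat) (k : level) (es : seq nat) := forall x,
  x \in ds -> did x \in es ->
  bval (dct x) <= charge k.1 (bval k.2) (dtl x) + L (dtl x) /\
  bval (dch x) <= charge k.1 (bval k.2) (dhd x) + L (dhd x).

(** Blocks may overlap, so a chain only yields edge-disjoint paths, through [edge_disjoint_trans].
    With [direct] set, the first block already reaches [t] and its paths are internally disjoint. *)
Lemma outer_walk_sound p k :
  pchain (Some k) p None -> all [in outer_arcs] p -> all (fun a => asrc a != None) p ->
  exists L : nat -> nat, [/\ \sum_(r < n) L r <= weight p,
    paid L k (flatten [seq alab a | a <- p]),
    exists A B, [/\ edge_disjoint_dpaths k.1 t A B, {subset A ++ B <= ds} &
      {subset dids (A ++ B) <= flatten [seq alab a | a <- p]}] &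
    direct -> k.1 = s ->
    exists A B, [/\ disjoint_dpaths k.1 t A B, {subset A ++ B <= ds} &
      {subset dids (A ++ B) <= flatten [seq alab a | a <- p]}]].
Proof.
elim: p k => //= a p IH k /andP[/eqP ha hp] /andP[aA pA] /andP[_ pN].
rewrite /weight big_cons -/(weight p).
case: (outer_arc_Some aA ha) => [[kt ea]|[l [c [es [lP kl hdir hres ea]]]]].
  move: hp pN; rewrite ea /=; case: p pA {IH} => [|a' p] //= pA; last first.
    by move=> /andP[/eqP->].
  move=> _ _; exists (fun=> 0); split.
  - by rewrite big1.
  - by move=> x _; rewrite in_nil.
  - by exists [::], [::]; split=> //; split=> //=; rewrite kt.
  - by move=> _ ks; move: st; rewrite -ks kt eqxx.
have [[L1 h1 h2] [A [B [hAB sAB dAB]]]] := res_sound wf (introN eqP kl) hres.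
move: hp; rewrite ea /= => hp.
have [L [i1 i2 [A' [B' [hAB' sAB' dAB']]] i4]] := IH _ hp pA pN.
rewrite /awt /alab /=.
exists (fun r => L1 r + charge l.1 (bval l.2) r + L r); split.
- by rewrite !big_split bval_add !leq_add ?sum_charge.
- move=> x xds; rewrite mem_cat => /orP[/(h2 x xds)[j1 j2]|/(i2 x xds)[j1 j2]].
    by split; [apply: leq_trans j1 _ | apply: leq_trans j2 _]; lia.
  by split; [apply: leq_trans j1 _ | apply: leq_trans j2 _]; lia.
- have e1 : edge_disjoint_dpaths k.1 l.1 A B.
    by case: hAB => [g1 g2 _ _ [_ g3]].
  have [|C1 [C2 [c1 c2 c3]]] := edge_disjoint_trans wf dsrev _ e1 hAB'.
    by move=> x; rewrite catA mem_cat => /orP[/sAB|/sAB'].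
  exists C1, C2; split=> // d /c3; rewrite catA /dids map_cat mem_cat.
  by rewrite mem_cat => /orP[/dAB->//|/dAB'->]; rewrite orbT.
- move=> hd ks; move: hdir; rewrite hd => /andP[_ /eqP lt].
  exists A, B; split=> //; first by rewrite -lt.
  by move=> d /dAB; rewrite mem_cat => ->.
Qed.

Lemma outer_sound es p : sp N.+2 outer_arcs = Some p ->
  es = flatten [seq alab a | a <- p] ->
  (exists2 L : nat -> nat, \sum_(r < n) L r <= weight p &
     satisfied L [seq x <- ds | did x \in es]) /\
  (exists A B, [/\ edge_disjoint_dpaths s t A B, {subset A ++ B <= ds} &
      {subset dids (A ++ B) <= es}]) /\
  (direct -> exists A B, [/\ disjoint_dpaths s t A B, {subset A ++ B <= ds} &
      {subset dids (A ++ B) <= es}]).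
Proof.
move=> /sp_sound; case: p => [|a p]; first by case/and4P.
case/and4P=> _ /= /andP[aA pA] pN /andP[/eqP a0 hp] ->.
have [k [kl ks ea]] := outer_arc_None aA a0.
move: hp; rewrite ea /= => hp.
have [L [h1 h2 h3 h4]] := outer_walk_sound hp pA pN.
rewrite ks in h3 h4; rewrite /alab /=; split; last by split=> // hd; exact: h4.
exists (fun r => charge k.1 (bval k.2) r + L r).
  by rewrite big_split /weight big_cons leq_add ?sum_charge.
by move=> x; rewrite mem_filter => /andP[xes xds]; exact: h2.
Qed.

(** * Completeness of the search over blocks *)

Variable L : nat -> nat.

Definition attained (k : level) := (k \in levels) && (bval k.2 == L k.1).

Lemma mem_outer_mid k l c es : k \in levels -> l \in levels -> k.1 != l.1 ->
  (direct ==> (k.1 == s) && (l.1 == t)) -> res N k.1 k.2 l.1 l.2 ds = Some (c, es) ->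
  (Some k, (Some l, (badd c l.2, es))) \in outer_arcs.
Proof.
move=> h1 h2 h3 h4 h5; rewrite !mem_cat; apply/orP; right; apply/orP; right.
apply/flatten_mapP; exists k => //; apply/flatten_mapP; exists l => //.
by rewrite /outer_mid h3 h4 h5 mem_head.
Qed.

Lemma mem_outer_init k : k \in levels -> k.1 = s ->
  (None, (Some k, (k.2, [::]))) \in outer_arcs.
Proof.
move=> h1 h2; rewrite mem_cat; apply/orP; left; apply/mapP; exists k => //.
by rewrite mem_filter h2 eqxx.
Qed.

Lemma mem_outer_fin k : k \in levels -> k.1 = t ->
  (Some k, (None, ([::], [::]))) \in outer_arcs.
Proof.
move=> h1 h2; rewrite !mem_cat; apply/orP; right; apply/orP; left.
by apply/mapP; exists k => //; rewrite mem_filter h2 eqxx.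
Qed.

(** Summing by membership counts a node once even if both paths visit it, unlike a sum over the
    list. *)
Definition setsum (f : nat -> nat) (V : seq nat) := \sum_(r < n) (if val r \in V then f r else 0).

Lemma setsum_le f V V' : {subset V <= V'} -> setsum f V <= setsum f V'.
Proof.
by move=> h; apply: leq_sum => r _; case: ifP => // /h ->.
Qed.

Lemma setsum_add f V1 V2 V3 : {subset V1 <= V3} -> {subset V2 <= V3} ->
  {in V1, forall r, r \notin V2} -> setsum f V1 + setsum f V2 <= setsum f V3.
Proof.
move=> h1 h2 h3; rewrite /setsum -big_split; apply: leq_sum => r _ /=.
case hr: (val r \in V1); first by rewrite (negbTE (h3 _ hr)) addn0 h1.
by rewrite add0n; case: ifP => // /h2 ->.
Qed.

Lemma setsum1 f r : r < n -> setsum f [:: r] = f r.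
Proof.
move=> h; rewrite /setsum (bigD1 (Ordinal h)) //= inE eqxx big1 ?addn0 // => i.
by rewrite -val_eqE /= inE => /negbTE->.
Qed.

Lemma setsum_total f V : setsum f V <= \sum_(r < n) f r.
Proof. by apply: leq_sum => r _; case: ifP. Qed.

Hypothesis (nN : n <= N).

(** [res_complete] is applied with levels set to zero off the block, so that the bound concerns only
    its own nodes and the bounds of different blocks can be added. *)
Lemma res_block k l A B : {subset A ++ B <= ds} -> satisfied L (A ++ B) ->
  disjoint_dpaths k.1 l.1 A B -> attained k -> attained l -> k.1 <> l.1 -> k.1 < n -> l.1 < n ->
  exists c es, res N k.1 k.2 l.1 l.2 ds = Some (c, es) /\
    2 * bval c <= 3 * setsum L [seq r <- heads A ++ heads B | r != l.1].
Proof.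
move=> sAB LAB hAB /andP[_ /eqP ak] /andP[_ /eqP al] kl kn ln.
pose L' r := if r \in k.1 :: heads A ++ heads B then L r else 0.
have LAB' : satisfied L' (A ++ B).
  move=> x xAB; have [i1 i2] := LAB x xAB; rewrite /L'.
  have hx : dhd x \in heads A ++ heads B by rewrite -map_cat map_f.
  have tx : dtl x \in k.1 :: heads A ++ heads B.
    case: hAB => dA dB _ _ _; rewrite -cat_cons mem_cat in_cons; move: xAB.
    rewrite mem_cat => /orP[/(dpath_dtl dA)|/(dpath_dtl dB)]; rewrite in_cons.
      by move=> ->.
    by case/orP=> ->; rewrite ?orbT.
  by rewrite tx in_cons hx orbT.
have hle r : L' r <= L r by rewrite /L'; case: ifP.
have [||c [es [E hc]]] := @res_complete n k.1 l.1 k.2 l.2 ds N wf (introN eqP kl)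
  L' A B sAB LAB' hAB _ _ kn ln nN.
- by rewrite ak.
- by rewrite al.
exists c, es; split=> //; apply: leq_trans hc _; rewrite leq_mul2l /=.
rewrite big_mkcond; apply: leq_sum => r _; rewrite mem_filter /L' in_cons.
case: (val r =P k.1) => //= _; case: (val r =P l.1) => //= _; by case: ifP.
Qed.

(** Induction on the number of edges, taking off the last block. With [r] the last vertex of [A]
    before [u] that lies on [B], either the parts of the two paths after [r] form a block that
    avoids everything before it, or the paths can be replaced by shorter ones. *)
Lemma outer_complete_walk A B u k : ~~ direct ->
  {subset A ++ B <= ds} -> satisfied L (A ++ B) ->
  (forall r, r \in s :: heads A ++ heads B -> exists2 l, attained l & l.1 = r) ->
  edge_disjoint_dpaths s u A B -> uniq (s :: heads A) -> uniq (s :: heads B) ->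
  attained k -> k.1 = u -> s < n ->
  exists p, [/\ pchain None p (Some k), all [in outer_arcs] p,
    2 * weight p <= 3 * setsum L (s :: heads A ++ heads B) &
    size p <= setsum (fun=> 1) (s :: heads A ++ heads B)].
Proof.
move=> hdir; have [m] := ubnP (size A + size B).
elim: m A B u k => // m IH A B u k /ltnSE hm sAB LAB hatt [dA dB dAB] uA uB kat ku sn.
have Ads : {subset A <= ds} by move=> x xA; apply: sAB; rewrite mem_cat xA.
have Bds : {subset B <= ds} by move=> x xA; apply: sAB; rewrite mem_cat xA orbT.
have /andP[klev /eqP kL] := kat.
case: (eqVneq u s) => us.
  exists [:: (None, (Some k, (k.2, [::])))]; split.
  - by rewrite /= !eqxx.
  - by rewrite /= mem_outer_init // ku.
  - rewrite /weight big_seq1 /awt /= kL ku us.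
    rewrite -[X in 2 * X](setsum1 L sn); apply: leq_mul => //; apply: setsum_le => r.
    by rewrite !inE => ->.
  - apply: (@leq_trans (setsum (fun=> 1) [:: s])); first by rewrite setsum1.
    apply: setsum_le => r.
    by rewrite !inE => ->.
have A0 : A != [::] by case: (A) dA us => //= /eqP ->; rewrite eqxx.
have [X1 [Y1 [r [eA hX1 hY1 rB [Y10 oY1]]]]] :=
  dpath_inner_hit (S := [in s :: heads B]) dA (mem_head _ _) A0.
have [X2 [Y2 [eB hX2 hY2]]] := dpath_split dB rB.
have hA : heads A = heads X1 ++ heads Y1 by rewrite eA /heads map_cat.
have hB : heads B = heads X2 ++ heads Y2 by rewrite eB /heads map_cat.
have uin (p : seq dart) v v' : p != [::] -> dpath v p v' -> v' \in heads p.
  case: p => // x p _ /= /andP[_ /dpath_last <-]; exact: mem_last.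
have uY1 := uin _ _ _ Y10 hY1.
have rX1 : r \in s :: heads X1 by rewrite -(dpath_last hX1) mem_last.
have uA' := uA; rewrite hA -cat_cons cat_uniq in uA'.
case/and3P: uA' => uX1 /hasPn nA uY1'.
have uB' := uB; rewrite hB -cat_cons cat_uniq in uB'.
case/and3P: uB' => uX2 /hasPn nB uY2'.
have ru : r != u by apply: contraTneq uY1 => <-; apply/negP => /nA /negP; apply.
have Y20 : Y2 != [::] by case: (Y2) hY2 ru => //= /eqP ->; rewrite eqxx.
have uY2 := uin _ _ _ Y20 hY2.
(* Suppose [B] returns after [r] to a vertex [z] that [A] visits before [r]. Follow [A] to [z] and
   then [B], and follow [B] to [r] and then [A]: the piece of [A] from [z] to [r] and that of [B]
   from [r] to [z] are saved. *)
case hrev: (has [in s :: heads X1] (heads Y2)).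
  case/hasP: hrev => z zY2 zX1.
  have [X1a [X1b [eX1 h1a h1b]]] := dpath_split hX1 zX1.
  have zr : z != r.
    apply: contraTneq zY2 => ->; apply/negP => /nB /negP; apply.
    by rewrite -(dpath_last hX2) mem_last.
  have [Y2a [Y2b [eY2 h2a h2b]]] : exists p1 p2,
      [/\ Y2 = p1 ++ p2, dpath r p1 z & dpath z p2 u].
    by apply: dpath_split hY2 _; rewrite in_cons zY2 orbT.
  have X1b0 : 0 < size X1b.
    by case: (X1b) h1b zr => //= /eqP ->; rewrite eqxx.
  have dA' : dpath s (X1a ++ Y2b) u by rewrite dpath_cat (dpath_last h1a) h1a.
  have dB' : dpath s (X2 ++ Y1) u by rewrite dpath_cat (dpath_last hX2) hX2.
  have [eA1 eA2 eA3] := eraseP dA'; have [eB1 eB2 eB3] := eraseP dB'.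
  have subA : {subset erase s (X1a ++ Y2b) <= A ++ B}.
    by move=> x /eA3; rewrite eA eB eX1 eY2 !mem_cat => /orP[->|->]; rewrite ?orbT.
  have subB : {subset erase s (X2 ++ Y1) <= A ++ B}.
    by move=> x /eB3; rewrite eA eB !mem_cat => /orP[->|->]; rewrite ?orbT.
  have subAB : {subset erase s (X1a ++ Y2b) ++ erase s (X2 ++ Y1) <= A ++ B}.
    by move=> x; rewrite mem_cat => /orP[/subA|/subB].
  have subh : {subset s :: heads (erase s (X1a ++ Y2b)) ++ heads (erase s (X2 ++ Y1))
      <= s :: heads A ++ heads B}.
    move=> v; rewrite !(in_cons s) -/(heads _) -map_cat => /orP[->//|/mapP[x /subAB xAB ->]].
    by rewrite -map_cat map_f ?orbT.
  have szer (p : seq dart) v : dpath s p v -> size (erase s p) <= size p.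
    move=> hp; have [q1 q2 q3] := eraseP hp.
    rewrite -(size_map dhd) -(size_map dhd p); apply: uniq_leq_size.
      by case/andP: q2.
    by move=> v' /mapP[x /q3 xp ->]; exact: map_f.
  have [||||||||||p [p1 p2 p3 p4]] := IH (erase s (X1a ++ Y2b)) (erase s (X2 ++ Y1)) u k.
  - apply: leq_trans hm; apply: leq_ltn_trans (leq_add (szer _ _ dA') (szer _ _ dB')) _.
    move: X1b0; rewrite eA eB eX1 eY2 !size_cat.
    by move: (size X1a) (size X1b) (size Y1) (size X2) (size Y2a) (size Y2b); clear; lia.
  - by move=> x /subAB /sAB.
  - exact: satisfied_sub LAB.
  - by move=> v /subh /hatt.
  - split=> // x y /eA3 xA /eB3 yB e; move: xA yB; rewrite !mem_cat.
    case/orP=> xX /orP[yX|yX].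
    + by apply: (dAB x y); rewrite ?eA ?eB ?eX1 ?mem_cat ?xX ?yX ?orbT.
    + have hu := uniq_dids wf Ads dA uA.
      move: hu; rewrite eA /dids map_cat cat_uniq => /and3P[_ /hasPn hh _].
      have /hh/negP : did y \in map did Y1 by exact: map_f.
      by apply; rewrite /= -e map_f // eX1 mem_cat xX.
    + have hu := uniq_dids wf Bds dB uB.
      move: hu; rewrite eB /dids map_cat cat_uniq => /and3P[_ /hasPn hh _].
      have /hh/negP : did x \in map did Y2 by rewrite map_f // eY2 mem_cat xX orbT.
      by apply; rewrite /= e map_f.
    + by apply: (dAB y x); rewrite ?eA ?eB ?eY2 ?mem_cat ?xX ?yX ?orbT.
  - exact: eA2.
  - exact: eB2.
  - exact: kat.
  - exact: ku.
  - exact: sn.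
  exists p; split=> //.
    by apply: leq_trans p3 _; rewrite leq_mul2l /=; exact: setsum_le.
  by apply: leq_trans p4 _; exact: setsum_le.
have [l lat lr] : exists2 l, attained l & l.1 = r.
  apply: hatt; move: rX1; rewrite hA !in_cons !mem_cat.
  by case/orP=> ->; rewrite ?orbT.
have [||||||||||p [p1 p2 p3 p4]] := IH X1 X2 r l.
- apply: leq_trans hm; rewrite eA eB !size_cat.
  by move: Y10; rewrite -size_eq0; move: (size X1) (size Y1) (size X2) (size Y2); clear; lia.
- move=> x; rewrite mem_cat => /orP[xX|xX]; [apply: Ads; rewrite eA | apply: Bds; rewrite eB];
    by rewrite mem_cat xX.
- apply: satisfied_sub LAB => x; rewrite eA eB !mem_cat.
  by case/orP=> ->; rewrite ?orbT.
- move=> v hv; apply: hatt; move: hv; rewrite hA hB !in_cons !mem_cat.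
  by case/or3P=> ->; rewrite ?orbT.
- split=> // x y xX yX; apply: dAB; rewrite ?eA ?eB mem_cat ?xX ?yX //.
- exact: uX1.
- exact: uX2.
- exact: lat.
- exact: lr.
- exact: sn.
have rn : r < n.
  move: rX1; rewrite in_cons => /orP[/eqP->//|/mapP[x xX ->]].
  by case: (proj1 wf x) => //; apply: Ads; rewrite eA mem_cat xX.
have un : u < n.
  by move: uY1 => /mapP[x xY ->]; case: (proj1 wf x) => //; apply: Ads; rewrite eA mem_cat xY orbT.
have sY : {subset Y1 ++ Y2 <= A ++ B}.
  by move=> x; rewrite eA eB !mem_cat => /orP[] ->; rewrite ?orbT.
have hrX2 : r \in s :: heads X2 by rewrite -(dpath_last hX2) mem_last.
have blk : disjoint_dpaths r u Y1 Y2.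
  split=> //.
  - by rewrite /= uY1' andbT; apply/negP => /nA /negP; apply.
  - by rewrite /= uY2' andbT; apply/negP => /nB /negP; apply.
  split; last by move=> x y xY yY; apply: dAB; rewrite ?eA ?eB mem_cat ?xY ?yY orbT.
  move=> v v1 v2; apply: oY1 => //.
  by rewrite /= in_cons hB mem_cat v2 !orbT.
have [||||||||c [es [E hc]]] := @res_block l k Y1 Y2.
- by move=> x /sY /sAB.
- exact: satisfied_sub LAB.
- by rewrite lr ku.
- exact: lat.
- exact: kat.
- by rewrite lr ku; exact/eqP.
- by rewrite lr.
- by rewrite ku.
(* The nodes entered by the last block are new, so the bounds for the two parts add up. A vertex on
   both [X2] and [Y1] would be [u] by the choice of [r], but [B] visits [u] only at its end. *)
have sep v : v \in s :: heads X1 ++ heads X2 -> v \notin heads Y1 ++ heads Y2.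
  rewrite -cat_cons mem_cat mem_cat negb_or => /orP[v1|v2]; apply/andP; split.
  - by apply/negP => /nA /negP; apply.
  - by apply: contraFN hrev => vY; apply/hasP; exists v.
  - apply/negP => vY.
    have vu : v = u.
      by apply: oY1 => //; rewrite /= in_cons hB mem_cat v2 orbT.
    by move: (nB _ uY2); rewrite -vu /= in_cons v2 orbT.
  - by apply/negP => /nB /negP; apply; rewrite /= in_cons v2 orbT.
have sub1 : {subset s :: heads X1 ++ heads X2 <= s :: heads A ++ heads B}.
  move=> v; rewrite hA hB !in_cons !mem_cat.
  by case/or3P=> ->; rewrite ?orbT.
have sub2 : {subset heads Y1 ++ heads Y2 <= s :: heads A ++ heads B}.
  move=> v; rewrite hA hB !in_cons !mem_cat.
  by case/orP=> ->; rewrite ?orbT.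
have uY : u \in heads Y1 ++ heads Y2 by rewrite mem_cat uY1.
have split_u f : setsum f [seq r <- heads Y1 ++ heads Y2 | r != u] + f u
    <= setsum f (heads Y1 ++ heads Y2).
  rewrite -(setsum1 f un); apply: setsum_add.
  - by move=> v; rewrite mem_filter => /andP[].
  - by move=> v; rewrite inE => /eqP->.
  - by move=> v; rewrite mem_filter inE => /andP[].
have total f := setsum_add f sub1 sub2 sep.
exists (rcons p (Some l, (Some k, (badd c k.2, es)))); split.
- by rewrite pchain_rcons p1 /atgt /= eqxx.
- rewrite all_rcons p2 andbT; apply: mem_outer_mid => //.
  + by case/andP: lat.
  + by rewrite lr ku.
  + by rewrite (negbTE hdir).
(* The level of [u] is paid exactly once, hence within the factor 3/2 allowed for it. *)
- rewrite weight_rcons /awt /= bval_add kL ku.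
  move: p3 hc (split_u L) (total L); rewrite ku.
  move: (weight p) (bval c) (L u) (setsum _ _) (setsum _ _) (setsum _ _) (setsum _ _).
  by clear; lia.
- rewrite size_rcons; move: p4 (split_u (fun=> 1)) (total (fun=> 1)).
  move: (size p) (setsum _ _) (setsum _ _) (setsum _ _) (setsum _ _).
  by clear; lia.
Qed.

Lemma outer_complete_edge A B k : ~~ direct ->
  {subset A ++ B <= ds} -> satisfied L (A ++ B) ->
  (forall r, r \in s :: heads A ++ heads B -> exists2 l, attained l & l.1 = r) ->
  edge_disjoint_dpaths s t A B -> uniq (s :: heads A) -> uniq (s :: heads B) ->
  attained k -> k.1 = t -> s < n ->
  exists p, sp N.+2 outer_arcs = Some p /\ 2 * weight p <= 3 * \sum_(r < n) L r.
Proof.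
move=> h1 h2 h3 h4 h5 h6 h7 h8 h9 h10.
have [p [p1 p2 p3 p4]] := outer_complete_walk h1 h2 h3 h4 h5 h6 h7 h8 h9 h10.
have [||||q Eq hq] := @sp_complete _ _ N.+2 outer_arcs
  (rcons p (Some k, (None, ([::], [::])))).
- by case: (p).
- by rewrite all_rcons p2 mem_outer_fin //; case/andP: h8.
- by rewrite pchain_rcons p1.
- rewrite size_rcons; apply: leq_ltn_trans p4 _; apply: leq_ltn_trans (setsum_total _ _) _.
  by rewrite sum_nat_const card_ord muln1 ltnS leqW.
exists q; split=> //; move: hq; rewrite weight_rcons addn0 => hq.
apply: leq_trans (leq_trans p3 _); first by rewrite leq_mul2l.
by rewrite leq_mul2l /= setsum_total.
Qed.

Lemma outer_complete_direct A B k l :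
  {subset A ++ B <= ds} -> satisfied L (A ++ B) -> disjoint_dpaths s t A B ->
  attained k -> k.1 = s -> attained l -> l.1 = t -> s < n -> t < n ->
  exists p, sp N.+2 outer_arcs = Some p /\ 2 * weight p <= 3 * \sum_(r < n) L r.
Proof.
move=> sAB LAB hAB kat ks lat lt sn tn.
have [||||||c [es [E hc]]] := @res_block k l A B sAB LAB; rewrite ?ks ?lt //.
  exact/eqP.
have /andP[klev /eqP kL] := kat; have /andP[llev /eqP lL] := lat.
have [||||q Eq hq] := @sp_complete _ _ N.+2 outer_arcs
  [:: (None, (Some k, (k.2, [::]))); (Some k, (Some l, (badd c l.2, es)));
      (Some l, (None, ([::], [::])))] => //.
- rewrite /= mem_outer_init // mem_outer_fin // mem_outer_mid //= ?ks ?lt //.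
  by rewrite !eqxx implybT.
- by rewrite /= !eqxx.
- case: N nN => [|N']; last by [].
  by rewrite leqn0 => /eqP n0; rewrite n0 in sn.
exists q; split=> //; move: hq hc; rewrite /weight !big_cons big_nil /awt /= bval_add kL ks lL lt.
have h1 : setsum L [seq r <- heads A ++ heads B | r != t] + L t
    <= setsum L (heads A ++ heads B).
  rewrite -(setsum1 L tn); apply: setsum_add.
  - by move=> v; rewrite mem_filter => /andP[].
  - move=> v; rewrite inE => /eqP->; case: hAB => dA _ _ _ _.
    rewrite mem_cat; apply/orP; left; rewrite -(dpath_last dA).
    case: (A) dA => [/= /eqP e|x A' _]; last exact: mem_last.
    by move: st; rewrite e eqxx.
  - by move=> v; rewrite mem_filter inE => /andP[].
have h2 : setsum L [:: s] + setsum L (heads A ++ heads B) <=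
    setsum L (s :: heads A ++ heads B).
  apply: setsum_add.
  - by move=> v; rewrite !inE => ->.
  - by move=> v vAB; rewrite in_cons vAB orbT.
  - move=> v; rewrite inE => /eqP->; rewrite mem_cat negb_or.
    by case: hAB => _ _ /= /andP[-> _] /andP[-> _] _.
have h3 := setsum_total L (s :: heads A ++ heads B).
rewrite (setsum1 L sn) in h2.
move=> hq hc; move: hq hc h1 h2 h3.
move: (\sum_(a <- q) _) (bval c) (L s) (L t) (setsum _ _) (setsum _ _) (setsum _ _).
move: (\sum_(r < n) _).
by clear; lia.
Qed.

End Outer.

(** * The algorithms *)

#[global] Instance Enc_level : Enc level := @Enc_prod nat bits _ _.
#[global] Instance EqPt_level : EqPt level := @EqPt_prod nat bits _ _ _ _.
#[global] Instance Enc_oarc : Enc oarc := Enc_arc (K := level) (L := seq nat).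

Lemma pt_outer A {eA : Enc A} (direct : bool) (N s t : A -> nat) (ds : A -> seq dart) :
  ptime N -> ptime s -> ptime t -> ptime ds ->
  ptime (fun a => outer direct (N a) (s a) (t a) (ds a)).
Proof.
move=> hN hs ht hd.
have hl : ptime (fun a => levels (ds a)) by rewrite /levels /dtl /dct; pt.
have hm : ptime (fun a => outer_arcs direct (N a) (s a) (t a) (ds a)).
  rewrite /outer_arcs; pt.
  - by apply: (pt_comp hs); pt.
  - by apply: (pt_comp ht); pt.
  - rewrite /outer_mid; apply: pt_if.
    + pt; [by apply: (pt_comp hs); pt | by apply: (pt_comp ht); pt].
    + apply: (pt_match_opt ([::], [::])); last exact: pt_cst; last by pt.
      apply: pt_res; pt.
      * by apply: (pt_comp hN); pt.
      * by apply: (pt_comp hd); pt.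
    + exact: pt_cst.
  - by apply: (pt_comp hl); pt.
rewrite /outer; apply: (pt_match_opt [::]); last exact: pt_cst.
  by apply: (pt_sp (K := level) (L := seq nat)); pt.
by rewrite /alab; pt.
Qed.

(** Instances without dependent types, encoded by the same trees as the original ones, so that
    [ptime] applies to functions on them. *)
Definition rcost : Type := (bits * bits)%type.
Definition redge : Type := ((nat * rcost) * (nat * rcost))%type.
Definition rdp : Type := ((nat * seq redge) * (nat * nat))%type.

#[global] Instance Enc_redge : Enc redge := @Enc_prod (nat * rcost) (nat * rcost) _ _.

Definition redge0 : redge := ((0, ([::], [::])), (0, ([::], [::]))).

Definition other_dens (es : seq redge) (i : nat) : bits :=
  bprod [seq bmul (nth redge0 es j).1.2.2 (nth redge0 es j).2.2.2
        | j <- [seq j <- iota 0 (size es) | j != i]].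

(* Costs are multiplied by the product of all the denominators. *)
Definition rdart (es : seq redge) (i : nat) : dart :=
  (i, ((nth redge0 es i).1.1, ((nth redge0 es i).2.1,
    (bmul (nth redge0 es i).1.2.1 (bmul (nth redge0 es i).2.2.2 (other_dens es i)),
     bmul (nth redge0 es i).2.2.1 (bmul (nth redge0 es i).1.2.2 (other_dens es i)))))).

Definition rdarts (es : seq redge) : seq dart :=
  flatten [seq [:: rdart es i; drev (rdart es i)] | i <- iota 0 (size es)].

Definition mask (m : nat) (es : seq nat) : seq bool := [seq i \in es | i <- iota 0 m].

Lemma pt_rdarts A {eA : Enc A} (es : A -> seq redge) :
  ptime es -> ptime (fun a => rdarts (es a)).
Proof.
move=> he.
have hn : ptime (fun p : A * nat => nth redge0 (es p.1) p.2).
  by apply: pt_nth; [apply: (pt_comp he) |]; pt.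
have hn2 : ptime (fun p : A * nat * nat => nth redge0 (es p.1.1) p.2).
  by apply: pt_nth; [apply: (pt_comp he) |]; pt.
have ho : ptime (fun p : A * nat => other_dens (es p.1) p.2).
  by rewrite /other_dens; pt; apply: (pt_comp he); pt.
have hr : ptime (fun p : A * nat => rdart (es p.1) p.2).
  by rewrite /rdart; pt.
by rewrite /rdarts /drev /did /dtl /dhd /dct /dch; pt.
Qed.

Definition disjoint_alg (direct : bool) (i : rdp) : option (seq bool) :=
  if outer direct i.1.1 i.2.1 i.2.2 (rdarts i.1.2) is Some es
  then Some (mask (size i.1.2) es) else None.

Lemma pt_disjoint_alg direct : ptime (disjoint_alg direct).
Proof.
rewrite /disjoint_alg; apply: (pt_match_opt [::]); last exact: pt_cst.
  by apply: pt_outer; pt; apply: pt_rdarts; pt.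
by rewrite /mask; pt.
Qed.

(** The free edges may form more than a path, so a path is first searched for among them. The
    augmenting search may use free edges off this path; they are removed from the answer, which has
    to be disjoint from the given set. *)
Definition aug_alg (i : rdp * seq bool) : option (seq bool) :=
  if ear i.1.2.1 i.1.2.2 [:: i.1.2.1; i.1.2.2]
      [seq x <- rdarts i.1.1.2 | nth false i.2 (did x)] i.1.1.1 is Some r1 then
    if ear i.1.2.1 i.1.2.2 (i.1.2.1 :: heads (erase i.1.2.1 r1.2))
       [seq x <- rdarts i.1.1.2 | did x \notin dids (erase i.1.2.1 r1.2)] i.1.1.1 is Some r2
    then Some (mask (size i.1.1.2) [seq j <- dids r2.2 | ~~ nth false i.2 j])
    else None
  else None.

Lemma pt_aug_alg : ptime aug_alg.
Proof.
rewrite /aug_alg; apply: (pt_match_opt ([::], [::])); last exact: pt_cst.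
  by apply: pt_ear; rewrite /did; pt; apply: pt_rdarts; pt.
apply: (pt_match_opt ([::], [::])); last exact: pt_cst.
  apply: pt_ear; rewrite /dids /did /heads /dhd; pt; try by apply: pt_erase; pt.
  by apply: pt_rdarts; pt.
by rewrite /mask /dids /did; pt.
Qed.

(** * From encoded graphs to darts *)

Lemma ptime_runs (I A B : Type) {eA : Enc A} {eB : Enc B} (encI : I -> tree) (f : A -> B)
    (raw : I -> A) (accept : I -> tree -> Prop) :
  ptime f -> (forall i, enc (raw i) = encI i) ->
  (forall i, accept i (enc (f (raw i)))) ->
  exists p, runs_in_polytime encI accept p.
Proof.
move=> [p [tm [h1 h2 h3]]] hraw hacc; exists p.
(* [runs_in_polytime] asks for the same constant and exponent in both bounds, hence the sum. *)
have [c [d H]] := pbnd_add h1 h2.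
exists c, d => i; have [k hk rk] := h3 (raw i).
have := H (raw i); rewrite /sz hraw in rk * => Hi.
exists (enc (f (raw i))), k; split=> //.
  by apply: leq_trans Hi; apply: leq_trans hk (leq_addr _ _).
by apply: leq_trans Hi; exact: leq_addl.
Qed.

Definition rcost_of (q : rat) : rcost := (nat_bits `|numq q|%N, nat_bits `|denq q|%N).

Section Graph.
Variable G : agraph.
Let n := nv G.

Definition redge_of (e : 'I_(ne G)) : redge :=
  ((val (end1 e), rcost_of (cost1 e)), (val (end2 e), rcost_of (cost2 e))).

Definition redges : seq redge := [seq redge_of e | e <- enum 'I_(ne G)].

Lemma size_redges : size redges = ne G.
Proof. by rewrite size_map size_enum_ord. Qed.

Lemma nth_redges (e : 'I_(ne G)) : nth redge0 redges e = redge_of e.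
Proof. by rewrite (nth_map e) ?size_enum_ord // nth_ord_enum. Qed.

Lemma enc_redges : enc redges = enc_seq [seq enc_edge e | e <- enum 'I_(ne G)].
Proof. by rewrite /enc /Enc_seq -map_comp. Qed.

Definition gdart (e : 'I_(ne G)) : dart := rdart redges e.
Definition gdarts : seq dart := rdarts redges.

Lemma mem_gdarts x : x \in gdarts -> exists e, x = gdart e \/ x = drev (gdart e).
Proof.
case/flatten_mapP=> i; rewrite mem_iota size_redges => /= hi.
by rewrite !inE => /orP[/eqP->|/eqP->]; exists (Ordinal hi); [left|right].
Qed.

Lemma gdart_mem e : gdart e \in gdarts.
Proof.
apply/flatten_mapP; exists (val e); first by rewrite mem_iota size_redges /= ltn_ord.
exact: mem_head.
Qed.

Lemma gdarts_rev : {in gdarts, forall x, drev x \in gdarts}.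
Proof.
move=> x /flatten_mapP[i hi hx]; apply/flatten_mapP; exists i => //.
by move: hx; rewrite !inE => /orP[/eqP->|/eqP->]; rewrite eqxx ?orbT.
Qed.

Lemma dtl_gdart e : dtl (gdart e) = val (end1 e).
Proof. by rewrite /gdart /rdart /dtl /= nth_redges. Qed.

Lemma dhd_gdart e : dhd (gdart e) = val (end2 e).
Proof. by rewrite /gdart /rdart /dhd /= nth_redges. Qed.

Lemma gdarts_wf : wfd n gdarts.
Proof.
split=> [x /mem_gdarts[e he]|x y /mem_gdarts[e he] /mem_gdarts[e' he'] hxy].
  have h : [/\ dtl (gdart e) < n, dhd (gdart e) < n & dtl (gdart e) != dhd (gdart e)].
    by rewrite dtl_gdart dhd_gdart; split; rewrite ?ltn_ord //; exact: ends_neq.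
  by case: he => ->; case: h => h1 h2 h3; split=> //; rewrite eq_sym.
have ee : e = e' by apply/val_inj; move: hxy; case: he => ->; case: he' => ->.
subst e'; case: he => ->; case: he' => ->; by [left|right].
Qed.

Local Open Scope ring_scope.

Definition scale : nat := (\prod_(e < ne G) (`|denq (cost1 e)|%N * `|denq (cost2 e)|%N))%N.

Lemma scale_gt0 : (0 < scale)%N.
Proof. by rewrite prodn_gt0 // => e; rewrite muln_gt0 !absz_gt0 !denq_neq0. Qed.

Lemma bval_other_dens (e : 'I_(ne G)) : bval (other_dens redges e) =
  (\prod_(j < ne G | j != e) (`|denq (cost1 j)|%N * `|denq (cost2 j)|%N))%N.
Proof.
rewrite /other_dens bval_prod big_map big_filter size_redges.
have -> : iota 0 (ne G) = index_iota 0 (ne G) by rewrite /index_iota subn0.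
rewrite big_mkord; apply: eq_bigr => j _.
by rewrite bval_mul nth_redges /= !bval_nat_bits.
Qed.

Lemma numq_natr (q : rat) : 0 <= q -> (`|numq q|%N)%:R = q * (`|denq q|%N)%:R :> rat.
Proof.
move=> q0; rewrite !natr_absz (ger0_norm (denq_ge0 q)) ger0_norm ?numq_ge0 //.
by rewrite -{2}(divq_num_den q) mulfVK // intr_eq0 denq_neq0.
Qed.

Lemma scaleE (e : 'I_(ne G)) : scale = (`|denq (cost1 e)| * `|denq (cost2 e)| *
  bval (other_dens redges e))%N.
Proof. by rewrite bval_other_dens /scale (bigD1 e). Qed.

Lemma dct_gdart e : (bval (dct (gdart e)))%:R = scale%:R * cost1 e.
Proof.
rewrite /gdart /rdart /dct /= nth_redges /= !bval_mul !bval_nat_bits (scaleE e).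
by rewrite !natrM numq_natr ?cost1_ge0 // [RHS]mulrC -!mulrA.
Qed.

Lemma dch_gdart e : (bval (dch (gdart e)))%:R = scale%:R * cost2 e.
Proof.
rewrite /gdart /rdart /dch /= nth_redges /= !bval_mul !bval_nat_bits (scaleE e).
rewrite !natrM numq_natr ?cost2_ge0 // [RHS]mulrC -!mulrA; congr (_ * _).
by rewrite mulrCA.
Qed.

Definition edges_of (es : seq nat) : {set edge G} := [set e : edge G | val e \in es].

Lemma mask_edges es : enc (mask (size redges) es) = enc_set (edges_of es).
Proof.
rewrite /enc /Enc_seq /mask /enc_set size_redges -map_comp -val_enum_ord -map_comp.
by congr enc_seq; apply/eq_in_map => e _; rewrite /= inE.
Qed.

(** Together with [le_activation] this links rational costs to integer levels: an answer is bounded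
    by the levels that its search provides, a competing solution by its own [max_level]. *)
Lemma activation_le es (L : nat -> nat) :
  satisfied L [seq x <- gdarts | did x \in es] ->
  scale%:R * activation_cost (edges_of es) <= (\sum_(r < n) L r)%:R :> rat.
Proof.
move=> hL; rewrite /activation_cost mulr_sumr natr_sum; apply: ler_sum => v _.
have s0 : 0 < scale%:R :> rat by rewrite ltr0n scale_gt0.
rewrite mulrC -ler_pdivlMr //; apply: bigmax_le; first by rewrite divr_ge0 ?ler0n.
move=> e /andP[]; rewrite inE => ees hv.
have [|h1 h2] := hL (gdart e); first by rewrite mem_filter ees gdart_mem.
rewrite dtl_gdart in h1; rewrite dhd_gdart in h2.
rewrite ler_pdivlMr // mulrC /edge_cost; case: eqP hv => [->|ne] hv.
  by rewrite -dct_gdart ler_nat.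
by move: hv; rewrite /incident; case: eqP => //= _ /eqP->; rewrite -dch_gdart ler_nat.
Qed.

(** The scaled activation of a node as a natural number; since every edge occurs in both
    orientations, looking at tails covers all incident edges. *)
Definition max_level (es : seq nat) (r : nat) : nat :=
  (\max_(x <- [seq x <- gdarts | (did x \in es) && (dtl x == r)]) bval (dct x))%N.

Lemma max_level_ct es x : x \in gdarts -> did x \in es -> (bval (dct x) <= max_level es (dtl x))%N.
Proof.
move=> xg xes; apply: (leq_bigmax_seq (F := fun x => bval (dct x))) => //.
by rewrite mem_filter xes eqxx.
Qed.

Lemma max_level_satisfied es : satisfied (max_level es) [seq x <- gdarts | did x \in es].
Proof.
move=> x; rewrite mem_filter => /andP[xes xg]; split; first exact: max_level_ct.
by apply: (max_level_ct (es := es) (x := drev x)) => //; exact: gdarts_rev.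
Qed.

(** A maximum over a nonempty list is attained, so the levels of a competing solution are among
    those tried by the outer search. *)
Lemma max_level_attained es x : x \in gdarts -> did x \in es -> exists2 k : level,
  attained gdarts (max_level es) k & k.1 = dtl x.
Proof.
move=> xg xes; have hex (s : seq dart) : s != [::] ->
    exists2 y, y \in s & \max_(z <- s) bval (dct z) = bval (dct y).
  elim: s => // y s IH _; case: (eqVneq s [::]) => [->|/IH[z zs hz]].
    by exists y; rewrite ?mem_head // big_seq1.
  rewrite big_cons hz; case: (leqP (bval (dct y)) (bval (dct z))) => h.
    by exists z; rewrite // in_cons zs orbT.
  by exists y; rewrite ?mem_head.
have : [seq y <- gdarts | (did y \in es) && (dtl y == dtl x)] != [::].
  have : x \in [seq y <- gdarts | (did y \in es) && (dtl y == dtl x)].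
    by rewrite mem_filter xes eqxx.
  by case: filter.
case/hex=> y; rewrite mem_filter => /andP[/andP[_ /eqP yx] yg] hy.
exists (dtl y, dct y) => //; rewrite /attained /= -hy yx eqxx andbT.
by rewrite -yx; apply/mapP; exists y.
Qed.

Definition ids (F : {set edge G}) : seq nat := [seq val e | e in F].

Lemma mem_ids F (e : edge G) : (val e \in ids F) = (e \in F).
Proof.
apply/imageP/idP => [[e' he' /val_inj->]//|he]; by exists e.
Qed.

Lemma le_activation (F : {set edge G}) :
  (\sum_(r < n) max_level (ids F) r)%:R <= scale%:R * activation_cost F :> rat.
Proof.
rewrite /activation_cost mulr_sumr natr_sum; apply: ler_sum => v _.
rewrite /max_level big_seq; elim/big_ind: _ => [|a b ha hb|x].
- by rewrite mulr_ge0 ?ler0n //; exact: bigmax_ge_id.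
- by rewrite /maxn; case: ifP.
rewrite mem_filter => /andP[/andP[xF /eqP xv] /mem_gdarts[e he]].
have eF : e \in F by rewrite -mem_ids; move: xF; case: he => ->.
suff [hv ->] : incident e v /\ (bval (dct x))%:R = scale%:R * edge_cost e v.
  rewrite ler_wpM2l ?ler0n //.
  by apply: (le_bigmax_cond 0 (fun e => edge_cost e v)); rewrite eF hv.
case: he xv => ->.
  rewrite dtl_gdart => /val_inj ev; rewrite /incident /edge_cost -ev eqxx.
  by rewrite dct_gdart.
rewrite -[dtl _]/(dhd (gdart e)) dhd_gdart => /val_inj ev.
rewrite /incident /edge_cost -ev eqxx orbT eq_sym (negbTE (ends_neq e)).
by rewrite -[dct _]/(dch (gdart e)) dch_gdart.
Qed.

(** A sum of nonnegative terms vanishes only if every term does, so [E] activates no node. *)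
Lemma activation_union_zero (E F : {set edge G}) :
  activation_cost E = 0 -> activation_cost (E :|: F) <= activation_cost F.
Proof.
move=> hE; apply: ler_sum => v _.
have hv : node_activation E v = 0.
  have /psumr_eq0P := hE; apply=> // r _; exact: bigmax_ge_id.
apply: bigmax_le => [|e /andP[]]; first exact: bigmax_ge_id.
rewrite inE => /orP[eE|eF] ev.
  apply: (@le_trans _ _ (node_activation E v)).
    by apply: (le_bigmax_cond 0 (fun e => edge_cost e v)); rewrite eE ev.
  by rewrite hv; exact: bigmax_ge_id.
by apply: (le_bigmax_cond 0 (fun e => edge_cost e v)); rewrite eF ev.
Qed.

(** * Walks in the graph and sequences of darts *)

Lemma walk_dpath F u (p : walk G) v : is_walk F u p v -> exists q : seq dart,
  [/\ {subset q <= gdarts}, dpath (val u) q (val v), heads q = map val (unzip2 p)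
    & dids q = map val (unzip1 p) /\ {in dids q, forall i, i \in ids F}].
Proof.
elim: p u => [|[e w] p IH] u /=.
  by move=> /eqP->; exists [::]; split=> //=.
case/and3P=> eF /orP[/andP[/eqP uE /eqP wE]|/andP[/eqP uE /eqP wE]] /IH[q [h1 h2 h3 [h4 h5]]].
  exists (gdart e :: q); split.
  - by move=> x; rewrite in_cons => /orP[/eqP->|/h1//]; exact: gdart_mem.
  - by rewrite /= dtl_gdart dhd_gdart uE -wE eqxx.
  - by rewrite /= dhd_gdart h3 wE.
  split; first by rewrite /= h4.
  by move=> i; rewrite /= in_cons => /orP[/eqP->|/h5//]; rewrite mem_ids.
exists (drev (gdart e) :: q); split.
- by move=> x; rewrite in_cons => /orP[/eqP->|/h1//]; exact: gdarts_rev (gdart_mem e).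
- rewrite /= -[dtl _]/(dhd (gdart e)) -[dhd (drev _)]/(dtl (gdart e)).
  by rewrite dtl_gdart dhd_gdart uE -wE eqxx.
- by rewrite /= -[dhd (drev _)]/(dtl (gdart e)) dtl_gdart h3 wE.
split; first by rewrite /= h4.
by move=> i; rewrite /= in_cons => /orP[/eqP->|/h5//]; rewrite mem_ids.
Qed.

Lemma dpath_walk (F : {set edge G}) (u : vertex G) q (v : vertex G) : {subset q <= gdarts} ->
  dpath (val u) q (val v) -> (forall e : edge G, val e \in dids q -> e \in F) ->
  exists p : walk G,
  [/\ is_walk F u p v, heads q = map val (unzip2 p) & dids q = map val (unzip1 p)].
Proof.
elim: q u => [|x q IH] u hs.
  by move=> /= /eqP/val_inj-> _; exists [::]; rewrite /= eqxx.
move=> /= /andP[/eqP xu hq] hF.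
have [e he] := mem_gdarts (hs x (mem_head _ _)).
have hs' : {subset q <= gdarts} by move=> y yq; apply: hs; rewrite in_cons yq orbT.
have hF' (e' : edge G) : val e' \in dids q -> e' \in F.
  by move=> h; apply: hF; rewrite in_cons h orbT.
have xe : did x = val e by case: he => ->.
have eF : e \in F by apply: hF; rewrite xe mem_head.
have [w [hw hj]] : exists w : vertex G, val w = dhd x /\ joins e u w.
  case: he xu => -> {x hs hF hq xe}.
    rewrite dtl_gdart dhd_gdart => /val_inj <-; exists (end2 e).
    by rewrite /joins !eqxx.
  rewrite -[dtl _]/(dhd (gdart e)) -[dhd (drev _)]/(dtl (gdart e)).
  rewrite dtl_gdart dhd_gdart => /val_inj <-; exists (end1 e).
  by rewrite /joins !eqxx orbT.
rewrite -hw in hq *.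
have [p [h1 h2 h3]] := IH w hs' hq hF'.
exists ((e, w) :: p); split; rewrite /= ?h2 ?h3 ?xe //.
by rewrite eF hj.
Qed.

Lemma path_dpath F u (p : walk G) v : is_path F u v p -> exists q : seq dart,
  [/\ {subset q <= gdarts}, dpath (val u) q (val v), uniq (val u :: heads q),
    heads q = map val (unzip2 p)
    & dids q = map val (unzip1 p) /\ {in dids q, forall i, i \in ids F}].
Proof.
case/andP=> /walk_dpath[q [h1 h2 h3 h4]] hu; exists q; split=> //.
by rewrite h3 -map_cons map_inj_uniq //; exact: val_inj.
Qed.

Lemma dpath_path (F : {set edge G}) (u : vertex G) q (v : vertex G) : {subset q <= gdarts} ->
  dpath (val u) q (val v) -> uniq (val u :: heads q) ->
  (forall e : edge G, val e \in dids q -> e \in F) ->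
  exists p : walk G,
  [/\ is_path F u v p, heads q = map val (unzip2 p) & dids q = map val (unzip1 p)].
Proof.
move=> h1 h2 hu h3; have [p [k1 k2 k3]] := dpath_walk h1 h2 h3.
exists p; split=> //; rewrite /is_path k1 /=.
by move: hu; rewrite k2 -map_cons map_inj_uniq //; exact: val_inj.
Qed.

Lemma dids_disjointP (p q : walk G) A B :
  dids A = map val (unzip1 p) -> dids B = map val (unzip1 q) ->
  reflect {in A & B, forall x y, did x <> did y} (edge_disjoint p q).
Proof.
move=> hA hB; apply: (iffP hasPn) => h.
  move=> x y xA yB e.
  have : did y \in dids B by exact: map_f.
  rewrite hB => /mapP[e' he' ee']; have /negP := h e' he'; apply=> /=.
  have : did x \in dids A by exact: map_f.
  by rewrite hA e ee' mem_map //; exact: val_inj.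
move=> e eq; apply/negP => /= ep.
have /mapP[y yB ey] : val e \in dids B by rewrite hB map_f.
have /mapP[x xA ex] : val e \in dids A by rewrite hA map_f.
by apply: (h x y xA yB); rewrite -ex -ey.
Qed.

Lemma disjoint_paths_dpaths F s t (p q : walk G) : s != t ->
  is_path F s t p -> is_path F s t q -> internally_disjoint s t p q ->
  exists A B, [/\ disjoint_dpaths (val s) (val t) A B, {subset A ++ B <= gdarts} &
     {in dids (A ++ B), forall i, i \in ids F}].
Proof.
move=> st /path_dpath[A [a1 a2 a3 a4 [a5 a6]]] /path_dpath[B [b1 b2 b3 b4 [b5 b6]]].
case/andP=> /(dids_disjointP a5 b5) hd /hasPn hi; exists A, B; split.
- split=> //; split=> // r rA rB.
  move: rA rB; rewrite a4 b4 => /mapP[w wp ->] /mapP[w' wq /val_inj ww]; subst w'.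
  have wt : w = t; last by rewrite wt.
  apply/eqP/negPn/negP => wt.
  have ws : w != s.
    apply: contraNneq (_ : s \notin unzip2 p) => [<-//|].
    by move: a3; rewrite a4 /= mem_map => [/andP[]|]; last exact: val_inj.
  have /hi/negP : w \in internal_nodes s t q by rewrite mem_filter ws wt wq.
  by apply; rewrite /= mem_filter ws wt wp.
- by move=> x; rewrite mem_cat => /orP[/a1|/b1].
- by move=> i; rewrite /dids map_cat mem_cat => /orP[/a6|/b6].
Qed.

Lemma dpaths_disjoint_paths (F : {set edge G}) (s t : vertex G) A B :
  disjoint_dpaths (val s) (val t) A B ->
  {subset A ++ B <= gdarts} -> (forall e : edge G, val e \in dids (A ++ B) -> e \in F) ->
  has_disjoint_paths 2 s t F.
Proof.
move=> [a2 b2 a3 b3 [hc hd]] hs hF.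
have [||p [p1 p2 p3]] := dpath_path (F := F) _ a2 a3.
- by move=> x xA; apply: hs; rewrite mem_cat xA.
- by move=> e he; apply: hF; rewrite /dids map_cat mem_cat he.
have [||q [q1 q2 q3]] := dpath_path (F := F) _ b2 b3.
- by move=> x xA; apply: hs; rewrite mem_cat xA orbT.
- by move=> e he; apply: hF; rewrite /dids map_cat mem_cat he orbT.
exists [:: p; q]; split; rewrite //= ?p1 ?q1 // !andbT.
apply/andP; split; first exact/(dids_disjointP p3 q3).
apply/hasPn => w; rewrite mem_filter => /andP[/andP[_ wt] wq].
apply/negP; rewrite /= mem_filter => /andP[_ wp].
have wv : val w = val t by apply: hc; rewrite ?p2 ?q2 map_f.
by move: wt; rewrite (val_inj wv) eqxx.
Qed.

(** Rerouted chains may repeat vertices, while the problem asks for simple paths, so loops are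
    erased; this only removes edges. *)
Lemma dpaths_edge_disjoint_paths (F : {set edge G}) (s t : vertex G) A B :
  edge_disjoint_dpaths (val s) (val t) A B ->
  {subset A ++ B <= gdarts} -> (forall e : edge G, val e \in dids (A ++ B) -> e \in F) ->
  has_edge_disjoint_paths 2 s t F.
Proof.
move=> [a2 b2 hd] hs hF.
have [a3 a4 a5] := eraseP a2; have [b3 b4 b5] := eraseP b2.
have [||p [p1 p2 p3]] := dpath_path (F := F) _ a3 a4.
- by move=> x /a5 xA; apply: hs; rewrite mem_cat xA.
- move=> e /mapP[x /a5 xA ex]; apply: hF.
  by rewrite ex map_f // mem_cat xA.
have [||q [q1 q2 q3]] := dpath_path (F := F) _ b3 b4.
- by move=> x /b5 xA; apply: hs; rewrite mem_cat xA orbT.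
- move=> e /mapP[x /b5 xA ex]; apply: hF.
  by rewrite ex map_f // mem_cat xA orbT.
exists [:: p; q]; split; rewrite //= ?p1 ?q1 // !andbT.
by apply/(dids_disjointP p3 q3) => x y /a5 xA /b5 yB; exact: hd.
Qed.

End Graph.

(** * Correctness of the algorithms *)

Definition raw_dp (i : dp_instance) : rdp :=
  ((nv (dp_graph i), redges (dp_graph i)), (val (dp_s i), val (dp_t i))).

Lemma enc_raw_dp i : enc (raw_dp i) = enc_dp i.
Proof.
by rewrite /enc_dp /enc_graph -enc_redges.
Qed.

Lemma satisfied_dids n ds ws L : wfd n ds -> {subset ws <= ds} -> satisfied L ws ->
  satisfied L [seq x <- ds | did x \in dids ws].
Proof.
move=> wf sub hL x; rewrite mem_filter => /andP[/mapP[y yw e] xds].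
have [h1 h2] := hL y yw.
by case: (proj2 wf y x (sub y yw) xds (esym e)) => ->.
Qed.

Lemma size2P (T : Type) (a : pred T) (r : rel T) :
  (exists ps : seq T, [/\ size ps = 2, all a ps & pairwise r ps]) ->
  exists p q, [/\ a p, a q & r p q].
Proof.
case=> -[|p [|q [|x l]]] [] // _ /= /and3P[hp hq _]; rewrite !andbT => hr.
by exists p, q.
Qed.

(** * The two approximation ratios *)

Section Approximation.
Variable i : dp_instance.
Let G := dp_graph i.
Let s := dp_s i.
Let t := dp_t i.
Let ds := gdarts G.
Let wf : wfd (nv G) ds := gdarts_wf G.
Let st : val s != val t := dp_s_neq_t i.

Local Open Scope ring_scope.

Lemma ratio_of_scaled (F F' : {set edge G}) (w : nat) :
  (scale G)%:R * activation_cost F <= w%:R ->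
  (2 * w <= 3 * \sum_(r < nv G) max_level G (ids F') r)%N ->
  activation_cost F <= 3%:R / 2%:R * activation_cost F'.
Proof.
move=> h1 h2; have s0 : 0 < (scale G)%:R :> rat by rewrite ltr0n scale_gt0.
rewrite -(ler_pM2l s0) mulrCA; apply: (le_trans h1).
rewrite mulrAC ler_pdivlMr ?ltr0n //.
apply: (@le_trans _ _ (3%:R * (\sum_(r < nv G) max_level G (ids F') r)%:R)).
  by rewrite -!natrM ler_nat mulnC.
by rewrite ler_wpM2l ?ler0n // le_activation.
Qed.

Lemma levels_attained es A B u v : {subset A ++ B <= ds} ->
  {in dids (A ++ B), forall j, j \in es} -> dpath u A v -> u != v ->
  forall r, r \in u :: heads A ++ heads B ->
  exists2 k : level, attained ds (max_level G es) k & k.1 = r.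
Proof.
move=> sub hes dA uv r; rewrite in_cons -map_cat => /orP[/eqP->|/mapP[x xAB ->]].
  case: A dA sub hes => [/= /eqP e|x A /= /andP[/eqP <- _] sub hes].
    by rewrite e eqxx in uv.
  by apply: max_level_attained; [apply: sub | apply: hes]; rewrite mem_head.
have xr : drev x \in ds by apply: gdarts_rev; exact: sub.
by apply: (max_level_attained xr); apply: hes; rewrite -[did _]/(did x) map_f.
Qed.

Lemma in_ids_satisfied es A : {subset A <= ds} -> {in dids A, forall j, j \in es} ->
  satisfied (max_level G es) A.
Proof.
move=> sub hes x xA; apply: max_level_satisfied; rewrite mem_filter (sub x xA) andbT.
by apply: hes; exact: map_f.
Qed.

Lemma last_in_heads A B u v : dpath u A v -> v \in u :: heads A ++ heads B.
Proof. by move=> /dpath_last <-; rewrite -cat_cons mem_cat mem_last. Qed.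

Lemma disjoint_bound (F : {set edge G}) : has_disjoint_paths 2 s t F ->
  exists2 p, sp (nv G).+2 (outer_arcs true (nv G) (val s) (val t) ds) = Some p &
    (2 * weight p <= 3 * \sum_(r < nv G) max_level G (ids F) r)%N.
Proof.
case/size2P=> p [q [hp hq hd]].
have [A [B [hAB sub hes]]] := disjoint_paths_dpaths (dp_s_neq_t i) hp hq hd.
have dA : dpath (val s) A (val t) by case: hAB.
have hatt := levels_attained sub hes dA st.
have [k kat ks] := hatt (val s) (mem_head _ _).
have [l lat lt] := hatt (val t) (last_in_heads B dA).
have [r [h1 h2]] := outer_complete_direct true wf st (leqnn _) sub
  (in_ids_satisfied sub hes) hAB kat ks lat lt (ltn_ord _) (ltn_ord _).
by exists r.
Qed.

Lemma edge_disjoint_bound (F : {set edge G}) : has_edge_disjoint_paths 2 s t F ->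
  exists2 p, sp (nv G).+2 (outer_arcs false (nv G) (val s) (val t) ds) = Some p &
    (2 * weight p <= 3 * \sum_(r < nv G) max_level G (ids F) r)%N.
Proof.
case/size2P=> p [q [/path_dpath[A [a1 a2 a3 _ [a5 a6]]] /path_dpath[B [b1 b2 b3 _ [b5 b6]]]]].
move/(dids_disjointP a5 b5) => hd.
have sub : {subset A ++ B <= ds} by move=> x; rewrite mem_cat => /orP[/a1|/b1].
have hes : {in dids (A ++ B), forall j, j \in ids F}.
  by move=> j; rewrite /dids map_cat mem_cat => /orP[/a6|/b6].
have hatt := levels_attained sub hes a2 st.
have [k kat kt] := hatt (val t) (last_in_heads B a2).
have [r [h1 h2]] := outer_complete_edge wf (leqnn _) (isT : ~~ false) sub
  (in_ids_satisfied sub hes) hatt (And3 a2 b2 hd) a3 b3 kat kt (ltn_ord _).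
by exists r.
Qed.

(** Treats both problems through their feasibility predicate [feas]; internally disjoint paths are
    supplied to it only when [direct] is set. *)
Lemma disjoint_alg_solves (direct : bool) (feas : {set edge G} -> Prop) :
  (forall F, feas F -> exists2 p,
    sp (nv G).+2 (outer_arcs direct (nv G) (val s) (val t) ds) = Some p &
    (2 * weight p <= 3 * \sum_(r < nv G) max_level G (ids F) r)%N) ->
  (forall es A B, edge_disjoint_dpaths (val s) (val t) A B ->
     (direct -> exists A B, [/\ disjoint_dpaths (val s) (val t) A B, {subset A ++ B <= ds} &
        {subset dids (A ++ B) <= es}]) ->
     {subset A ++ B <= ds} -> {subset dids (A ++ B) <= es} -> feas (edges_of G es)) ->
  exists o : option {set edge G},
    enc (disjoint_alg direct (raw_dp i)) = enc_option (@enc_set _) o /\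
    match o with
    | Some F => feas F /\ forall F', feas F' ->
        activation_cost F <= 3%:R / 2%:R * activation_cost F'
    | None => forall F, ~ feas F
    end.
Proof.
move=> hcomp hfeas.
rewrite /disjoint_alg /outer /= -/(gdarts G) -/ds -/s -/t.
case E: sp => [p|]; last first.
  by exists None; split=> // F /hcomp[p]; rewrite E.
set es := flatten _.
have [[L h1 h2] [[A [B [h3 h4 h5]]] h6]] := outer_sound wf (@gdarts_rev G) st E (erefl es).
exists (Some (edges_of G es)); split.
  by rewrite -[LHS]/(Node (enc (mask (size (redges G)) es)) Leaf) mask_edges.
split; first exact: hfeas h3 h6 h4 h5.
move=> F' /hcomp[q]; rewrite E => -[<-] hq.
apply: ratio_of_scaled hq; apply: (le_trans (activation_le h2)).
by rewrite ler_nat.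
Qed.

End Approximation.

Lemma disjoint_paths_ratio : admits_approximation_ratio (activation_DP 2) (3%:R / 2%:R)%R.
Proof.
apply: (ptime_runs (raw := raw_dp) (pt_disjoint_alg true) enc_raw_dp) => i.
apply: disjoint_alg_solves; first exact: disjoint_bound.
move=> es _ _ _ /(_ isT)[A [B [h1 h2 h3]]] _ _.
by apply: dpaths_disjoint_paths h1 h2 _ => e /h3; rewrite inE.
Qed.

Lemma edge_disjoint_paths_ratio :
  admits_approximation_ratio (activation_EDP 2) (3%:R / 2%:R)%R.
Proof.
apply: (ptime_runs (raw := raw_dp) (pt_disjoint_alg false) enc_raw_dp) => i.
apply: disjoint_alg_solves; first exact: edge_disjoint_bound.
move=> es A B h1 _ h2 h3.
by apply: dpaths_edge_disjoint_paths h1 h2 _ => e /h3; rewrite inE.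
Qed.

(** * Optimality of the augmentation *)

Section Augmentation.
Variable i : dp_aug_instance 2.
Let G := dp_graph (aug_base i).
Let s := dp_s (aug_base i).
Let t := dp_t (aug_base i).
Let ds := gdarts G.
Let wf : wfd (nv G) ds := gdarts_wf G.
Let st : val s != val t := dp_s_neq_t (aug_base i).
Let E0 : {set edge G} := aug_E0 i.

Definition raw_aug : rdp * seq bool :=
  (raw_dp (aug_base i), [seq e \in aug_E0 i | e <- enum 'I_(ne (dp_graph (aug_base i)))]).

Lemma enc_raw_aug : enc raw_aug = enc_dp_aug i.
Proof.
rewrite /enc_dp_aug -enc_raw_dp /enc_set /raw_aug.
by rewrite -[LHS]/(Node _ (enc [seq e \in aug_E0 i | e <- _])) /enc /Enc_seq -map_comp.
Qed.

Lemma nth_raw_aug (e : edge G) : nth false raw_aug.2 (val e) = (e \in E0).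
Proof. by rewrite (nth_map e) ?size_enum_ord ?ltn_ord // nth_ord_enum. Qed.

Local Open Scope ring_scope.

Lemma aug_alg_solves : exists o : option {set edge G},
  enc (aug_alg raw_aug) = enc_option (@enc_set _) o /\
  match o with
  | Some F => ([disjoint F & E0] /\ has_disjoint_paths 2 s t (E0 :|: F)) /\
      forall F' : {set edge G}, [disjoint F' & E0] /\ has_disjoint_paths 2 s t (E0 :|: F') ->
        activation_cost F <= activation_cost F'
  | None => forall F : {set edge G},
      ~ ([disjoint F & E0] /\ has_disjoint_paths 2 s t (E0 :|: F))
  end.
Proof.
have did_ex x : x \in ds -> exists e : edge G, did x = val e.
  by case/mem_gdarts=> e [] ->; exists e.
have [q [q1 q2 q3 q4]] : exists q : seq dart, [/\ {subset q <= ds},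
    {in q, forall x, nth false raw_aug.2 (did x)}, dpath (val s) q (val t) &
    uniq (val s :: heads q)].
  have [[|p [|x l]] [] //= _ /andP[hp _] _] := aug_E0_paths i.
  have [q [q1 q2 q3 _ [_ q5]]] := path_dpath hp; exists q; split=> // x xq.
  have [e he] := did_ex x (q1 x xq).
  by rewrite he nth_raw_aug -mem_ids -he q5 // map_f.
pose ds0 := [seq x <- ds | nth false raw_aug.2 (did x)].
have sub0 : {subset ds0 <= ds} by move=> x; rewrite mem_filter => /andP[].
have wf0 : wfd (nv G) ds0.
  split; first by move=> x /sub0; exact: (proj1 wf).
  by move=> x y /sub0 xd /sub0 yd; exact: (proj2 wf).
have q5 : {subset q <= ds0} by move=> x xq; rewrite mem_filter q2 ?q1.
(* Only the success of the first search matters, not its cost, so the levels may be taken over all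
   edges. *)
have satq : satisfied (max_level G (dids ds)) q.
  by apply: in_ids_satisfied => // j /mapP[x /q1 xd ->]; exact: map_f.
have [c1 [w1 [E1 _]]] :=
  virtual_complete wf0 st q5 satq q3 (ltn_ord _) (ltn_ord _) (leqnn _).
have [v1 v2 _] := virtual_sound (nv G) st E1.
have [k1 k2 k3] := eraseP v1.
have Pds : {subset erase (val s) w1 <= ds} by move=> x /k3 /v2 /sub0.
have PE (e : edge G) : val e \in dids (erase (val s) w1) -> e \in E0.
  by case/mapP=> x /k3 /v2; rewrite mem_filter -nth_raw_aug => /andP[+ _] ->.
have lower (F : {set edge G}) : has_disjoint_paths 2 s t (E0 :|: F) -> exists c2 w2,
    ear (val s) (val t) (val s :: heads (erase (val s) w1))
      [seq x <- ds | did x \notin dids (erase (val s) w1)] (nv G) = Some (c2, w2) /\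
    (bval c2)%:R <= (scale G)%:R * activation_cost F.
  case/size2P=> p [r [hp hr hd]].
  have [A [B [hAB sub hes]]] := disjoint_paths_dpaths (dp_s_neq_t (aug_base i)) hp hr hd.
  have subA : {subset A <= ds} by move=> x xA; apply: sub; rewrite mem_cat xA.
  have subB : {subset B <= ds} by move=> x xA; apply: sub; rewrite mem_cat xA orbT.
  have sat := in_ids_satisfied sub hes.
  have satA := satisfied_sub (mem_subseq (prefix_subseq A B)) sat.
  have satB := satisfied_sub (mem_subseq (suffix_subseq A B)) sat.
  have [c2 [w2 [E2 h2]]] :=
    stage_complete wf st Pds k1 k2 subA subB satA satB hAB (ltn_ord _) (leqnn _).
  (* The bound from [stage_complete] counts the free edges as well, but they add nothing to the
     activation cost. *)
  exists c2, w2; split=> //; apply: (@le_trans _ _ ((scale G)%:R * activation_cost (E0 :|: F))).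
    by apply: le_trans (le_activation _); rewrite ler_nat.
  by rewrite ler_wpM2l ?ler0n // activation_union_zero // aug_E0_cost.
have -> : aug_alg raw_aug =
    if ear (val s) (val t) (val s :: heads (erase (val s) w1))
      [seq x <- ds | did x \notin dids (erase (val s) w1)] (nv G) is Some r2
    then Some (mask (size (redges G)) [seq j <- dids r2.2 | ~~ nth false raw_aug.2 j])
    else None.
  by rewrite /aug_alg -[ear _ _ _ _ _]/(ear (val s) (val t) [:: val s; val t] ds0 (nv G)) E1.
case E2: ear => [[c2 w2]|]; last first.
  by exists None; split=> // F [_ /lower[c2 [w2 []]]]; rewrite E2.
have [w2ds [L h1 h2] [A [B [hAB sAB]]]] := stage_sound wf st Pds k1 k2 E2.
set es := [seq j <- _ | _].
exists (Some (edges_of G es)); split.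
  by rewrite -[LHS]/(Node (enc (mask (size (redges G)) es)) Leaf) mask_edges.
split; first split.
- apply/pred0P => e /=; rewrite inE mem_filter nth_raw_aug.
  by case: (e \in E0); rewrite ?andbF.
- have sds : {subset A ++ B <= ds} by move=> x /sAB; rewrite mem_cat => /orP[/Pds|/w2ds].
  apply: (dpaths_disjoint_paths hAB sds) => e /mapP[x /sAB xAB ex]; rewrite !inE mem_filter.
  move: xAB; rewrite mem_cat => /orP[xP|xw]; first by rewrite PE // ex map_f.
  by rewrite nth_raw_aug ex map_f // andbT orbN.
move=> F' [_ /lower[c [w []]]]; rewrite E2 => -[<- _] hc.
have s0 : 0 < (scale G)%:R :> rat by rewrite ltr0n scale_gt0.
rewrite -(ler_pM2l s0); apply: le_trans hc.
apply: (@le_trans _ _ (\sum_(r < nv G) L r)%:R); last by rewrite ler_nat.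
apply: activation_le; apply: satisfied_sub (satisfied_dids wf w2ds h2) => x.
by rewrite !mem_filter => /andP[/andP[_ ->] ->].
Qed.

End Augmentation.

Lemma augmentation_polytime : admits_polytime_algorithm (activation_DP_augmentation 2).
Proof. exact: (ptime_runs (raw := raw_aug) pt_aug_alg enc_raw_aug aug_alg_solves). Qed.

Theorem theorem1 :
  admits_polytime_algorithm (activation_DP_augmentation 2) /\
  admits_approximation_ratio (activation_DP 2) (3%:R / 2%:R)%R /\
  admits_approximation_ratio (activation_EDP 2) (3%:R / 2%:R)%R.
Proof.
exact: (conj augmentation_polytime (conj disjoint_paths_ratio edge_disjoint_paths_ratio)).
Qed.
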